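(* For an integer $d\ge 1$ let $\mu_{D_4}(d)$ denote the maximal number of quotient singularities of type $D_4$ that an irreducible surface of degree $d$ in $\mathbb{P}^3(\mathbb{C})$ can have. Then $$\mu_{D_4}(8)\ge 48,\qquad \mu_{D_4}(12)\ge 160\qquad\text{and}\qquad \mu_{D_4}(24)\ge 1440,$$ and consequently, for all integers $k\ge 1$, $$\mu_{D_4}(8k)\ge 48k^3,\qquad \mu_{D_4}(12k)\ge 160k^3\qquad\text{and}\qquad \mu_{D_4}(24k)\ge 1440k^3.$$
   Context: A quotient singularity of type $D_4$ of a complex surface is a point at which the surface is analytically equivalent to the rational double point $D_4$, i.e. to $\{x^2y+y^3+z^2=0\}\subset\mathbb{C}^3$ at the origin. *)

(* Defs.v *)
From HB Require Import structures.
From mathcomp Require Import all_boot all_order all_algebra.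
From mathcomp Require Import complex.
From mathcomp Require mpoly.
From mathcomp Require Import all_classical all_reals all_analysis.

Set Implicit Arguments.
Unset Strict Implicit.
Unset Printing Implicit Defensive.

Import Order.TTheory GRing.Theory Num.Theory.
Import numFieldNormedType.Exports.
(* The notations of mpoly clash with those of the analysis library. *)
Import (canonicals, coercions) mpoly.

Local Open Scope classical_set_scope.
Local Open Scope ring_scope.

(* The field of complex numbers.  It is given the type [numClosedFieldType]
   (rather than being left as [complex R]) so that the topology and the norm
   that every [numFieldType] carries are inferred for it; on [R[i]] the norm is
   the complex modulus. *)
Definition Cplx (R : realType) : numClosedFieldType := R[i].

(* Over the scalar field [Cplx R], [differentiable] means complex
   (Frechet-)differentiable, so on an open set it means holomorphic. *)
Definition holomorphic_on (R : realType) (m n : nat)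
    (U : set 'rV[Cplx R]_m) (f : 'rV[Cplx R]_m -> 'rV[Cplx R]_n) : Prop :=
  open U /\ forall z, U z -> differentiable f z.

(* The germs at [a] of [A] and at [b] of [B] correspond to each other under a
   biholomorphic map [phi : U -> V] (with inverse [psi]) of open neighbourhoods
   in C^n.  Germs are compared as sets, which loses nothing for hypersurfaces
   with a reduced equation. *)
Definition analytically_equivalent (R : realType) (n : nat)
    (A : set 'rV[Cplx R]_n) (a : 'rV[Cplx R]_n)
    (B : set 'rV[Cplx R]_n) (b : 'rV[Cplx R]_n) : Prop :=
  exists (U V : set 'rV[Cplx R]_n) (phi psi : 'rV[Cplx R]_n -> 'rV[Cplx R]_n),
    [/\ holomorphic_on U phi /\ holomorphic_on V psi,
        (forall z, U z -> V (phi z) /\ psi (phi z) = z),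
        (forall w, V w -> U (psi w) /\ phi (psi w) = w),
        U a /\ phi a = b
      & forall z, U z -> (A z <-> B (phi z))].

Definition D4_model (R : realType) : set 'rV[Cplx R]_3 :=
  [set v | let x := v 0 0 in let y := v 0 1 in let z := v 0 2%:R in
           x ^+ 2 * y + y ^+ 3 + z ^+ 2 = 0].

(* The points of P^3(C) are the lines through the origin of C^4. *)
Definition proj3 (R : realType) : set {vspace 'rV[Cplx R]_4} :=
  [set L | \dim L = 1%N].

(* [affine_lift i a] inserts a 1 at position [i] of [a]; the maps
   [a |-> <[affine_lift i a]>] are the four standard affine charts of P^3(C). *)
Definition affine_lift (R : realType) (i : 'I_4) (a : 'rV[Cplx R]_3)
    : 'rV[Cplx R]_4 :=
  \row_j (if unlift i j is Some k then a 0 k else 1).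

Definition affine_part (R : realType) (F : mpoly.mpoly 4 (Cplx R)) (i : 'I_4)
    : set 'rV[Cplx R]_3 :=
  [set a | mpoly.meval (affine_lift i a 0) F = 0].

Definition D4_points (R : realType) (F : mpoly.mpoly 4 (Cplx R))
    : set {vspace 'rV[Cplx R]_4} :=
  [set L | proj3 L /\ exists (i : 'I_4) (a : 'rV[Cplx R]_3),
     L = <[affine_lift i a]>%VS /\
     analytically_equivalent (affine_part F i) a (@D4_model R) 0].

Definition irreducible_mpoly (R : realType) (F : mpoly.mpoly 4 (Cplx R))
    : Prop :=
  [/\ F != 0, F \isn't a GRing.unit
    & forall G H : mpoly.mpoly 4 (Cplx R),
        F = G * H -> G \is a GRing.unit \/ H \is a GRing.unit].

(* [F] defines an irreducible surface of degree [d] of P^3(C). *)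
Definition irreducible_surface (R : realType) (d : nat)
    (F : mpoly.mpoly 4 (Cplx R)) : Prop :=
  F \is mpoly.ishomog1 d mpoly.mdeg /\ irreducible_mpoly F.

(* [counting A] is the number of elements of [A], +oo if [A] is infinite.  D4
   points are isolated singular points and their number is bounded in terms of
   [d], so the supremum is a maximum; when there is no irreducible surface of
   degree [d] (d = 0), it is -oo. *)
Definition mu_D4 (R : realType) (d : nat) : \bar R :=
  ereal_sup [set counting (D4_points F) | F in @irreducible_surface R d].

(* Main.v *)
(* A surface F = 0 of degree d with N points of type D4, none of them on the
   faces y_0 y_1 y_2 y_3 = 0 of a suitable tetrahedron, pulls back under the map
   (x_i) |-> (y_i) = (x_i^k) to a surface of degree dk with N k^3 points of type
   D4, since that map is etale of degree k^3 outside the faces.  The pullback is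
   irreducible: two factors would have a common zero in any plane, and the face
   planes being chosen so that the plane y_0 = y_3 meets the ramified critical
   locus of F only in D4 points outside the faces, such a zero would be a D4
   point, whose germ is irreducible.  It remains to exhibit F for d = 8, 12, 24:
   the last two are invariants of the reflection groups G_29 and G_32, and the
   D4 points are obtained from one of them by symmetries.

   A point is recognized as D4 from an equation U z^2 + z q(u, v) + c(u, v) = 0,
   with c = c0 u^3 + c1 u^2 v + c2 u v^2 + c3 v^3 diagonal at the point: after
   completing the square, the inverse function theorem diagonalizes the nearby
   cubic forms, and a sum of two cubes is x^2 y + y^3 in suitable coordinates.

   The points have coordinates in Z[w, i], where w is a cube root of unity, and
   are distinguished by residues modulo a prime. *)
From Stdlib Require Import ZArith.
From HB Require Import structures.
Require Import Defs.
From mathcomp Require Import all_boot all_order all_algebra.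
From mathcomp Require Import separable cyclotomic complex.
From mathcomp Require mpoly.
From mathcomp Require Import all_classical all_reals all_analysis.
From mathcomp Require Import ring lra zify ssrZ.

Set Implicit Arguments.
Unset Strict Implicit.
Unset Printing Implicit Defensive.

Import Order.TTheory GRing.Theory Num.Theory.
Import numFieldNormedType.Exports.
Import (canonicals, coercions) mpoly.

Delimit Scope Z_scope with BZ.
Local Open Scope classical_set_scope.
Local Open Scope ring_scope.

(** * Strict differentiability and the inverse function theorem over C *)

(** The tetrahedron has two tasks that pull apart: its trace on the plane [y_0 = y_3] must be in
    good position with respect to the critical points of F, and its faces must avoid all D4 points.
    On that plane the faces y_0 = 0 and y_3 = 0 cut the same line, and the vertices 0 and 3 enter
    only through their sum, so the trace is a mere triangle. Taking the vertices p - n, q, r, n,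
    with p, q, r in the plane x_4 = 0 and n = (n1, n2, n3, 1) outside it, makes [y_0 = y_3] the
    plane x_4 = 0 and turns the critical condition into a statement about the ternary form F(x_1,
    x_2, x_3, 0), independent of n. The integers n1, n2, n3 remain free to move the faces off the D4
    points. In degrees 8 and 12 the triangle p, q, r is the coordinate triangle. In degree 24 its
    edges carry D4 points, such as (1, i, 0, 0), and the triangle (1, 1, -1), (-1, 1, 1), (1, -1, 1)
    replaces it. Neither condition involves k, so one tetrahedron serves all the covers. *)

Section RealNorm.
Variable R : realType.
Local Notation C := (Cplx R).

(** The norm of a module over C takes values in C, which is only partially ordered. Its real part
    brings all estimates into the ordered field [R], where [lra] applies. *)
Definition nr (V : normedModType C) (x : V) : R := complex.Re (`|x| : R[i]).

Lemma nrE (V : normedModType C) (x : V) : `|x| = ((nr x)%:C)%C :> C.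
Proof.
have /ger0_real := normr_ge0 x; rewrite /nr => h.
have : (`|x| : R[i]) \is Num.real by exact: h.
by move=> /RRe_real ->.
Qed.

Lemma ler_nr (V W : normedModType C) (x : V) (y : W) :
  (nr x <= nr y) = (`|x| <= `|y|).
Proof. by rewrite !nrE [RHS]lecR. Qed.

Lemma nr_le (V : normedModType C) (x : V) (e : R) :
  (nr x <= e) = (`|x| <= (e%:C)%C :> C).
Proof. by rewrite !nrE [RHS]lecR. Qed.

Lemma nr_lt (V : normedModType C) (x : V) (e : R) :
  (nr x < e) = (`|x| < (e%:C)%C :> C).
Proof. by rewrite !nrE [RHS]ltcR. Qed.

Lemma nr_ge0 (V : normedModType C) (x : V) : 0 <= nr x.
Proof. by have := normr_ge0 x; rewrite nrE (_ : (0 : C) = (0%:C)%C) // [X in is_true X]lecR. Qed.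

Lemma nr0 (V : normedModType C) : nr (0 : V) = 0.
Proof. by rewrite /nr normr0. Qed.

Lemma nr_eq0 (V : normedModType C) (x : V) : (nr x == 0) = (x == 0).
Proof.
apply/eqP/eqP => [h|->]; last exact: nr0.
by apply/eqP; rewrite -normr_eq0 nrE h.
Qed.

Lemma nrN (V : normedModType C) (x : V) : nr (- x) = nr x.
Proof. by rewrite /nr normrN. Qed.

Lemma nrD (V : normedModType C) (x y : V) : nr (x + y) <= nr x + nr y.
Proof. by rewrite nr_le rmorphD /= -!nrE; exact: ler_normD. Qed.

Lemma nrB (V : normedModType C) (x y : V) : nr (x - y) = nr (y - x).
Proof. by rewrite -nrN opprB. Qed.

Lemma nr_dist (V : normedModType C) (z x y : V) : nr (x - y) <= nr (x - z) + nr (z - y).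
Proof. by rewrite -(subrKA z); exact: nrD. Qed.

Definition nrs (x : C) : R := nr (x : C^o).

Lemma nrsM (x y : C) : nrs (x * y) = nrs x * nrs y.
Proof.
have h (z : C) : `|z| = ((nrs z)%:C)%C :> C by exact: (nrE (z : C^o)).
have : ((nrs (x * y))%:C)%C = (((nrs x) * (nrs y))%:C)%C :> R[i].
  by rewrite -h [LHS]normrM rmorphM /= -!h.
by case.
Qed.

Lemma nrZ (V : normedModType C) (z : C) (v : V) : nr (z *: v) = nrs z * nr v.
Proof.
have h : `|z| = ((nrs z)%:C)%C :> C by exact: (nrE (z : C^o)).
have : ((nr (z *: v))%:C)%C = (((nrs z) * (nr v))%:C)%C :> C.
  by rewrite -nrE normrZ h nrE -[LHS]rmorphM.
by case.
Qed.

Lemma nrs_real (x : R) : 0 <= x -> nrs (x%:C)%C = x.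
Proof.
move=> x0; rewrite /nrs /nr.
rewrite (_ : (`|((x%:C)%C : C^o)| : R[i]) = (`|(x%:C)%C| : R[i])) //.
by rewrite normc_def /= expr0n /= addr0 sqrtr_sqr ger0_norm.
Qed.

Lemma nr_coord n (x : 'rV[C]_n) i : nrs (x ord0 i) <= nr x.
Proof.
rewrite /nrs ler_nr /= [X in _ <= X]mx_normE.
exact: (@le_bigmax _ _ _ _ (fun ij : 'I_1 * 'I_n => widen_itv `|x ij.1 ij.2|%:itv : {nonneg C}) (ord0, i)).
Qed.

Lemma nr_rV_le n (x : 'rV[C]_n) (e : R) : 0 <= e -> (forall i, nrs (x ord0 i) <= e) -> nr x <= e.
Proof.
move=> e0 h; have [->|x0] := eqVneq x 0; first by rewrite nr0.
have : mx_norm x != 0.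
  by apply/eqP => /mx_norm_eq0 => /eqP; rewrite (negPf x0).
move/mx_norm_neq0 => [[i j] /= hx].
have -> : nr x = nrs (x ord0 j).
  by rewrite /nrs /nr (_ : `|x| = mx_norm x) // hx /= (ord1 i).
exact: h.
Qed.

(** The sum of the moduli of all entries bounds the operator norm for the sup norm. The added 1
    keeps the constant positive, so that later tolerances may be divided by it. *)
Lemma nr_mulmx n m (M : 'M[C]_(n, m)) :
  exists2 K : R, 0 < K & forall h : 'rV[C]_n, nr (h *m M) <= K * nr h.
Proof.
exists (1 + \sum_i \sum_j nrs (M i j)).
  rewrite ltr_pwDl // sumr_ge0 // => i _; apply: sumr_ge0 => j _; exact: nr_ge0.
move=> h; have nh := nr_ge0 h.
have nM i j : 0 <= nrs (M i j) by exact: nr_ge0.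
have S0 : 0 <= \sum_i \sum_j nrs (M i j).
  by apply: sumr_ge0 => i _; apply: sumr_ge0.
apply: nr_rV_le => [|j]; first by rewrite mulr_ge0 // addr_ge0.
rewrite mxE.
apply: (@le_trans _ _ (\sum_i nrs (h ord0 i * M i j))).
  elim/big_rec2: _ => [|i y1 y2 _ ih]; first by rewrite /nrs nr0.
  by apply: (le_trans (nrD (_ : C^o) (_ : C^o))); rewrite lerD2l.
rewrite mulrDl mul1r ler_wpDl // mulr_suml; apply: ler_sum => i _.
rewrite nrsM mulrC; apply: ler_pM => //; [exact: nr_ge0| |exact: nr_coord].
by rewrite (bigD1 j) //= lerDl sumr_ge0.
Qed.

End RealNorm.

(** * Limits of sequences with geometrically decreasing steps *)

Section GeometricConvergence.
Variable R : realType.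
Local Notation C := (Cplx R).

Local Notation h k := ((2^-1 : R) ^+ k).

(** Nested intervals: u k - 2 c 2^-k increases and u k + 2 c 2^-k decreases, so the supremum of the
    lower ends lies in every interval. *)
Lemma geo_cvg_real (u : nat -> R) (c : R) :
  (forall k, `|u k.+1 - u k| <= c * h k) ->
  exists l, forall k, `|u k - l| <= 2 * c * h k.
Proof.
move=> hu.
have hS k : h k.+1 = h k / 2 by rewrite exprS mulrC.
pose v k := u k - 2 * c * h k; pose w k := u k + 2 * c * h k.
have hk k := hu k; have vS k : v k <= v k.+1.
  by have := hk k; rewrite ler_norml /v hS => /andP[]; lra.
have wS k : w k.+1 <= w k.
  by have := hk k; rewrite ler_norml /w hS => /andP[]; lra.
have c0 : 0 <= c.
  by have := hk 0; rewrite expr0 mulr1; apply: le_trans.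
have h0 k : 0 <= h k by rewrite exprn_ge0.
have vw k : v k <= w k.
  have : 0 <= c * h k by rewrite mulr_ge0.
  rewrite /v /w; lra.
have vh : {homo v : x y / (x <= y)%N >-> x <= y} by apply: homo_leq => // ? ? ?; exact: le_trans.
have wh : {homo w : x y / (x <= y)%N >-> y <= x}.
  apply: (@homo_leq _ w (fun x y => y <= x)) => //.
  by move=> y x z /[swap]; exact: le_trans.
have vw2 i j : v i <= w j.
  apply: le_trans (vh i (maxn i j) (leq_maxl _ _)) _.
  by apply: le_trans (vw _) (wh j _ (leq_maxr _ _)).
have sv : has_sup (range v).
  by split; [exists (v 0%N), 0%N|exists (w 0%N) => _ [i _ <-]].
exists (sup (range v)) => k.
have h1 : v k <= sup (range v) by apply: (sup_upper_bound sv); exists k.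
have h2 : sup (range v) <= w k by apply: ge_sup; [exists (v 0%N), 0%N|move=> _ [i _ <-]].
by rewrite ler_norml; move: h1 h2; rewrite /v /w => ? ?; apply/andP; split; lra.
Qed.

Lemma nrs_Re (z : C) : `|complex.Re (z : R[i])| <= nrs z.
Proof.
have := normc_ge_Re (z : R[i]); rewrite (_ : (`|(z : R[i])|) = ((nrs z)%:C)%C); first by rewrite lecR.
exact: (nrE (z : C^o)).
Qed.

Lemma nrs_Im (z : C) : `|complex.Im (z : R[i])| <= nrs z.
Proof.
have -> : nrs z = nrs ((0 +i* -1)%C * (z : R[i]) : C).
  rewrite nrsM [X in X * _](_ : _ = 1) ?mul1r //.
  by rewrite /nrs /nr (_ : (`| (0 +i* -1)%C : C^o| : R[i]) = `|(0 +i* -1)%C : R[i]|) // normc_def /= expr0n /= sqrrN expr1n add0r sqrtr1.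
have := nrs_Re ((0 +i* -1)%C * (z : R[i]) : C).
by case: z => a b /=; rewrite mul0r sub0r mulN1r opprK.
Qed.

Lemma nrs_le_ReIm (z : C) : nrs z <= `|complex.Re (z : R[i])| + `|complex.Im (z : R[i])|.
Proof.
case: z => a b /=.
have -> : ((a +i* b)%C : C) = (a%:C)%C + (0 +i* 1)%C * (b%:C)%C.
  by apply/eqP; rewrite eq_complex /= !mul0r !mul1r subr0 addr0 !add0r !eqxx.
apply: (le_trans (nrD (_ : C^o) (_ : C^o))).
have hr (x : R) : nr (((x%:C)%C : C) : C^o) = `|x|.
  rewrite /nr (_ : (`|((x%:C)%C : C) : C^o| : R[i]) = `|(x%:C)%C : R[i]|) //.
  by rewrite normc_def /= expr0n /= addr0 sqrtr_sqr.
rewrite hr lerD2l -/(nrs _) nrsM [X in _ * X]hr.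
by rewrite /nrs /nr (_ : (`| (0 +i* 1)%C : C^o| : R[i]) = `|(0 +i* 1)%C : R[i]|) // normc_def /= expr0n /= expr1n add0r sqrtr1 mul1r.
Qed.

(** Real and imaginary parts of each coordinate converge separately; their two errors of 2 c add up
    to 4 c. *)
Lemma geo_cvg_rV n (u : nat -> 'rV[C]_n) (c : R) :
  (forall k, nr (u k.+1 - u k) <= c * h k) ->
  exists l, forall k, nr (u k - l) <= 4 * c * h k.
Proof.
move=> hu.
have c0 : 0 <= c.
  by have := hu 0; rewrite expr0 mulr1; apply: le_trans; exact: nr_ge0.
have H i : exists l : C, forall k, nrs (u k ord0 i - l) <= 4 * c * h k.
  have [|a ha] := @geo_cvg_real (fun k => complex.Re (u k ord0 i : R[i])) c.
    move=> k; apply: le_trans (hu k).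
    apply: le_trans (nr_coord _ i); rewrite !mxE; apply: le_trans (nrs_Re _).
    by rewrite raddfB.
  have [|b hb] := @geo_cvg_real (fun k => complex.Im (u k ord0 i : R[i])) c.
    move=> k; apply: le_trans (hu k).
    apply: le_trans (nr_coord _ i); rewrite !mxE; apply: le_trans (nrs_Im _).
    by rewrite raddfB.
  exists (a +i* b)%C => k; apply: (le_trans (nrs_le_ReIm _)).
  have -> : complex.Re ((u k ord0 i : R[i]) - (a +i* b)%C) = complex.Re (u k ord0 i : R[i]) - a by rewrite raddfB.
  have -> : complex.Im ((u k ord0 i : R[i]) - (a +i* b)%C) = complex.Im (u k ord0 i : R[i]) - b by rewrite raddfB.
  have := ha k; have := hb k; lra.
have [l hl] := choice H.
exists (\row_i l i) => k; apply: nr_rV_le => [|i].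
  by rewrite mulr_ge0 ?exprn_ge0 // mulr_ge0.
by rewrite !mxE; exact: hl.
Qed.

Lemma geo_small (t c : R) : (forall k, t <= c * h k) -> t <= 0.
Proof.
move=> ht; rewrite leNgt; apply/negP => t0.
have c0 : 0 < c by have := ht 0; rewrite expr0 mulr1; exact: lt_le_trans.
have [k hk] : exists k, c / t < 2 ^+ k.
  exists (Num.bound (c / t)); apply: lt_trans (archi_boundP (ltW (divr_gt0 c0 t0))) _.
  by rewrite -natrX ltr_nat ltn_expl.
have := ht k; rewrite exprVn ler_pdivlMr ?exprn_gt0 // leNgt mulrC => /negP; apply.
by rewrite -ltr_pdivrMr.
Qed.

End GeometricConvergence.

(** * Strict differentiability *)

Section StrictDifferentiability.
Variable R : realType.
Local Notation C := (Cplx R).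

(* Strict differentiability is used instead of continuity of the derivative: it
   composes without a mean value inequality, which is missing over C. *)
Definition sdiff n m (f : 'rV[C]_n -> 'rV[C]_m) (a : 'rV[C]_n) (M : 'M[C]_(n, m)) :=
  forall e : R, 0 < e -> exists2 d : R, 0 < d &
    forall x y, nr (x - a) < d -> nr (y - a) < d ->
      nr (f x - f y - (x - y) *m M) <= e * nr (x - y).

Definition sdiffs n (f : 'rV[C]_n -> C) (a : 'rV[C]_n) (g : 'cV[C]_n) :=
  forall e : R, 0 < e -> exists2 d : R, 0 < d &
    forall x y, nr (x - a) < d -> nr (y - a) < d ->
      nrs (f x - f y - ((x - y) *m g) ord0 ord0) <= e * nr (x - y).

Lemma nrsD (x y : C) : nrs (x + y) <= nrs x + nrs y.
Proof. exact: (nrD (x : C^o)). Qed.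

Lemma nrs_ge0 (x : C) : 0 <= nrs x.
Proof. exact: nr_ge0. Qed.

Lemma nrs0 : nrs (0 : C) = 0.
Proof. exact: (nr0 _). Qed.

Lemma sdiffs_lip n (f : 'rV[C]_n -> C) a g : sdiffs f a g ->
  exists L : R, exists d : R, [/\ 0 < L, 0 < d & forall x y, nr (x - a) < d -> nr (y - a) < d ->
      nrs (f x - f y) <= L * nr (x - y)].
Proof.
move=> hf; have [d d0 hd] := hf 1 ltr01; have [K K0 hK] := nr_mulmx g.
exists (1 + K), d; split => // [|x y hx hy]; first by rewrite addr_gt0.
rewrite -[f x - f y](subrK (((x - y) *m g) ord0 ord0)).
apply: (le_trans (nrsD _ _)); rewrite mulrDl; apply: lerD; first exact: hd.
by apply: le_trans (hK _); exact: nr_coord.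
Qed.

Lemma sdiff_lip n m (f : 'rV[C]_n -> 'rV[C]_m) a M : sdiff f a M ->
  exists L : R, exists d : R, [/\ 0 < L, 0 < d & forall x y, nr (x - a) < d -> nr (y - a) < d ->
      nr (f x - f y) <= L * nr (x - y)].
Proof.
move=> hf; have [d d0 hd] := hf 1 ltr01; have [K K0 hK] := nr_mulmx M.
exists (1 + K), d; split => // [|x y hx hy]; first by rewrite addr_gt0.
rewrite -[f x - f y](subrK ((x - y) *m M)).
by apply: (le_trans (nrD _ _)); rewrite mulrDl; apply: lerD; [exact: hd|exact: hK].
Qed.

Lemma sdiffs_cst n (c : C) (a : 'rV[C]_n) : sdiffs (fun=> c) a 0.
Proof.
move=> e e0; exists 1 => // x y _ _.
by rewrite mulmx0 mxE !subrr nrs0 mulr_ge0 ?nr_ge0 // ltW.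
Qed.

Lemma sdiffs_coord n i (a : 'rV[C]_n) : sdiffs (fun x => x ord0 i) a (delta_mx i ord0).
Proof.
move=> e e0; exists 1 => // x y _ _.
rewrite -colE !mxE subrr nrs0 mulr_ge0 ?nr_ge0 // ltW //.
Qed.

Lemma sdiffsD n (f h : 'rV[C]_n -> C) a gf gh : sdiffs f a gf -> sdiffs h a gh ->
  sdiffs (fun x => f x + h x) a (gf + gh).
Proof.
move=> hf hh e e0; have e2 : 0 < e / 2 by rewrite divr_gt0.
have [d1 d10 h1] := hf _ e2; have [d2 d20 h2] := hh _ e2.
exists (Num.min d1 d2); first by rewrite lt_min d10.
move=> x y; rewrite !lt_min => /andP[x1 x2] /andP[y1 y2].
have -> : ((x - y) *m (gf + gh)) ord0 ord0 = ((x - y) *m gf) ord0 ord0 + ((x - y) *m gh) ord0 ord0.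
  by rewrite mulmxDr mxE.
rewrite (_ : _ - _ - _ = (f x - f y - ((x - y) *m gf) ord0 ord0)
   + (h x - h y - ((x - y) *m gh) ord0 ord0)); last by ring.
by apply: (le_trans (nrsD _ _)); apply: (le_trans (lerD (h1 x y x1 y1) (h2 x y x2 y2))); rewrite -mulrDl -splitr.
Qed.

Lemma sdiffs_eq n (f h : 'rV[C]_n -> C) a g : (forall x, f x = h x) -> sdiffs f a g -> sdiffs h a g.
Proof. by move=> /funext ->. Qed.

Lemma sdiffsM n (f h : 'rV[C]_n -> C) a gf gh : sdiffs f a gf -> sdiffs h a gh ->
  sdiffs (fun x => f x * h x) a (h a *: gf + f a *: gh).
Proof.
move=> hf hh e e0.
have [Lf [df [Lf0 df0 lf]]] := sdiffs_lip hf; have [Lh [dh [Lh0 dh0 lh]]] := sdiffs_lip hh.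
have [Kf Kf0 hKf] := nr_mulmx gf; have [Kh Kh0 hKh] := nr_mulmx gh.
(* f x h x - f y h y = h(a)(f x - f y) + f(a)(h x - h y)
     + (h x - h(a))(f x - f y) + (f y - f(a))(h x - h y) *)
pose s := 1 + nrs (h a) + nrs (f a).
have s0 : 0 < s by rewrite /s; have := nrs_ge0 (h a); have := nrs_ge0 (f a); lra.
have es : 0 < e / 2 / s by rewrite !divr_gt0.
have [d1 d10 h1] := hf _ es; have [d2 d20 h2] := hh _ es.
pose t := e / 4 / (Lf * Lh).
have t0 : 0 < t by rewrite !divr_gt0 // mulr_gt0.
exists (Num.min (Num.min df dh) (Num.min (Num.min d1 d2) t)).
  by rewrite !lt_min df0 dh0 d10 d20.
move=> x y; rewrite !lt_min => /andP[/andP[x1 x2] /andP[/andP[x3 x4] x5]] /andP[/andP[y1 y2] /andP[/andP[y3 y4] y5]].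
have a1 : nr (a - a) < df by rewrite subrr nr0.
have a2 : nr (a - a) < dh by rewrite subrr nr0.
have -> : ((x - y) *m (h a *: gf + f a *: gh)) ord0 ord0 =
    h a * ((x - y) *m gf) ord0 ord0 + f a * ((x - y) *m gh) ord0 ord0.
  by rewrite mulmxDr -!scalemxAr; set P := _ *m gf; set Q := _ *m gh; rewrite !mxE.
rewrite (_ : _ - _ - _ = h a * (f x - f y - ((x - y) *m gf) ord0 ord0)
   + f a * (h x - h y - ((x - y) *m gh) ord0 ord0) +
   ((h x - h a) * (f x - f y) + (f y - f a) * (h x - h y))); last by ring.
apply: (le_trans (nrsD _ _)).
have N0 := nr_ge0 (x - y).
have B1 : nrs ((h x - h a) * (f x - f y)) <= e / 4 * nr (x - y).
  rewrite nrsM; apply: (@le_trans _ _ ((Lh * t) * (Lf * nr (x - y)))).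
    apply: ler_pM; rewrite ?nrs_ge0 //; last exact: lf.
    apply: (le_trans (lh x a x2 a2)); rewrite ler_pM2l //; exact: ltW.
  by rewrite (_ : _ * _ = e / 4 * nr (x - y)) // /t; field; rewrite ?gt_eqF.
have B2 : nrs ((f y - f a) * (h x - h y)) <= e / 4 * nr (x - y).
  rewrite nrsM; apply: (@le_trans _ _ ((Lf * t) * (Lh * nr (x - y)))).
    apply: ler_pM; rewrite ?nrs_ge0 //; last exact: lh.
    apply: (le_trans (lf y a y1 a1)); rewrite ler_pM2l //; exact: ltW.
  by rewrite (_ : _ * _ = e / 4 * nr (x - y)) // /t; field; rewrite ?gt_eqF.
have B3 : nrs (h a * (f x - f y - ((x - y) *m gf) ord0 ord0)
   + f a * (h x - h y - ((x - y) *m gh) ord0 ord0)) <= e / 2 * nr (x - y).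
  apply: (@le_trans _ _ ((nrs (h a) + nrs (f a)) * (e / 2 / s * nr (x - y)))).
    apply: (le_trans (nrsD _ _)); rewrite !nrsM mulrDl.
    by apply: lerD; (apply: ler_wpM2l; first exact: nrs_ge0); [exact: h1|exact: h2].
  rewrite mulrA ler_wpM2r // mulrCA ler_piMr ?divr_ge0 ?(ltW e0) //.
  by rewrite ltW // ltr_pdivrMr // mul1r /s; move: (nrs _) (nrs _); clear=> p q; lra.
apply: (le_trans (lerD B3 (le_trans (nrsD _ _) (lerD B1 B2)))).
by move: (nr _); clear=> p; lra.
Qed.

Lemma sdiff_row n m (f : 'I_m -> 'rV[C]_n -> C) a g : (forall j, sdiffs (f j) a (g j)) ->
  sdiff (fun x => \row_j f j x) a (\matrix_(i, j) g j i ord0).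
Proof.
move=> hf e e0.
have [d hd] := choice (fun j => (let: ex_intro2 d d0 h := hf j e e0 in
   ex_intro _ d (conj d0 h)) : exists d, 0 < d /\ (forall x y, nr (x - a) < d -> nr (y - a) < d ->
      nrs (f j x - f j y - ((x - y) *m g j) ord0 ord0) <= e * nr (x - y))).
exists (\big[Num.min/1]_j d j).
  by elim/big_ind: _ => // [x y x0 y0|j _]; [rewrite lt_min x0|case: (hd j)].
move=> x y hx hy; apply: nr_rV_le => [|j]; first by rewrite mulr_ge0 ?nr_ge0 // ltW.
have [_ /(_ x y)] := hd j.
have lej : \big[Num.min/1]_j d j <= d j by exact: bigmin_le.
move=> /(_ (lt_le_trans hx lej) (lt_le_trans hy lej)).
rewrite [X in nrs (_ - X)]mxE !mxE; congr (nrs (_ - _) <= _).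
by apply: eq_bigr => i _; rewrite !mxE.
Qed.

Lemma sdiff_comp n m p (f : 'rV[C]_n -> 'rV[C]_m) (h : 'rV[C]_m -> 'rV[C]_p) a M N :
  sdiff f a M -> sdiff h (f a) N -> sdiff (fun x => h (f x)) a (M *m N).
Proof.
move=> hf hh e e0.
have [L [df [L0 df0 lf]]] := sdiff_lip hf.
have [K K0 hK] := nr_mulmx N.
have e1 : 0 < e / 2 / K by rewrite !divr_gt0.
have e2 : 0 < e / 2 / L by rewrite !divr_gt0.
have [d1 d10 h1] := hf _ e1; have [d2 d20 h2] := hh _ e2.
have t0 : 0 < d2 / L by rewrite divr_gt0.
exists (Num.min df (Num.min d1 (d2 / L))); first by rewrite !lt_min df0 d10.
move=> x y; rewrite !lt_min => /and3P[x1 x2 x3] /and3P[y1 y2 y3].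
have a1 : nr (a - a) < df by rewrite subrr nr0.
have X : nr (f x - f a) < d2.
  by apply: (le_lt_trans (lf x a x1 a1)); rewrite mulrC -ltr_pdivlMr.
have Y : nr (f y - f a) < d2.
  by apply: (le_lt_trans (lf y a y1 a1)); rewrite mulrC -ltr_pdivlMr.
rewrite (_ : _ - _ = (h (f x) - h (f y) - (f x - f y) *m N)
   + (f x - f y - (x - y) *m M) *m N); last first.
  by rewrite [X in _ = _ + X]mulmxBl -mulmxA addrA subrK.
apply: (le_trans (nrD _ _)).
have -> : e * nr (x - y) = e / 2 / L * (L * nr (x - y)) + K * (e / 2 / K * nr (x - y)).
  by field; rewrite !gt_eqF.
apply: lerD.
  by apply: (le_trans (h2 _ _ X Y)); rewrite ler_pM2l //; exact: lf.
by apply: (le_trans (hK _)); rewrite ler_pM2l //; exact: h1.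
Qed.

Lemma sdiffs_comp n m (f : 'rV[C]_n -> 'rV[C]_m) (h : 'rV[C]_m -> C) a M g :
  sdiff f a M -> sdiffs h (f a) g -> sdiffs (fun x => h (f x)) a (M *m g).
Proof.
move=> hf hh.
have := @sdiff_comp _ _ 1 f (fun x => \row_j h x) a M (\matrix_(i, j) g i ord0) hf.
move=> /(_ (sdiff_row (fun=> hh))) H e /H [d d0 hd]; exists d => // x y hx hy.
apply: le_trans (hd x y hx hy); apply: le_trans (nr_coord _ ord0).
rewrite !mxE; rewrite le_eqVlt; apply/orP; left; apply/eqP; congr (nrs (_ - _)).
by apply: eq_bigr => i _; congr (_ * _); rewrite !mxE; apply: eq_bigr => j _; rewrite !mxE.
Qed.

(** Putting y = a in the strict estimate gives the Frechet expansion over the scalars C. This is the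
    link to [holomorphic_on]. *)
Lemma sdiff_differentiable n m (f : 'rV[C]_n -> 'rV[C]_m) a M :
  sdiff f a M -> differentiable f a.
Proof.
move=> hf; pose df : {linear 'rV[C]_n -> 'rV[C]_m} := mulmxr M.
have [K K0 hK] := nr_mulmx M.
have cdf : continuous df.
  apply/linear_bounded_continuous; apply/linear_boundedP.
  exists ((K%:C)%C : C); split; first by rewrite /=; apply: gtr0_real; rewrite [X in is_true X]ltcR.
  move=> r hr x; apply: le_trans (_ : (K%:C)%C * `|x| <= _); last first.
    by rewrite ler_wpM2r // ltW.
  by rewrite [`|x|]nrE -[X in _ <= X]rmorphM /= -nr_le; exact: hK.
have edf : f \o shift a = cst (f a) + df +o_ (nbhs (0 : 'rV[C]_n)) id.
  apply/eqaddoP => e e0.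
  have er : e = ((complex.Re (e : R[i]))%:C)%C.
    by have /gtr0_real : 0 < e by []; move=> /RRe_real.
  have re0 : 0 < complex.Re (e : R[i]) by rewrite -ltcR -er.
  have [d d0 hd] := hf _ re0.
  have dC0 : 0 < ((d%:C)%C : C) by rewrite [X in is_true X]ltcR.
  apply/nbhs_ballP; exists ((d%:C)%C : C) => // h; rewrite -ball_normE /ball_ /= sub0r normrN -nr_lt => hh.
  rewrite [X in X <= _]nrE er [`|h|]nrE -[X in _ <= X]rmorphM /= [X in is_true X]lecR.
  have := hd (h + a) a; rewrite addrK subrr nr0 => /(_ hh d0).
  by rewrite opprD addrA.
have E := diff_unique cdf edf.
by apply/diff_locallyP; rewrite E.
Qed.

End StrictDifferentiability.

(** * The inverse function theorem *)

Section InverseFunction.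
Variable R : realType.
Local Notation C := (Cplx R).

(** Stands for continuous differentiability near [a]: strict differentiability at every point of a
    ball. *)
Definition nice n m (f : 'rV[C]_n -> 'rV[C]_m) (a : 'rV[C]_n) :=
  exists2 d : R, 0 < d & forall x, nr (x - a) < d -> exists M, sdiff f x M.

Definition nices n (f : 'rV[C]_n -> C) (a : 'rV[C]_n) :=
  exists2 d : R, 0 < d & forall x, nr (x - a) < d -> exists g, sdiffs f x g.

Definition nball n (a : 'rV[C]_n) (r : R) : set 'rV[C]_n := [set x | nr (x - a) < r].

Lemma open_nball n (a : 'rV[C]_n) r : open (nball a r).
Proof.
rewrite (_ : nball a r = ball a ((r%:C)%C : C)); first exact: ball_open.
by apply/seteqP; split => x; rewrite -ball_normE /nball /ball_ /= nrB nr_lt.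
Qed.

Lemma open_nbhs_nball n (U : set 'rV[C]_n) :
  (forall x, U x -> exists2 d : R, 0 < d & nball x d `<=` U) -> open U.
Proof.
move=> h; rewrite openE => x /h [d d0 hd]; apply: filterS hd _.
by apply: open_nbhs_nbhs; split; [exact: open_nball|rewrite /nball /= subrr nr0].
Qed.

Local Notation h k := ((2^-1 : R) ^+ k).

(** The iterates of [T] from [a] move by at most 2^-k r / 8 at step k. They stay within r / 4 of [a]
    and their limit within r / 2, inside the ball where [T] contracts. *)
Lemma contraction_fixpoint n (T : 'rV[C]_n -> 'rV[C]_n) (a : 'rV[C]_n) (r : R) :
  (forall x y, nr (x - a) < r -> nr (y - a) < r -> nr (T x - T y) <= nr (x - y) / 2) ->
  nr (T a - a) <= r / 8 -> 0 < r -> exists2 x, nr (x - a) <= r / 2 & T x = x.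
Proof.
move=> hT ha r0; pose u k := iter k T a.
have hS k : h k.+1 = h k / 2 by rewrite exprS mulrC.
have h0 k : 0 < h k by rewrite exprn_gt0.
have hu k : nr (u k - a) <= (1 - h k) * (r / 4) /\ nr (u k.+1 - u k) <= r / 8 * h k.
  elim: k => [|k [ih1 ih2]]; first by rewrite /u /= subrr nr0 expr0 subrr mul0r mulr1.
  have i1 : nr (u k.+1 - a) <= (1 - h k.+1) * (r / 4).
    apply: le_trans (nr_dist (u k) _ _) _; rewrite hS.
    apply: le_trans (lerD ih2 ih1) _; lra.
  split => //; rewrite hS.
  have b j : (1 - h j) * (r / 4) < r by have : 0 < h j * r := mulr_gt0 (h0 _) r0; lra.
  apply: le_trans (hT _ _ (le_lt_trans i1 (b _)) (le_lt_trans ih1 (b _))) _.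
  by rewrite -/(u k.+1) -/(u k); lra.
have [l hl] := geo_cvg_rV (fun k => (hu k).2).
have la : nr (l - a) <= r / 2.
  have := hl 0%N; rewrite expr0 /u /= nrB; lra.
exists l => //.
apply/eqP; rewrite -subr_eq0 -nr_eq0 eq_le nr_ge0 andbT.
apply: (@geo_small _ _ r) => k.
apply: le_trans (nr_dist (u k.+1) _ _) _.
have b : (1 - h k) * (r / 4) < r by have : 0 < h k * r := mulr_gt0 (h0 _) r0; lra.
have l1 : nr (T l - u k.+1) <= nr (l - u k) / 2.
  by apply: hT; [lra|exact: le_lt_trans (hu k).1 b].
have h1 := hl k; have h2 := hl k.+1; rewrite hS in h2; rewrite (nrB l) in l1.
have rh : 0 < r * h k := mulr_gt0 r0 (h0 k).
move: h1 h2 l1 rh; clear; lra.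
Qed.

(** Newton's map with frozen derivative, x - (f x - w) M^-1, contracts near [a], and its fixed point
    solves f x = w. The lower bound [low] gives uniqueness of the solution and the Lipschitz
    estimate for the inverse. The radius [r0] lets the caller keep [U] inside a ball on which
    further conditions hold. *)
Theorem inverse_function n (f : 'rV[C]_n -> 'rV[C]_n) a M (r0 : R) :
    sdiff f a M -> M \in unitmx -> nice f a -> 0 < r0 ->
  exists (U V : set 'rV[C]_n) (psi : 'rV[C]_n -> 'rV[C]_n),
    [/\ U a /\ (U `<=` nball a r0),
        open U /\ (forall x, U x -> exists N, sdiff f x N),
        open V /\ (forall w, V w -> exists N, sdiff psi w N),
        (forall z, U z -> V (f z) /\ psi (f z) = z)
      & (forall w, V w -> U (psi w) /\ f (psi w) = w)].
Proof.
move=> hf uM [d1 d10 hnice] r00.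
have [K K0 hK] := nr_mulmx (invmx M).
have e0 : 0 < 1 / 2 / K by rewrite !divr_gt0.
have [d2 d20 hd2] := hf _ e0.
pose r := Num.min r0 (Num.min d1 d2).
have rp : 0 < r by rewrite !lt_min r00 d10.
have rr0 : r <= r0 by rewrite ge_min lexx.
have rd1 : r <= d1 by rewrite /r !ge_min lexx /= orbT.
have rd2 : r <= d2 by rewrite /r !ge_min lexx /= !orbT.
have low x y : nr (x - a) < r -> nr (y - a) < r -> nr (x - y) <= 2 * K * nr (f x - f y).
  move=> hx hy.
  have h1 := hd2 x y (lt_le_trans hx rd2) (lt_le_trans hy rd2).
  have -> : nr (x - y) = nr ((x - y) *m M *m invmx M) by rewrite mulmxK.
  have h2 := hK ((x - y) *m M).
  have h3 : nr ((x - y) *m M) <= nr (f x - f y) + 1 / 2 / K * nr (x - y).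
    rewrite -[(x - y) *m M](subKr (f x - f y)); apply: le_trans (nrD _ _) _.
    by rewrite nrN lerD2l.
  have h4 : nr (x - y) <= K * nr (f x - f y) + nr (x - y) / 2.
    have := le_trans h2 (_ : _ <= K * (nr (f x - f y) + 1 / 2 / K * nr (x - y))).
    rewrite ler_pM2l // mulmxK // => /(_ h3); congr (_ <= _); field; exact: lt0r_neq0.
  by rewrite mulmxK //; move: h4; clear; move: (nr (x - y)) (nr (f x - f y)) => p q; lra.
(* With this radius |T a - a| <= K |f a - w| < r / 8, the starting condition of
   [contraction_fixpoint]. *)
pose V := nball (f a) (r / (8 * K)).
pose U := [set x | nr (x - a) < r /\ V (f x)].
have solve w : V w -> exists2 x, U x & f x = w.
  move=> Vw; pose T x := x - (f x - w) *m invmx M.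
  have [||x xr Tx] := @contraction_fixpoint _ T a r _ _ rp.
  - move=> x y hx hy.
    have -> : T x - T y = - ((f x - f y - (x - y) *m M) *m invmx M).
      rewrite [in RHS]mulmxBl mulmxK //.
      have -> : f x - f y = (f x - w) - (f y - w) by rewrite opprB addrA subrK.
      rewrite [in RHS]mulmxBl /T; set A := _ *m _; set B := _ *m _.
      by apply/matrixP => i j; rewrite !mxE; ring.
    rewrite nrN; apply: le_trans (hK _) _.
    have := hd2 x y (lt_le_trans hx rd2) (lt_le_trans hy rd2).
    rewrite -(ler_pM2l K0); congr (_ <= _); field; exact: lt0r_neq0.
  - rewrite /T addrAC subrr sub0r nrN; apply: le_trans (hK _) _.
    move: Vw; rewrite /V /nball /= nrB => /ltW; rewrite -(ler_pM2l K0).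
    by congr (_ <= _); field; exact: lt0r_neq0.
  have fx : f x = w.
    move: Tx; rewrite /T => /eqP; rewrite -subr_eq0 addrAC subrr sub0r oppr_eq0 => /eqP E.
    apply/eqP; rewrite -subr_eq0 -[_ - w](mulmxKV uM) E mul0mx //.
  by exists x => //; split; [lra|rewrite fx].
pose psi w := if pselect (V w) is left Vw then projT1 (cid2 (solve w Vw)) else a.
have psiP w : V w -> U (psi w) /\ f (psi w) = w.
  by move=> Vw; rewrite /psi; case: pselect => // Vw'; case: (cid2 _).
have inj x y : U x -> U y -> f x = f y -> x = y.
  move=> [xr _] [yr _] E; apply/eqP; rewrite -subr_eq0 -nr_eq0 eq_le nr_ge0 andbT.
  by have := low x y xr yr; rewrite E subrr nr0 mulr0.
have fcont x : nr (x - a) < r -> exists L : R, exists d : R, [/\ 0 < L, 0 < d & forall y, nr (y - x) < d -> nr (f y - f x) <= L * nr (y - x)].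
  move=> xr; have [N /sdiff_lip [L [d [L0 d0 hL]]]] := hnice x (lt_le_trans xr rd1).
  by exists L, d; split => // y hy; apply: hL => //; rewrite subrr nr0.
have oU : open U.
  apply: open_nbhs_nball => x [xr Vx].
  have [L [d [L0 d0 hL]]] := fcont x xr.
  pose s := r / (8 * K) - nr (f x - f a).
  have s0 : 0 < s by rewrite subr_gt0.
  exists (Num.min (r - nr (x - a)) (Num.min d (s / L))).
    by rewrite !lt_min subr_gt0 xr d0 divr_gt0.
  move=> y; rewrite /nball /= !lt_min => /and3P[y1 y2 y3]; split.
    by apply: le_lt_trans (nr_dist x _ _) _; lra.
  rewrite /V /nball /=; apply: le_lt_trans (nr_dist (f x) _ _) _.
  have := hL y y2; move: y3; rewrite ltr_pdivlMr // mulrC /s; clear.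
  by move: (nr _) (nr _) (nr _) => p1 p2 p3; lra.
have Ua : U a by split; rewrite /V /nball /= subrr nr0 // divr_gt0 // mulr_gt0.
exists U, V, psi; split => //.
- by split => // x [xr _]; exact: lt_le_trans rr0.
- by split => // x [xr _]; exact: hnice (lt_le_trans xr rd1).
- split; first exact: open_nball.
  move=> w Vw; have [Up fp] := psiP w Vw.
  have [N hN] := hnice _ (lt_le_trans Up.1 rd1).
  (* f is bi-Lipschitz near psi w, hence its derivative there is injective *)
  have uN : N \in unitmx.
    rewrite -row_free_unit -kermx_eq0; apply/eqP/row_matrixP => i; rewrite row0.
    set k := row i _; have kN : k *m N = 0 by rewrite /k -row_mul mulmx_ker row0.
    (* Along a kernel vector [f] would move by at most 1 / (4 K) times the length, half of what
       [low] imposes. The vector is scaled to length q / 2 so that its end stays in both balls where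
       the estimates hold. *)
    have e1 : 0 < 1 / (4 * K) by rewrite divr_gt0 // mulr_gt0.
    have [d d0 hd] := hN _ e1.
    apply/eqP; rewrite -nr_eq0 eq_le nr_ge0 andbT leNgt; apply/negP => k0.
    pose q := Num.min d (r - nr (psi w - a)).
    have q0 : 0 < q by rewrite lt_min d0 subr_gt0; exact: Up.1.
    pose t : R := q / 2 / nr k.
    have t0 : 0 < t by rewrite !divr_gt0.
    pose y := psi w + ((t%:C)%C : C) *: k.
    have yk : nr (y - psi w) = q / 2.
      by rewrite /y addrAC subrr add0r nrZ nrs_real ?ltW // /t; field; rewrite gt_eqF.
    have qd : q <= d by rewrite ge_min lexx.
    have qr : q <= r - nr (psi w - a) by rewrite ge_min lexx orbT.
    have ya : nr (y - a) < r by apply: le_lt_trans (nr_dist (psi w) _ _) _; lra.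
    have := hd y (psi w); rewrite subrr nr0 => /(_ _ d0).
    have -> : (y - psi w) *m N = 0.
      by rewrite /y addrAC subrr add0r -scalemxAl kN scaler0.
    have yd : nr (y - psi w) < d.
      by rewrite yk; move: q0 qd; clear; lra.
    rewrite subr0 => /(_ yd) H1.
    have := low y (psi w) ya Up.1.
    have : 2 * K * nr (f y - f (psi w)) <= 2 * K * (1 / (4 * K) * nr (y - psi w)).
      by rewrite ler_pM2l // mulr_gt0.
    have -> : 2 * K * (1 / (4 * K) * nr (y - psi w)) = nr (y - psi w) / 2.
      by field; rewrite gt_eqF.
    move: H1 q0; rewrite yk; clear; move: (nr _) => p; lra.
  exists (invmx N) => e e1.
  have [J J0 hJ] := nr_mulmx (invmx N).
  have e2 : 0 < e / (2 * K * J) by rewrite divr_gt0 // !mulr_gt0.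
  have [d d0 hd] := hN _ e2.
  pose q := r / (8 * K) - nr (w - f a).
  have q0 : 0 < q by rewrite subr_gt0.
  exists (Num.min q (d / (2 * K))); first by rewrite lt_min q0 divr_gt0 // mulr_gt0.
  have inV x : nr (x - w) < q -> V x.
    by move=> hx; rewrite /V /nball /=; apply: le_lt_trans (nr_dist w _ _) _; move: hx; rewrite /q; lra.
  move=> x y; rewrite !lt_min => /andP[x1 x2] /andP[y1 y2].
  have [Ux fx] := psiP x (inV x x1); have [Uy fy] := psiP y (inV y y1).
  have cl z : nr (z - w) < d / (2 * K) -> U (psi z) -> f (psi z) = z -> nr (psi z - psi w) < d.
    move=> hz Uz fz; apply: le_lt_trans (low _ _ Uz.1 Up.1) _; rewrite fz fp.
    by rewrite mulrC -ltr_pdivlMr // mulr_gt0.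
  have := hd _ _ (cl x x2 Ux fx) (cl y y2 Uy fy); rewrite fx fy => H1.
  have -> : psi x - psi y - (x - y) *m invmx N = - ((x - y - (psi x - psi y) *m N) *m invmx N).
    by rewrite (mulmxBl _ (_ *m N)) mulmxK // opprB.
  rewrite nrN; apply: le_trans (hJ _) _.
  apply: le_trans (_ : J * (e / (2 * K * J) * (2 * K * nr (x - y))) <= _).
    rewrite ler_pM2l //; apply: le_trans H1 _; rewrite ler_pM2l //.
    by have := low _ _ Ux.1 Uy.1; rewrite fx fy.
  rewrite le_eqVlt; apply/orP; left; apply/eqP; field.
  by rewrite !gt_eqF.
- move=> z Uz; split; first exact: Uz.2.
  have [Up fp] := psiP (f z) Uz.2; exact: inj.
Qed.

End InverseFunction.

Local Notation mpolyC := mpoly.mpolyC.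
Local Notation "''Y_' i" := (mpoly.mpolyX _ (mpoly.mnm1 i)) (at level 8, i at level 2, format "''Y_' i").

(** * D4 points of polynomials *)

Section PolynomialMaps.
Variable K : fieldType.
Local Notation MP n := (mpoly.mpoly n K).

Lemma mpoly_ring_ind n (P : MP n -> Prop) :
  (forall c, P (mpolyC n c)) -> (forall i, P 'Y_i) ->
  (forall p q, P p -> P q -> P (p + q)) -> (forall p q, P p -> P q -> P (p * q)) ->
  forall p, P p.
Proof.
move=> hC hX hD hM; apply: mpoly.mpolyind => [|c m p _ _ hp].
  by rewrite -(mpoly.mpolyC0 n); exact: hC.
apply: hD => //; rewrite -mpoly.mul_mpolyC; apply: (hM) => //.
rewrite mpoly.mpolyXE_id; elim/big_ind: _ => [||i _]; [by rewrite -(mpoly.mpolyC1 n); exact: hC|exact: hM|].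
elim: (m i) => [|k ih]; first by rewrite expr0 -(mpoly.mpolyC1 n); exact: hC.
by rewrite exprS; exact: hM.
Qed.

Definition curve n (g : 'I_n -> {poly K}) (p : MP n) : {poly K} := mpoly.mmap polyC g p.

Lemma curveC n (g : 'I_n -> {poly K}) c : curve g (mpolyC n c) = c%:P.
Proof. by rewrite /curve mpoly.mmapC. Qed.
Lemma curveX n (g : 'I_n -> {poly K}) i : curve g 'Y_i = g i.
Proof. by rewrite /curve mpoly.mmapX mpoly.mmap1U. Qed.
Lemma curveD n (g : 'I_n -> {poly K}) p q : curve g (p + q) = curve g p + curve g q.
Proof. exact: raddfD. Qed.
Lemma curveM n (g : 'I_n -> {poly K}) p q : curve g (p * q) = curve g p * curve g q.
Proof. exact: rmorphM. Qed.

Lemma curveXn n (g : 'I_n -> {poly K}) p k : curve g (p ^+ k) = curve g p ^+ k.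
Proof. exact: rmorphXn. Qed.

Definition pev n (v : 'rV[K]_n) (p : MP n) : K := mpoly.meval (v ord0) p.

Lemma pevC n (v : 'rV[K]_n) c : pev v (mpolyC n c) = c.
Proof. exact: mpoly.mevalC. Qed.
Lemma pevX n (v : 'rV[K]_n) i : pev v 'Y_i = v ord0 i.
Proof. exact: mpoly.mevalXU. Qed.
Lemma pevD n (v : 'rV[K]_n) p q : pev v (p + q) = pev v p + pev v q.
Proof. exact: mpoly.mevalD. Qed.
Lemma pevM n (v : 'rV[K]_n) p q : pev v (p * q) = pev v p * pev v q.
Proof. exact: mpoly.mevalM. Qed.
Lemma pev0 n (v : 'rV[K]_n) : pev v 0 = 0.
Proof. exact: mpoly.meval0. Qed.
Lemma pev1 n (v : 'rV[K]_n) : pev v 1 = 1.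
Proof. exact: mpoly.meval1. Qed.
Lemma pevN n (v : 'rV[K]_n) p : pev v (- p) = - pev v p.
Proof. exact: mpoly.mevalN. Qed.
Lemma pevXn n (v : 'rV[K]_n) p k : pev v (p ^+ k) = pev v p ^+ k.
Proof. exact: rmorphXn. Qed.
Lemma pevMn n (v : 'rV[K]_n) p k : pev v (p *+ k) = pev v p *+ k.
Proof. exact: mpoly.mevalMn. Qed.
Lemma pev_nat n (v : 'rV[K]_n) k : pev v k%:R = k%:R.
Proof. exact: rmorph_nat. Qed.

Definition pevE := (pevC, pevX, pevD, pevM, pev0, pev1, pevN, pevXn, pevMn, pev_nat).

Definition line n (v t : 'rV[K]_n) (i : 'I_n) : {poly K} := (v ord0 i)%:P + t ord0 i *: 'X.

(** The directional derivative at [v] along [t], as the linear coefficient of the restriction to the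
    line v + t X. Higher coefficients of the same restriction give the orders of vanishing used for
    germs. *)
Definition dp n (v t : 'rV[K]_n) (p : MP n) : K := (curve (line v t) p)`_1.

Lemma coef0_line n (v t : 'rV[K]_n) i : (line v t i)`_0 = v ord0 i.
Proof. by rewrite /line coefD coefC coefZ coefX /= mulr0 addr0. Qed.
Lemma coef1_line n (v t : 'rV[K]_n) i : (line v t i)`_1 = t ord0 i.
Proof. by rewrite /line coefD coefC coefZ coefX /= mulr1 add0r. Qed.

Lemma curve_coef0 n (g : 'I_n -> {poly K}) p (v : 'rV[K]_n) :
  (forall i, (g i)`_0 = v ord0 i) -> (curve g p)`_0 = pev v p.
Proof.
move=> hg; elim/mpoly_ring_ind: p => [c|i|p q hp hq|p q hp hq].
- by rewrite curveC coefC pevE.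
- by rewrite curveX hg pevE.
- by rewrite curveD coefD hp hq pevE.
- by rewrite curveM coefM big_ord_recl big_ord0 addr0 hp hq pevE.
Qed.

Lemma coef1M (p q : {poly K}) : (p * q)`_1 = p`_0 * q`_1 + p`_1 * q`_0.
Proof. by rewrite coefM 2!big_ord_recl big_ord0 addr0. Qed.

Lemma line_coef0 n (v t : 'rV[K]_n) p : (curve (line v t) p)`_0 = pev v p.
Proof. by apply: curve_coef0 => i; exact: coef0_line. Qed.

Lemma dpC n (v t : 'rV[K]_n) c : dp v t (mpolyC n c) = 0.
Proof. by rewrite /dp curveC coefC. Qed.
Lemma dpX n (v t : 'rV[K]_n) i : dp v t 'Y_i = t ord0 i.
Proof. by rewrite /dp curveX coef1_line. Qed.
Lemma dpD n (v t : 'rV[K]_n) p q : dp v t (p + q) = dp v t p + dp v t q.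
Proof. by rewrite /dp curveD coefD. Qed.
Lemma dpM n (v t : 'rV[K]_n) p q : dp v t (p * q) = pev v p * dp v t q + dp v t p * pev v q.
Proof. by rewrite /dp curveM coef1M !line_coef0. Qed.
Lemma dp0 n (v t : 'rV[K]_n) : dp v t 0 = 0.
Proof. by rewrite -(mpoly.mpolyC0 n) dpC. Qed.
Lemma dp1 n (v t : 'rV[K]_n) : dp v t 1 = 0.
Proof. by rewrite -(mpoly.mpolyC1 n) dpC. Qed.
Lemma dpN n (v t : 'rV[K]_n) p : dp v t (- p) = - dp v t p.
Proof. by rewrite /dp /curve raddfN coefN. Qed.
Lemma dpXn n (v t : 'rV[K]_n) p k : dp v t (p ^+ k.+1) = k.+1%:R * pev v p ^+ k * dp v t p.
Proof.
elim: k => [|k ih]; first by rewrite !expr1 expr0 !mul1r.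
by rewrite exprS dpM ih pevXn -(natr1 k.+1) exprS; ring.
Qed.
Lemma dpMn n (v t : 'rV[K]_n) p k : dp v t (p *+ k) = dp v t p *+ k.
Proof. by rewrite /dp /curve raddfMn coefMn. Qed.
Lemma dp_nat n (v t : 'rV[K]_n) k : dp v t k%:R = 0.
Proof. by rewrite -mpoly.mpolyC_nat dpC. Qed.

Definition dpE := (dpC, dpX, dpD, dpXn, dpMn, dp_nat, dpM, dp0, dp1, dpN).

Lemma dp_lin n (v t s : 'rV[K]_n) a p : dp v (a *: t + s) p = a * dp v t p + dp v s p.
Proof.
elim/mpoly_ring_ind: p => [c|i|p q hp hq|p q hp hq]; rewrite !dpE ?mxE.
- by rewrite mulr0 addr0.
- by [].
- by rewrite hp hq; ring.
- by rewrite hp hq; ring.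
Qed.

Lemma dp_t0 n (v : 'rV[K]_n) p : dp v 0 p = 0.
Proof. by have := dp_lin v 0 0 (-1) p; rewrite scaler0 addr0 mulN1r addNr. Qed.

Definition subst n m (W : 'I_n -> MP m) (p : MP n) : MP m := mpoly.mmap (mpolyC m (R := K)) W p.

Lemma substC n m (W : 'I_n -> MP m) c : subst W (mpolyC n c) = mpolyC m c.
Proof. by rewrite /subst mpoly.mmapC. Qed.
Lemma substX n m (W : 'I_n -> MP m) i : subst W 'Y_i = W i.
Proof. by rewrite /subst mpoly.mmapX mpoly.mmap1U. Qed.
Lemma substD n m (W : 'I_n -> MP m) p q : subst W (p + q) = subst W p + subst W q.
Proof. exact: raddfD. Qed.
Lemma substM n m (W : 'I_n -> MP m) p q : subst W (p * q) = subst W p * subst W q.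
Proof. exact: rmorphM. Qed.
Lemma substXn n m (W : 'I_n -> MP m) p k : subst W (p ^+ k) = subst W p ^+ k.
Proof. exact: rmorphXn. Qed.

Definition pmap n m (W : 'I_n -> MP m) (v : 'rV[K]_m) : 'rV[K]_n := \row_i pev v (W i).
Definition dpmap n m (W : 'I_n -> MP m) (v t : 'rV[K]_m) : 'rV[K]_n := \row_i dp v t (W i).

Lemma pev_subst n m (W : 'I_n -> MP m) v p : pev v (subst W p) = pev (pmap W v) p.
Proof.
elim/mpoly_ring_ind: p => [c|i|p q hp hq|p q hp hq].
- by rewrite substC !pevE.
- by rewrite substX pevX mxE.
- by rewrite substD !pevD hp hq.
- by rewrite substM !pevM hp hq.
Qed.

Lemma dp_subst n m (W : 'I_n -> MP m) v t p : dp v t (subst W p) = dp (pmap W v) (dpmap W v t) p.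
Proof.
elim/mpoly_ring_ind: p => [c|i|p q hp hq|p q hp hq].
- by rewrite substC !dpE.
- by rewrite substX dpX mxE.
- by rewrite substD !dpD hp hq.
- by rewrite substM !dpM hp hq !pev_subst.
Qed.

(* Syntax of polynomials, on which values and differentials compute. *)
Inductive pexp (n : nat) : Type :=
| PC of K | PX of 'I_n | PA of pexp n & pexp n | PM of pexp n & pexp n | PE of pexp n & nat.

Fixpoint pden n (e : pexp n) : MP n :=
  match e with
  | PC c => mpolyC n c
  | PX i => 'Y_i
  | PA e1 e2 => pden e1 + pden e2
  | PM e1 e2 => pden e1 * pden e2
  | PE e1 k => pden e1 ^+ k
  end.

Fixpoint peval n (v : 'I_n -> K) (e : pexp n) : K :=
  match e with
  | PC c => c
  | PX i => v i
  | PA e1 e2 => peval v e1 + peval v e2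
  | PM e1 e2 => peval v e1 * peval v e2
  | PE e1 k => peval v e1 ^+ k
  end.

Fixpoint pdiff n (v t : 'I_n -> K) (e : pexp n) : K :=
  match e with
  | PC c => 0
  | PX i => t i
  | PA e1 e2 => pdiff v t e1 + pdiff v t e2
  | PM e1 e2 => peval v e1 * pdiff v t e2 + pdiff v t e1 * peval v e2
  | PE e1 k => k%:R * peval v e1 ^+ k.-1 * pdiff v t e1
  end.

Lemma pev_pden n v (e : pexp n) : pev v (pden e) = peval (v ord0) e.
Proof. by elim: e => [c|i|e1 h1 e2 h2|e1 h1 e2 h2|e1 h1 k] /=; rewrite ?pevE ?h1 ?h2. Qed.

Lemma dp_pden n v t (e : pexp n) : dp v t (pden e) = pdiff (v ord0) (t ord0) e.
Proof.
elim: e => [c|i|e1 h1 e2 h2|e1 h1 e2 h2|e1 h1 k] /=.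
- exact: dpC.
- exact: dpX.
- by rewrite dpD h1 h2.
- by rewrite dpM !pev_pden h1 h2.
- case: k => [|k] /=; first by rewrite dp1 !mul0r.
  by rewrite dpXn pev_pden h1.
Qed.

End PolynomialMaps.

(** * An algebraic form of the D4 condition *)

Section D4Points.
Variable K : fieldType.
Local Notation MP := (mpoly.mpoly 4 K).
Implicit Types (F G H u z : MP) (v t : 'rV[K]_4).

(** The common kernel of the three differentials is at most the line of [v], the direction collapsed
    in P^3: the three functions are local coordinates at the point. *)
Definition transverse v (u1 u2 z : MP) :=
  forall t, dp v t u1 = 0 -> dp v t u2 = 0 -> dp v t z = 0 -> exists a, t = a *: v.

(** The decomposition is a global polynomial identity with variable coefficients, constrained only
    through their values at [v]. It can be checked by [ring], pulled back by substitutions and moved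
    by symmetries without any analysis. *)
Definition D4pt F v := exists (u1 u2 z U q0 q1 q2 c0 c1 c2 c3 : MP),
  [/\ F = U * z ^+ 2 + z * (q0 * u1 ^+ 2 + q1 * u1 * u2 + q2 * u2 ^+ 2)
        + (c0 * u1 ^+ 3 + c1 * u1 ^+ 2 * u2 + c2 * u1 * u2 ^+ 2 + c3 * u2 ^+ 3),
      [/\ pev v u1 = 0, pev v u2 = 0 & pev v z = 0],
      [/\ pev v U != 0, pev v c0 != 0 & pev v c3 != 0],
      pev v c1 = 0 /\ pev v c2 = 0
    & transverse v u1 u2 z].

(** The hypothesis on [dpmap] says that the differential of [W] is injective modulo the radial
    directions. This is what transports [transverse]. *)
Lemma D4pt_subst (W : 'I_4 -> MP) F v :
  (forall t a, dpmap W v t = a *: pmap W v -> exists b, t = b *: v) ->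
  D4pt F (pmap W v) -> D4pt (subst W F) v.
Proof.
move=> hW [u1 [u2 [z [U [q0 [q1 [q2 [c0 [c1 [c2 [c3 [-> [e1 e2 e3] [f1 f2 f3] [g1 g2] tr]]]]]]]]]]]].
exists (subst W u1), (subst W u2), (subst W z), (subst W U).
exists (subst W q0), (subst W q1), (subst W q2), (subst W c0), (subst W c1), (subst W c2), (subst W c3).
split; rewrite ?pev_subst //.
  by rewrite !(substD, substM, substXn).
move=> t; rewrite !dp_subst => h1 h2 h3.
have [a ha] := tr _ h1 h2 h3; exact: hW ha.
Qed.

Lemma D4pt_scale (c : K) F v : c != 0 -> D4pt F v -> D4pt (mpolyC 4 c * F) v.
Proof.
move=> c0 [u1 [u2 [z [U [q0 [q1 [q2 [k0 [k1 [k2 [k3 [-> he [f1 f2 f3] [g1 g2] tr]]]]]]]]]]]].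
exists u1, u2, z, (mpolyC 4 c * U), (mpolyC 4 c * q0), (mpolyC 4 c * q1), (mpolyC 4 c * q2).
exists (mpolyC 4 c * k0), (mpolyC 4 c * k1), (mpolyC 4 c * k2), (mpolyC 4 c * k3).
split; rewrite ?pevM ?pevC ?g1 ?g2 ?mulr0 ?mulf_neq0 //.
ring.
Qed.

(** The matrix of the three differentials has a kernel of dimension at most 1 in a space of
    dimension 4, hence rank 3. *)
Lemma transverse_surj v (u1 u2 z : MP) : transverse v u1 u2 z ->
  forall a b c, exists t, [/\ dp v t u1 = a, dp v t u2 = b & dp v t z = c].
Proof.
move=> tr a b c.
pose w (i : 'I_3) : MP := tnth [tuple u1; u2; z] i.
pose M : 'M[K]_(4, 3) := \matrix_(i, j) dp v (delta_mx 0 i) (w j).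
have ME (t : 'rV[K]_4) j : (t *m M) 0 j = dp v t (w j).
  rewrite mxE [in RHS](row_sum_delta t).
  under eq_bigr => i _ do rewrite mxE.
  elim/big_rec2: _ => [|i y1 y2 _ ->]; first by rewrite dp_t0.
  by rewrite dp_lin.
have rM : row_full M.
  rewrite /row_full eqn_leq rank_leq_col /=.
  have rk : (\rank (kermx M) <= 1)%N.
    apply: leq_trans (_ : \rank v <= _)%N; last exact: rank_leq_row.
    apply: mxrankS; apply/row_subP => i.
    have : row i (kermx M) *m M = 0 by rewrite -row_mul mulmx_ker row0.
    set t := row i _ => tM.
    have dt j : dp v t (w j) = 0 by rewrite -ME tM mxE.
    have [k ->] : exists k, t = k *: v by apply: tr; [exact: (dt 0)|exact: (dt 1)|exact: (dt 2%:R)].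
    exact: scalemx_sub.
  by have := mxrank_ker M; have := rank_leq_row M; lia.
pose y : 'rV[K]_3 := \row_j [tuple a; b; c]`_j.
have /submxP [t ht] : (y <= M)%MS by exact: submx_full.
exists t; split.
- by have := ME t 0; rewrite -ht mxE.
- by have := ME t 1; rewrite -ht mxE.
- by have := ME t 2%:R; rewrite -ht mxE.
Qed.

Lemma coef0_divX (p : {poly K}) : p`_0 = 0 -> exists q, p = q * 'X.
Proof.
move=> p0; exists (drop_poly 1 p); rewrite -[LHS](poly_take_drop 1) expr1.
rewrite [take_poly 1 p](_ : _ = 0) ?add0r //.
by apply/polyP => [[|i]]; rewrite coef_take_poly coef0.
Qed.

(* If G and H both vanish at v, their differentials multiply to U dz^2, so both
   vanish on ker dz, where F would then have no cubic term. *)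
Lemma D4pt_irreducible_germ G H v : D4pt (G * H) v -> pev v G = 0 -> pev v H = 0 -> False.
Proof.
move=> [u1 [u2 [z [U [q0 [q1 [q2 [c0 [c1 [c2 [c3 [E [e1 e2 e3] [f1 f2 f3] [g1 g2] tr]]]]]]]]]]]] G0 H0.
have lineX t p : pev v p = 0 -> exists q, curve (line v t) p = q * 'X.
  by move=> p0; apply: coef0_divX; rewrite line_coef0.
have dpX1 t p q : curve (line v t) p = q * 'X -> dp v t p = q`_0.
  by rewrite /dp => ->; rewrite coefMX.
have second t : dp v t G * dp v t H = pev v U * dp v t z ^+ 2.
  have [g hg] := lineX t G G0; have [h hh] := lineX t H H0.
  have [a1 h1] := lineX t u1 e1; have [a2 h2] := lineX t u2 e2; have [a3 h3] := lineX t z e3.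
  have := congr1 (curve (line v t)) E.
  rewrite !(curveD, curveM, curveXn) hg hh h1 h2 h3.
  set A := curve _ U; set B0 := curve _ q0; set B1 := curve _ q1; set B2 := curve _ q2.
  set D0 := curve _ c0; set D1 := curve _ c1; set D2 := curve _ c2; set D3 := curve _ c3.
  rewrite [LHS](_ : _ = (g * h) * 'X^2); last by ring.
  rewrite [RHS](_ : _ = (A * a3 ^+ 2 + (a3 * (B0 * a1 ^+ 2 + B1 * a1 * a2 + B2 * a2 ^+ 2)
     + (D0 * a1 ^+ 3 + D1 * a1 ^+ 2 * a2 + D2 * a1 * a2 ^+ 2 + D3 * a2 ^+ 3)) * 'X) * 'X^2); last by ring.
  move=> /(congr1 (coefp 2)) /=; rewrite !coefMXn ltnn subnn !coefD coefMX /= addr0.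
  rewrite [a3 ^+ 2]expr2 !coef0M (dpX1 _ _ _ hg) (dpX1 _ _ _ hh) (dpX1 _ _ _ h3) => ->.
  rewrite -expr2.
  by rewrite /A line_coef0.
have [t0 [_ _ z0]] := transverse_surj tr 0 0 1.
(* Polarization: adding t to a vector t0 with dz(t0) = 1 does not change the product of the
   differentials, so the cross term vanishes. One of dG(t), dH(t) is already 0, and as neither
   differential vanishes at t0, so is the other. *)
have van t : dp v t z = 0 -> dp v t G = 0 /\ dp v t H = 0.
  move=> tz; have := second t; have := second t0; have := second (1 *: t + t0); have := second (- 1 *: t + t0).
  rewrite !dp_lin tz z0 !mulr0 !add0r expr0n /= mulr0 expr1n mulr1 !mul1r.
  set g0 := dp v t0 G; set h0 := dp v t0 H; set g := dp v t G; set h := dp v t H.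
  move=> A1 A2 A3 A4; have gh0 : g0 * h0 != 0 by rewrite A3.
  have := gh0; rewrite mulf_eq0 negb_or => /andP[g0n h0n].
  have A5 : g0 * h + g * h0 = 0.
    have -> : g0 * h + g * h0 = (g + g0) * (h + h0) - g * h - g0 * h0 by ring.
    by rewrite A2 A4 A3 subr0 subrr.
  move/eqP: A4; rewrite mulf_eq0 => /orP[] /eqP Z; move: A5; rewrite Z ?mulr0 ?mul0r ?addr0 ?add0r => /eqP;
    by rewrite mulf_eq0 ?(negPf g0n) ?(negPf h0n) /= ?orbF => /eqP.
(* Along this direction [u2], [z], [G] and [H] all vanish to order 2. The product then starts in
   degree 4, whereas [F] has the coefficient c0(v) in degree 3. *)
have [t [t1 t2 t3]] := transverse_surj tr 1 0 0.
have [tG tH] := van t t3.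
have lineX2 p : pev v p = 0 -> dp v t p = 0 -> exists q, curve (line v t) p = q * 'X^2.
  move=> p0 p1; have [q hq] := lineX t p p0.
  have [|r hr] := @coef0_divX q; first by rewrite -(dpX1 _ _ _ hq).
  by exists r; rewrite hq hr expr2 mulrA.
have [g hg] := lineX2 G G0 tG; have [h hh] := lineX2 H H0 tH.
have [a1 h1] := lineX t u1 e1; have [a2 h2] := lineX2 u2 e2 t2; have [a3 h3] := lineX2 z e3 t3.
have := congr1 (curve (line v t)) E.
rewrite !(curveD, curveM, curveXn) hg hh h1 h2 h3.
set A := curve _ U; set B0 := curve _ q0; set B1 := curve _ q1; set B2 := curve _ q2.
set D0 := curve _ c0; set D1 := curve _ c1; set D2 := curve _ c2; set D3 := curve _ c3.
rewrite [LHS](_ : _ = (g * h) * 'X^4); last by ring.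
rewrite [RHS](_ : _ = D0 * a1 ^+ 3 * 'X^3 + (A * a3 ^+ 2 + a3 * (B0 * a1 ^+ 2 + B1 * a1 * (a2 * 'X) + B2 * (a2 * 'X) ^+ 2)
     + (D1 * a1 ^+ 2 * a2 + D2 * a1 * a2 ^+ 2 * 'X + D3 * a2 ^+ 3 * 'X^2)) * 'X^4); last by ring.
move=> /(congr1 (coefp 3)) /=; rewrite coefD !coefMXn ltnn subnn /= addr0 coef0M /D0 line_coef0.
have -> : (a1 ^+ 3)`_0 = 1 by rewrite !exprS expr0 !coef0M -(dpX1 _ _ _ h1) t1 coef1 !mulr1.
by rewrite mulr1 => /esym/eqP; rewrite (negPf f2).
Qed.

(** 4 U F = (2 U z + q)^2 + 4 U c - q^2, where q is the quadratic form in u1, u2. The quartic q^2 is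
    distributed over the coefficients of the cubic, which change by terms vanishing at [v]. *)
Lemma D4pt_complete_square F v : 2%:R != 0 :> K -> D4pt F v ->
  exists (u1 u2 z w d0 d1 d2 d3 : MP),
  [/\ w * F = z ^+ 2 + (d0 * u1 ^+ 3 + d1 * u1 ^+ 2 * u2 + d2 * u1 * u2 ^+ 2 + d3 * u2 ^+ 3),
      [/\ pev v u1 = 0, pev v u2 = 0 & pev v z = 0],
      [/\ pev v w != 0, pev v d0 != 0 & pev v d3 != 0],
      pev v d1 = 0 /\ pev v d2 = 0
    & transverse v u1 u2 z].
Proof.
move=> n2 [u1 [u2 [z [U [q0 [q1 [q2 [c0 [c1 [c2 [c3 [-> [e1 e2 e3] [f1 f2 f3] [g1 g2] tr]]]]]]]]]]]].
have n4 : 4%:R != 0 :> K by rewrite (natrM _ 2 2) mulf_neq0.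
pose two := mpolyC 4 (2%:R : K).
exists u1, u2, (two * U * z + (q0 * u1 ^+ 2 + q1 * u1 * u2 + q2 * u2 ^+ 2)), (two ^+ 2 * U).
exists (two ^+ 2 * U * c0 - q0 ^+ 2 * u1), (two ^+ 2 * U * c1 - two * q0 * q1 * u1).
exists (two ^+ 2 * U * c2 - (q1 ^+ 2 + two * q0 * q2) * u1).
exists (two ^+ 2 * U * c3 - two * q1 * q2 * u1 - q2 ^+ 2 * u2).
have two2 : two = 2%:R by rewrite /two mpoly.mpolyC_nat.
have tv : pev v two = 2%:R by rewrite /two pevC.
split.
- by rewrite two2; ring.
- by split=> //; rewrite !(pevD, pevM, pevXn) e1 e2 e3 !expr0n /= !mulr0 !addr0.
- by split; rewrite !(pevD, pevN, pevM, pevXn) ?tv ?e1 ?e2 ?mulr0 ?subr0 ?mulf_neq0 ?expf_neq0.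
- by split; rewrite !(pevD, pevN, pevM, pevXn) ?e1 ?e2 ?g1 ?g2 ?mulr0 ?subr0.
move=> t t1 t2 t3; apply: tr => //; move: t3.
rewrite !(dpD, dpM, dpXn, pevM) t1 t2 e1 e2 e3 tv !(mulr0, addr0, mul0r, add0r).
by move=> /eqP; rewrite !mulf_eq0 (negPf n2) (negPf f1) /= => /eqP.
Qed.

End D4Points.

(** * Calculus near a point *)

Section NiceCalculus.
Variable R : realType.
Local Notation C := (Cplx R).

Lemma sdiff_coord n m (f : 'rV[C]_n -> 'rV[C]_m) a M j :
  sdiff f a M -> sdiffs (fun x => f x ord0 j) a (col j M).
Proof.
move=> hf; have := sdiffs_comp hf (sdiffs_coord j (f a)).
by rewrite -colE.
Qed.

Lemma nicesD n (f h : 'rV[C]_n -> C) a : nices f a -> nices h a -> nices (fun x => f x + h x) a.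
Proof.
move=> [d1 d10 h1] [d2 d20 h2]; exists (Num.min d1 d2); first by rewrite lt_min d10.
move=> x; rewrite lt_min => /andP[/h1 [g1 G1] /h2 [g2 G2]].
by exists (g1 + g2); exact: sdiffsD.
Qed.

Lemma nicesM n (f h : 'rV[C]_n -> C) a : nices f a -> nices h a -> nices (fun x => f x * h x) a.
Proof.
move=> [d1 d10 h1] [d2 d20 h2]; exists (Num.min d1 d2); first by rewrite lt_min d10.
move=> x; rewrite lt_min => /andP[/h1 [g1 G1] /h2 [g2 G2]].
by exists (h x *: g1 + f x *: g2); exact: sdiffsM.
Qed.

Lemma nices_cst n c (a : 'rV[C]_n) : nices (fun=> c) a.
Proof. by exists 1 => // x _; exists 0; exact: sdiffs_cst. Qed.

Lemma nice_row n m (f : 'I_m -> 'rV[C]_n -> C) a : (forall j, nices (f j) a) ->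
  nice (fun x => \row_j f j x) a.
Proof.
move=> hf.
have [d hd] := choice (fun j => (let: ex_intro2 d d0 h := hf j in
   ex_intro _ d (conj d0 h)) : exists d, 0 < d /\ (forall x, nr (x - a) < d -> exists g, sdiffs (f j) x g)).
exists (\big[Num.min/1]_j d j).
  by elim/big_ind: _ => // [x y x0 y0|j _]; [rewrite lt_min x0|case: (hd j)].
move=> x hx.
have hg j : exists g, sdiffs (f j) x g.
  have [_ /(_ x)] := hd j; apply; apply: lt_le_trans hx _; exact: bigmin_le.
have [g Hg] := choice hg.
by exists (\matrix_(i, j) g j i ord0); exact: sdiff_row.
Qed.

Lemma nices_near n (f : 'rV[C]_n -> C) a (c : C) : nices f a -> f a != c ->
  exists2 d : R, 0 < d & forall x, nr (x - a) < d -> f x != c.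
Proof.
move=> [d1 d10 h1] fc; have [g hg] := h1 a ltac:(by rewrite subrr nr0).
have [L [d [L0 d0 hL]]] := sdiffs_lip hg.
have fc0 : 0 < nrs (f a - c) by rewrite lt_def nrs_ge0 andbT [_ == 0]nr_eq0 subr_eq0.
exists (Num.min d (nrs (f a - c) / L)); first by rewrite lt_min d0 divr_gt0.
move=> x; rewrite lt_min => /andP[x1]; rewrite ltr_pdivlMr // mulrC => x2.
apply: contraTneq (hL x a x1 ltac:(by rewrite subrr nr0)) => ->.
by rewrite -ltNge [nrs (c - _)](nrB (c : C^o)).
Qed.

Lemma nice_near n m (f : 'rV[C]_n -> 'rV[C]_m) a (V : set 'rV[C]_m) : nice f a -> open V -> V (f a) ->
  exists2 d : R, 0 < d & forall x, nr (x - a) < d -> V (f x).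
Proof.
move=> [d1 d10 h1] oV Va; have [g hg] := h1 a ltac:(by rewrite subrr nr0).
have [L [d [L0 d0 hL]]] := sdiff_lip hg.
have /nbhs_ballP [e /= e0 he] : nbhs (f a) V by exact: open_nbhs_nbhs.
have er : e = ((complex.Re (e : R[i]))%:C)%C by move: (gtr0_real e0) => /RRe_real.
have re0 : 0 < complex.Re (e : R[i]) by rewrite -ltcR -er.
exists (Num.min d (complex.Re (e : R[i]) / L)); first by rewrite lt_min d0 divr_gt0.
move=> x; rewrite lt_min => /andP[x1]; rewrite ltr_pdivlMr // mulrC => x2.
apply: he; rewrite -ball_normE /ball_ /= er -nr_lt nrB.
by apply: le_lt_trans (hL x a x1 _) _ => //; rewrite subrr nr0.
Qed.

Lemma pev_sdiffs n (p : mpoly.mpoly n C) (a : 'rV[C]_n) :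
  exists2 g, sdiffs (fun x => pev x p) a g & forall t, (t *m g) ord0 ord0 = dp a t p.
Proof.
elim/mpoly_ring_ind: p => [c|i|p q [g hg hgt] [h hh hht]|p q [g hg hgt] [h hh hht]].
- exists 0 => [|t]; last by rewrite mulmx0 mxE dpC.
  by apply: sdiffs_eq (sdiffs_cst c a) => x; rewrite pevC.
- exists (delta_mx i ord0) => [|t]; last by rewrite -colE mxE dpX.
  by apply: sdiffs_eq (sdiffs_coord i a) => x; rewrite pevX.
- exists (g + h) => [|t]; last by rewrite mulmxDr mxE hgt hht dpD.
  by apply: sdiffs_eq (sdiffsD hg hh) => x; rewrite pevD.
- exists (pev a q *: g + pev a p *: h) => [|t].
    by apply: sdiffs_eq (sdiffsM hg hh) => x; rewrite pevM.
  rewrite dpM -hgt -hht mulmxDr -!scalemxAr.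
  by set A := _ *m g; set B := _ *m h; rewrite !mxE; ring.
Qed.
End NiceCalculus.

(** * Deformations of a diagonal binary cubic *)

Section DiagonalCubic.
Variable K : fieldType.
Hypothesis three_neq0 : 3%:R != 0 :> K.
Variables A D : K.
Hypotheses (A0 : A != 0) (D0 : D != 0).

Let cubes i j : pexp K 4 := PA (PM (PC _ A) (PE (PX K i) 3)) (PM (PC _ D) (PE (PX K j) 3)).
Let mixed i j k l : pexp K 4 :=
  PM (PC _ 3%:R) (PA (PM (PC _ A) (PM (PE (PX K i) 2) (PX K j))) (PM (PC _ D) (PM (PE (PX K k) 2) (PX K l)))).

(* The coefficients of A (x0 X + x1 Y)^3 + D (x2 X + x3 Y)^3. *)
Definition cubic_coefs (j : 'I_4) : pexp K 4 :=
  nth (PC 4 0) [:: cubes 0 2%:R; mixed 0 1 2%:R 3%:R; mixed 1 0 3%:R 2%:R; cubes 1 3%:R] j.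

(** The identity of GL_2, flattened. *)
Definition id2 : 'rV[K]_4 := \row_j [tuple 1; 0; 0; 1]`_j.

Lemma id2E : [/\ id2 ord0 0 = 1, id2 ord0 1 = 0, id2 ord0 2%:R = 0 & id2 ord0 3%:R = 1].
Proof. by split; rewrite mxE. Qed.

Lemma cubic_coefs_id2 j : pev id2 (pden (cubic_coefs j)) = [tuple A; 0; 0; D]`_j.
Proof.
have [e0 e1 e2 e3] := id2E.
by case: j => [[|[|[|[|j]]]] lj] //; rewrite pev_pden /= ?e0 ?e1 ?e2 ?e3; ring.
Qed.

Lemma ord4_ind (P : 'I_4 -> Prop) : P 0 -> P 1 -> P 2%:R -> P 3%:R -> forall j, P j.
Proof.
move=> h0 h1 h2 h3 [[|[|[|[|j]]]] lj] //.
- by rewrite (_ : Ordinal lj = 0) //; apply: val_inj.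
- by rewrite (_ : Ordinal lj = 1) //; apply: val_inj.
- by rewrite (_ : Ordinal lj = 2%:R) //; apply: val_inj.
- by rewrite (_ : Ordinal lj = 3%:R) //; apply: val_inj.
Qed.

(** At the identity the differential of the coefficient map is diagonal, with entries 3 A, 3 A, 3 D,
    3 D. *)
Lemma cubic_coefs_etale t : (forall j, dp id2 t (pden (cubic_coefs j)) = 0) -> t = 0.
Proof.
have [e0 e1 e2 e3] := id2E => h.
have n3 (x y : K) : y != 0 -> 3%:R * y * x = 0 -> x = 0.
  move=> y0 /eqP; rewrite mulf_eq0 (negPf (_ : 3%:R * y != 0)) ?mulf_neq0 //.
  by move=> /eqP.
apply/rowP; elim/ord4_ind; rewrite [RHS]mxE.
- by apply: (n3 _ A A0); rewrite -(h 0) dp_pden /= ?e0 ?e1 ?e2 ?e3; ring.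
- by apply: (n3 _ A A0); rewrite -(h 1) dp_pden /= ?e0 ?e1 ?e2 ?e3; ring.
- by apply: (n3 _ D D0); rewrite -(h 2%:R) dp_pden /= ?e0 ?e1 ?e2 ?e3; ring.
- by apply: (n3 _ D D0); rewrite -(h 3%:R) dp_pden /= ?e0 ?e1 ?e2 ?e3; ring.
Qed.

Lemma cubic_coefsE (m : 'rV[K]_4) x y :
  A * (m ord0 0 * x + m ord0 1 * y) ^+ 3 + D * (m ord0 2%:R * x + m ord0 3%:R * y) ^+ 3 =
  pev m (pden (cubic_coefs 0)) * x ^+ 3 + pev m (pden (cubic_coefs 1)) * x ^+ 2 * y
  + pev m (pden (cubic_coefs 2%:R)) * x * y ^+ 2 + pev m (pden (cubic_coefs 3%:R)) * y ^+ 3.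
Proof. by rewrite !pev_pden /=; ring. Qed.

End DiagonalCubic.

Section Chart.
Variable R : realType.
Local Notation C := (Cplx R).
Local Notation MP := (mpoly.mpoly 4 C).

Definition tangent_lift (i : 'I_4) (t : 'rV[C]_3) : 'rV[C]_4 :=
  \row_j (if unlift i j is Some k then t ord0 k else 0).

Lemma chart_sdiffs i (p : MP) (a : 'rV[C]_3) :
  exists2 g, sdiffs (fun x => pev (affine_lift i x) p) a g
    & forall t, (t *m g) ord0 ord0 = dp (affine_lift i a) (tangent_lift i t) p.
Proof.
elim/mpoly_ring_ind: p => [c|j|p q [g hg hgt] [h hh hht]|p q [g hg hgt] [h hh hht]].
- exists 0 => [|t]; last by rewrite mulmx0 mxE dpC.
  by apply: sdiffs_eq (sdiffs_cst c a) => x; rewrite pevC.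
- case: (unliftP i j) => [k ->|->].
    exists (delta_mx k ord0) => [|t]; last by rewrite -colE mxE dpX mxE liftK.
    by apply: sdiffs_eq (sdiffs_coord k a) => x; rewrite pevX mxE liftK.
  exists 0 => [|t]; last by rewrite mulmx0 mxE dpX mxE unlift_none.
  by apply: sdiffs_eq (sdiffs_cst 1 a) => x; rewrite pevX mxE unlift_none.
- exists (g + h) => [|t]; last by rewrite mulmxDr mxE hgt hht dpD.
  by apply: sdiffs_eq (sdiffsD hg hh) => x; rewrite pevD.
- exists (pev (affine_lift i a) q *: g + pev (affine_lift i a) p *: h) => [|t].
    by apply: sdiffs_eq (sdiffsM hg hh) => x; rewrite pevM.
  rewrite dpM -hgt -hht mulmxDr -!scalemxAr.
  by set A := _ *m g; set B := _ *m h; rewrite !mxE; ring.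
Qed.

Lemma chart_nices i (p : MP) (a : 'rV[C]_3) : nices (fun x => pev (affine_lift i x) p) a.
Proof. by exists 1 => // x _; have [g hg _] := chart_sdiffs i p x; exists g. Qed.

(* The orbit map of GL_2 at the cubic form A x^3 + D y^3 has an invertible
   differential at the identity. *)
Lemma diagonal_cubic_versal (A D : C) : A != 0 -> D != 0 ->
  exists (V : set 'rV[C]_4) (psi : 'rV[C]_4 -> 'rV[C]_4),
  let c := \row_j [tuple A; 0; 0; D]`_j in
  [/\ open V /\ (forall w, V w -> exists N, sdiff psi w N), V c, psi c = id2 C
    & forall w, V w -> forall x y : C,
      A * (psi w ord0 0 * x + psi w ord0 1 * y) ^+ 3 + D * (psi w ord0 2%:R * x + psi w ord0 3%:R * y) ^+ 3 =
      w ord0 0 * x ^+ 3 + w ord0 1 * x ^+ 2 * y + w ord0 2%:R * x * y ^+ 2 + w ord0 3%:R * y ^+ 3].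
Proof.
move=> A0 D0.
pose W j := pden (cubic_coefs A D j).
pose f (x : 'rV[C]_4) : 'rV[C]_4 := \row_j pev x (W j).
have hg x j : exists g, sdiffs (fun x => pev x (W j)) x g /\ forall t, (t *m g) ord0 ord0 = dp x t (W j).
  by have [g h1 h2] := pev_sdiffs (W j) x; exists g.
have fS x : exists2 M, sdiff f x M & forall t, t *m M = \row_j dp x t (W j).
  have [g Hg] := choice (hg x).
  exists (\matrix_(i, j) g j i ord0); first by apply: sdiff_row => j; exact: (Hg j).1.
  move=> t; apply/rowP => j; rewrite !mxE -(Hg j).2 mxE.
  by apply: eq_bigr => i _; rewrite !mxE.
have [M hM tM] := fS (id2 C).
have n3 : 3%:R != 0 :> C by rewrite pnatr_eq0.
have uM : M \in unitmx.
  rewrite -row_free_unit -kermx_eq0; apply/eqP/row_matrixP => i; rewrite row0.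
  set t := row i _; have : t *m M = 0 by rewrite /t -row_mul mulmx_ker row0.
  rewrite tM => /rowP tj; apply: (cubic_coefs_etale n3 A0 D0) => j.
  by have := tj j; rewrite !mxE.
have nf : nice f (id2 C) by exists 1 => // x _; have [N] := fS x; exists N.
have [U [V [psi [[Ue _] _ oV UV VU]]]] := inverse_function hM uM nf ltr01.
have fe : f (id2 C) = \row_j [tuple A; 0; 0; D]`_j.
  by apply/rowP => j; rewrite [LHS]mxE cubic_coefs_id2 [RHS]mxE.
exists V, psi; rewrite -fe; split => //; try by have [] := UV _ Ue.
move=> w Vw x y; have [_ fp] := VU w Vw.
by rewrite cubic_coefsE -[in RHS]fp ![f _ _ _]mxE.
Qed.

End Chart.

Section SumOfCubes.
Variable K : numClosedFieldType.

Lemma cube_root (x : K) : exists2 r, r ^+ 3 = x & (x != 0 -> r != 0).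
Proof.
exists (3.-root x) => [|x0]; first by rewrite rootCK.
by rewrite rootC_eq0.
Qed.

(* a^3 + d^3 = (a+d)^3 / 4 + 3 (a+d) (a-d)^2 / 4 *)
Lemma sum_of_cubes_D4 : exists (mu nu : K),
  [/\ mu != 0, nu != 0 & forall a d, (mu * (a - d)) ^+ 2 * (nu * (a + d)) + (nu * (a + d)) ^+ 3 = a ^+ 3 + d ^+ 3].
Proof.
have n4 : 4%:R != 0 :> K by rewrite pnatr_eq0.
have n3 : 3%:R != 0 :> K by rewrite pnatr_eq0.
have [nu hnu nu0] := cube_root 4%:R^-1.
have {}nu0 : nu != 0 by apply: nu0; rewrite invr_eq0.
pose mu := sqrtC (3%:R / 4%:R / nu).
have hmu : mu ^+ 2 = 3%:R / 4%:R / nu by rewrite sqrtCK.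
exists mu, nu; split => // [|a d].
  by rewrite sqrtC_eq0 !mulf_neq0 ?invr_eq0.
rewrite 2!exprMn hmu hnu.
have -> : 3%:R / 4%:R / nu * (a - d) ^+ 2 * (nu * (a + d)) =
          3%:R / 4%:R * (a - d) ^+ 2 * (a + d) * (nu / nu) by field; rewrite nu0.
by rewrite divff // mulr1; field.
Qed.

End SumOfCubes.

(** * From the algebraic condition to the analytic normal form *)

Section Criterion.
Variable R : realType.
Local Notation C := (Cplx R).
Local Notation MP := (mpoly.mpoly 4 C).

Theorem D4pt_analytic (F : MP) i (a : 'rV[C]_3) :
  D4pt F (affine_lift i a) -> analytically_equivalent (affine_part F i) a (@D4_model R) 0.
Proof.
move=> /D4pt_complete_square [|u1 [u2 [z [w [d0 [d1 [d2 [d3 [E [e1 e2 e3] [f1 f2 f3] [g1 g2] tr]]]]]]]]].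
  by rewrite pnatr_eq0.
set v := affine_lift i a in e1 e2 e3 f1 f2 f3 g1 g2 tr.
pose val (p : MP) (x : 'rV[C]_3) : C := pev (affine_lift i x) p.
have [V [psi [[oV sV] Vc psic hV]]] := diagonal_cubic_versal f2 f3.
set A := pev v d0 in Vc psic hV f2; set D := pev v d3 in Vc psic hV f3.
pose c (x : 'rV[C]_3) : 'rV[C]_4 := \row_j val [:: d0; d1; d2; d3]`_j x.
have cn : nice c a by apply: nice_row => j; exact: chart_nices.
have ca : c a = \row_j [tuple A; 0; 0; D]`_j.
  apply/rowP; elim/ord4_ind; rewrite [LHS]mxE [RHS]mxE //.
have [r1 r10 hr1] := nice_near cn oV (eq_ind_r V Vc ca).
pose m j (x : 'rV[C]_3) : C := psi (c x) ord0 j.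
have mn j : nices (m j) a.
  case: cn => r2 r20 hr2; exists (Num.min r1 r2); first by rewrite lt_min r10.
  move=> x; rewrite lt_min => /andP[x1 x2].
  have [N hN] := hr2 x x2; have [P hP] := sV _ (hr1 x x1).
  by eexists; exact: (sdiff_coord j (sdiff_comp hN hP)).
have [rho rho3 rho0] := cube_root A; have [sig sig3 sig0] := cube_root D.
have {}rho0 := rho0 f2; have {}sig0 := sig0 f3.
have [mu [nu [mu0 nu0 hmn]]] := sum_of_cubes_D4 C.
pose X (x : 'rV[C]_3) := rho * (m 0 x * val u1 x + m 1 x * val u2 x).
pose Y (x : 'rV[C]_3) := sig * (m 2%:R x * val u1 x + m 3%:R x * val u2 x).
pose T (j : 'I_3) (x : 'rV[C]_3) : C := [:: mu * (X x + - 1 * Y x); nu * (X x + Y x); val z x]`_j.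
have Xn : nices X a by apply: nicesM; [exact: nices_cst|apply: nicesD; apply: nicesM => //; exact: chart_nices].
have Yn : nices Y a by apply: nicesM; [exact: nices_cst|apply: nicesD; apply: nicesM => //; exact: chart_nices].
have Tn j : nices (T j) a.
  rewrite /T; case: j => [[|[|[|j]]] lj] //=; last exact: chart_nices.
    apply: nicesM; [exact: nices_cst|apply: nicesD => //].
    by apply: nicesM => //; exact: nices_cst.
  by apply: nicesM; [exact: nices_cst|apply: nicesD].
pose f x : 'rV[C]_3 := \row_j T j x.
have fn : nice f a by exact: nice_row.
have inball : nr (a - a) < 1 by rewrite subrr nr0.
have here n (h : 'rV[C]_n -> C) (b : 'rV[C]_n) : nices h b -> exists g, sdiffs h b g.
  by move=> [d d0' hd]; apply: hd; rewrite subrr nr0.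
have m0 : [/\ m 0 a = 1, m 1 a = 0, m 2%:R a = 0 & m 3%:R a = 1].
  by rewrite /m ca psic; exact: id2E.
case: m0 => m00 m01 m02 m03.
have [gm0 hm0] := here _ _ _ (mn 0). have [gm1 hm1] := here _ _ _ (mn 1).
have [gm2 hm2] := here _ _ _ (mn 2%:R). have [gm3 hm3] := here _ _ _ (mn 3%:R).
have [h1 hh1 ht1] := chart_sdiffs i u1 a. have [h2 hh2 ht2] := chart_sdiffs i u2 a.
have [hz hhz htz] := chart_sdiffs i z a.
have v1 : val u1 a = 0 by []. have v2 : val u2 a = 0 by [].
(* The unknown derivatives of the [m j] come multiplied by u1(a) = u2(a) = 0 and drop out; only the
   value of the matrix [m] at [a], the identity, remains. *)
have dX : sdiffs X a (rho *: h1).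
  have := sdiffsM (sdiffs_cst rho a) (sdiffsD (sdiffsM hm0 hh1) (sdiffsM hm1 hh2)).
  by rewrite -/(val u1 a) -/(val u2 a) m00 m01 v1 v2 !scale0r scale1r !scaler0 !add0r addr0.
have dY : sdiffs Y a (sig *: h2).
  have := sdiffsM (sdiffs_cst sig a) (sdiffsD (sdiffsM hm2 hh1) (sdiffsM hm3 hh2)).
  by rewrite -/(val u1 a) -/(val u2 a) m02 m03 v1 v2 !scale0r scale1r !scaler0 !add0r.
pose G (j : 'I_3) := [:: mu *: (rho *: h1 + - 1 *: (sig *: h2)); nu *: (rho *: h1 + sig *: h2); hz]`_j.
have dT j : sdiffs (T j) a (G j).
  case: j => [[|[|[|j]]] lj]; [| |exact: hhz|by []].
    have := sdiffsM (sdiffs_cst mu a) (sdiffsD dX (sdiffsM (sdiffs_cst (-1) a) dY)).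
    by rewrite !scaler0 !add0r.
  by have := sdiffsM (sdiffs_cst nu a) (sdiffsD dX dY); rewrite !scaler0 !add0r.
pose M : 'M[C]_3 := \matrix_(k, j) G j k ord0.
have fM : sdiff f a M by exact: sdiff_row.
have uM : M \in unitmx.
  rewrite -row_free_unit -kermx_eq0; apply/eqP/row_matrixP => k; rewrite row0.
  set t := row k _; have tM : t *m M = 0 by rewrite /t -row_mul mulmx_ker row0.
  clearbody t.
  have tG j : (t *m G j) ord0 ord0 = 0.
    have := congr1 (fun N : 'rV[C]_3 => N ord0 j) tM; rewrite [RHS]mxE => <-; rewrite !mxE.
    by apply: eq_bigr => l _; rewrite !mxE.
  have tr' : exists b, tangent_lift i t = b *: v.
    have T0 := tG 0; have T1 := tG 1; have T2 := tG 2%:R.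
    have lin (x y y' : C) g h : (t *m (x *: (y *: g + y' *: h))) ord0 ord0
        = x * (y * (t *m g) ord0 ord0 + y' * (t *m h) ord0 ord0).
      rewrite -scalemxAr mulmxDr -!scalemxAr; set P := t *m g; set Q := t *m h.
      by rewrite !mxE.
    move: T0 T1 T2; rewrite /G /= scalerA !lin htz ht1 ht2.
    set p1 := dp _ _ u1; set p2 := dp _ _ u2.
    move=> /eqP; rewrite mulf_eq0 (negPf mu0) /= => /eqP T0.
    move=> /eqP; rewrite mulf_eq0 (negPf nu0) /= => /eqP T1 T2.
    have two0 : 2%:R != 0 :> C by rewrite pnatr_eq0.
    have z1 : p1 = 0.
      have : 2%:R * (rho * p1) = 0 by rewrite -[RHS]addr0 -{1}T0 -T1; ring.
      by move=> /eqP; rewrite !mulf_eq0 (negPf two0) (negPf rho0) /= => /eqP.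
    have z2 : p2 = 0.
      by move: T1; rewrite z1 mulr0 add0r => /eqP; rewrite mulf_eq0 (negPf sig0) /= => /eqP.
    exact: tr.
  case: tr' => b hb.
  (* A lifted tangent vector has i-th coordinate 0, whereas [v] has i-th coordinate 1. *)
  have b0 : b = 0.
    by have := congr1 (fun N : 'rV[C]_4 => N ord0 i) hb; rewrite !mxE unlift_none mulr1.
  apply/rowP => l; have := congr1 (fun N : 'rV[C]_4 => N ord0 (lift i l)) hb.
  by rewrite !mxE liftK b0 mul0r.
(* The neighbourhood is shrunk so that [w] has no zero: there F = 0 and w F = 0 define the same
   set. *)
have [r2 r20 hr2] := nices_near (chart_nices i w a) f1.
have r3 : 0 < Num.min r1 r2 by rewrite lt_min r10.
have [U [V' [phi [[Ua Ur] [oU sU] [oV' sV'] UV VU]]]] := inverse_function fM uM fn r3.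
have fa : f a = 0.
  have Xa : X a = 0 by rewrite /X v1 v2 !mulr0 addr0 mulr0.
  have Ya : Y a = 0 by rewrite /Y v1 v2 !mulr0 addr0 mulr0.
  apply/rowP => j; rewrite [LHS]mxE [RHS]mxE /T Xa Ya !mulr0 !addr0 !mulr0.
  by case: j => [[|[|[|j]]] lj].
exists U, V', f, phi; split => //.
- split; split => // x hx; first by have [N] := sU x hx; exact: sdiff_differentiable.
  by have [N] := sV' x hx; exact: sdiff_differentiable.
- move=> x Ux; have := Ur x Ux; rewrite /nball /= lt_min => /andP[x1 x2].
  have wx := hr2 x x2; have := hV _ (hr1 x x1) (val u1 x) (val u2 x).
  rewrite -/(m 0 x) -/(m 1 x) -/(m 2%:R x) -/(m 3%:R x) => cub.
  have XY : X x ^+ 3 + Y x ^+ 3 = val d0 x * val u1 x ^+ 3 + val d1 x * val u1 x ^+ 2 * val u2 x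
     + val d2 x * val u1 x * val u2 x ^+ 2 + val d3 x * val u2 x ^+ 3.
    by rewrite /X /Y !exprMn rho3 sig3 cub /c !mxE.
  have key : val w x * val F x = val z x ^+ 2 + (X x ^+ 3 + Y x ^+ 3).
    rewrite XY -[LHS]pevM E !(pevD, pevM, pevXn) //.
  rewrite /D4_model /affine_part /= ![f x _ _]mxE /T /=.
  have -> : (mu * (X x + -1 * Y x)) ^+ 2 * (nu * (X x + Y x)) + (nu * (X x + Y x)) ^+ 3 + val z x ^+ 2 = val w x * val F x.
    by rewrite key mulN1r hmn addrC.
  have -> : mpoly.meval (affine_lift i x 0) F = val F x by rewrite /val /pev.
  split => [->|/eqP]; first by rewrite mulr0.
  by rewrite mulf_eq0 (negPf wx) => /eqP.
Qed.

End Criterion.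

(** * Common zeros of two forms on a plane *)

Section PlaneSection.
Variable K : closedFieldType.
Local Notation MP := (mpoly.mpoly 4 K).

(** A nonconstant p would make p + 1 nonconstant, and a root of p + 1 is a point where p takes the
    value -1. *)
Lemma closed_poly_eq0 (p : {poly K}) : (forall x, p.[x] = 0) -> p = 0.
Proof.
move=> hp; have [/size_poly1P [c c0 pc]|sp] := boolP (size p == 1%N).
  by move: (hp 0); rewrite pc hornerC => ->.
have [->//|p0] := eqVneq p 0.
have : size (p + 1) != 1%N.
  have s1 : (1 < size p)%N by rewrite ltn_neqAle eq_sym sp size_poly_gt0.
  by rewrite size_polyDl ?size_poly1.
move=> /closed_rootP [x /rootP]; rewrite hornerD hornerC hp add0r => /eqP.
by rewrite oner_eq0.
Qed.

(** The restriction to x_0 = x_3 as a polynomial in x_1. The values [a] of x_0, x_3 and [b] of x_2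
    lie in an arbitrary ring [A], so that they can be scalars or polynomials in a parameter. *)
Definition section_poly (A : comNzRingType) (f : {rmorphism K -> A}) (a b : A) (p : MP) : {poly A} :=
  mpoly.mmap (polyC \o f) (fun i : 'I_4 => nth 0 [:: a%:P; 'X; b%:P; a%:P] i) p.

Definition monomial_part (A : comNzRingType) (a b : A) (m : mpoly.multinom 4) : A :=
  a ^+ (m 0) * b ^+ (m 2%:R) * a ^+ (m 3%:R).

Lemma section_polyE (A : comNzRingType) (f : {rmorphism K -> A}) a b p :
  section_poly f a b p = \sum_(m <- mpoly.msupp p)
     (f (mpoly.mcoeff m p) * monomial_part a b m)%:P * 'X^(m 1).
Proof.
rewrite /section_poly /mpoly.mmap; apply: eq_bigr => m _.
rewrite /mpoly.mmap1 !big_ord_recl big_ord0 /= /monomial_part !polyCM !polyC_exp.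
have -> : lift ord0 ord0 = 1 :> 'I_4 by apply: val_inj.
have -> : lift ord0 (lift ord0 ord0) = 2%:R :> 'I_4 by apply: val_inj.
have -> : lift ord0 (lift ord0 (lift ord0 ord0)) = 3%:R :> 'I_4 by apply: val_inj.
rewrite -/(0 : 'I_4); ring.
Qed.

Lemma section_poly_map (A B : comNzRingType) (f : {rmorphism K -> A}) (h : {rmorphism A -> B}) a b p :
  map_poly h (section_poly f a b p) = section_poly (h \o f) (h a) (h b) p.
Proof.
rewrite !section_polyE rmorph_sum; apply: eq_bigr => m _.
by rewrite rmorphM /= map_polyXn map_polyC /= /monomial_part !rmorphM !rmorphXn.
Qed.

Definition e1 : 'rV[K]_4 := delta_mx 0 1.

Lemma mdeg4 (m : mpoly.multinom 4) : mpoly.mdeg m = (m 0%R + m 1%R + m 2%:R%R + m 3%:R%R)%N.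
Proof.
rewrite mpoly.mdegE !big_ord_recl big_ord0 addn0 !addnA.
by congr (m _ + m _ + m _ + m _)%N; apply: val_inj.
Qed.

Lemma pev_e1 p : pev e1 p = \sum_(m <- mpoly.msupp p) mpoly.mcoeff m p * monomial_part 0 0 m.
Proof.
rewrite /pev mpoly.mevalE; apply: eq_bigr => m _; congr (_ * _).
rewrite !big_ord_recl big_ord0 !mxE /= /monomial_part mulr1.
have -> : lift ord0 (lift ord0 ord0) = 2%:R :> 'I_4 by apply: val_inj.
have -> : lift ord0 (lift ord0 (lift ord0 ord0)) = 3%:R :> 'I_4 by apply: val_inj.
by rewrite /= expr1n mul1r mulrA.
Qed.

(** Only the monomial x_1^d contributes to degree d, every other one of degree d having a smaller
    power of x_1. The leading coefficient thus does not depend on [a] and [b], and resultants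
    commute with their specialization. *)
Lemma section_poly_lead (A : comNzRingType) (f : {rmorphism K -> A}) a b p d :
  p \is mpoly.ishomog1 d mpoly.mdeg ->
  (section_poly f a b p)`_d = f (pev e1 p) /\ (size (section_poly f a b p) <= d.+1)%N.
Proof.
move=> /mpoly.dhomogP hp; split.
  rewrite section_polyE coef_sum pev_e1 rmorph_sum big_seq [RHS]big_seq; apply: eq_bigr => m hm.
  have : mpoly.mdeg m = d := hp m hm; rewrite mdeg4 => <-; rewrite coefCM coefXn rmorphM -mulrA; congr (_ * _).
  rewrite /monomial_part; case: eqP => h.
    have [-> -> ->] : [/\ m 0 = 0%N, m 2%:R = 0%N & m 3%:R = 0%N].
      by move: h; move: (m 0) (m 1) (m 2%:R) (m 3%:R) => x0 x1 x2 x3 h; split; lia.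
    by rewrite !expr0 !mulr1 rmorph1.
  rewrite mulr0 rmorphM rmorphM !rmorphXn rmorph0 !expr0n.
  case: eqP => h0; last by rewrite !mul0r.
  case: eqP => h2; last by rewrite mulr0 mul0r.
  by case: eqP => h3; [lia|rewrite mulr0].
apply/leq_sizeP => j hj; rewrite section_polyE coef_sum big_seq big1 // => m hm.
rewrite coefCM coefXn; have : mpoly.mdeg m = d := hp m hm; rewrite mdeg4 => hd.
by case: eqP => [h|]; [lia|rewrite mulr0].
Qed.

Definition plane_pt (s y t : K) : 'rV[K]_4 := \row_i nth 0 [:: s; y; t; s] i.

Lemma section_poly_horner s t p y :
  (section_poly idfun s t p).[y] = pev (plane_pt s y t) p.
Proof.
rewrite section_polyE /pev mpoly.mevalE horner_sum; apply: eq_bigr => m _.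
rewrite hornerM hornerC hornerXn -mulrA; congr (_ * _).
rewrite !big_ord_recl big_ord0 !mxE /= /monomial_part mulr1.
have -> : lift ord0 ord0 = 1 :> 'I_4 by apply: val_inj.
have -> : lift ord0 (lift ord0 ord0) = 2%:R :> 'I_4 by apply: val_inj.
have -> : lift ord0 (lift ord0 (lift ord0 ord0)) = 3%:R :> 'I_4 by apply: val_inj.
rewrite -/(0 : 'I_4); ring.
Qed.

(* The eliminant of y vanishes at the origin of the (s, t)-plane; a polynomial
   in two variables has no isolated zero over a closed field. *)
Theorem common_zero_on_plane (G H : MP) m n : (0 < m)%N -> (0 < n)%N ->
  G \is mpoly.ishomog1 m mpoly.mdeg -> H \is mpoly.ishomog1 n mpoly.mdeg ->
  pev e1 G != 0 -> pev e1 H != 0 ->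
  exists x : 'rV[K]_4, [/\ x != 0, x ord0 0 = x ord0 3%:R, pev x G = 0 & pev x H = 0].
Proof.
move=> m0 n0 hG hH G1 H1.
pose rho s t := resultant (section_poly idfun s t G) (section_poly idfun s t H).
have lead (A : comNzRingType) (f : {rmorphism K -> A}) a b p d : p \is mpoly.ishomog1 d mpoly.mdeg ->
    pev e1 p != 0 -> f (pev e1 p) != 0 ->
    size (section_poly f a b p) = d.+1 /\ lead_coef (section_poly f a b p) = f (pev e1 p).
  move=> hp _ fp; have [c s] := section_poly_lead f a b hp.
  have sz : size (section_poly f a b p) = d.+1.
    by apply/eqP; rewrite eqn_leq s ltnNge; apply/negP => /leq_sizeP /(_ d (leqnn _)) E; rewrite -c E eqxx in fp.
  by rewrite lead_coefE sz /= c.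
(* On a parametrized line of the (s, t)-plane the eliminant is a polynomial in the parameter. *)
have lineR s0 s1 t0 t1 : exists P : {poly K}, forall x, P.[x] = rho (s0 + s1 * x) (t0 + t1 * x).
  pose a := s0%:P + s1 *: 'X; pose b := t0%:P + t1 *: 'X.
  exists (resultant (section_poly polyC a b G) (section_poly polyC a b H)) => x.
  have pc c : c != 0 -> (c%:P : {poly K}) != 0 by rewrite polyC_eq0.
  have [_ lG] := lead _ (polyC : {rmorphism K -> {poly K}}) a b _ _ hG G1 (pc _ G1).
  have [_ lH] := lead _ (polyC : {rmorphism K -> {poly K}}) a b _ _ hH H1 (pc _ H1).
  have := @map_resultant _ _ (horner_eval x : {rmorphism {poly K} -> K}) (section_poly polyC a b G) (section_poly polyC a b H).
  rewrite lG lH /= /horner_eval !hornerC => /(_ G1 H1) ->.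
  rewrite /rho !(section_poly_map _ (horner_eval x : {rmorphism {poly K} -> K})).
  have e q : section_poly (horner_eval x \o polyC) (horner_eval x a) (horner_eval x b) q
      = section_poly idfun (s0 + s1 * x) (t0 + t1 * x) q.
    rewrite !section_polyE; apply: eq_bigr => k _.
    by rewrite /= /horner_eval hornerC /a /b !hornerE.
  by rewrite !e.
have zero s t : rho s t = 0 -> exists y, pev (plane_pt s y t) G = 0 /\ pev (plane_pt s y t) H = 0.
  move=> /eqP; rewrite /rho resultant_eq0 => gt.
  have [|y] := @closed_rootP K (gcdp (section_poly idfun s t G) (section_poly idfun s t H)) _.
    by rewrite neq_ltn gt orbT.
  by rewrite root_gcd => /andP[/rootP gy /rootP hy]; exists y; rewrite -!section_poly_horner.
have rho00 : rho 0 0 = 0.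
  apply/eqP; rewrite /rho resultant_eq0.
  have sG : size (section_poly idfun 0 0 G) = m.+1 by have [] := lead _ (idfun : {rmorphism K -> K}) 0 0 _ _ hG G1 G1.
  have r p d : (0 < d)%N -> p \is mpoly.ishomog1 d mpoly.mdeg -> root (section_poly idfun 0 0 p) 0.
    move=> d0 /mpoly.dhomogP hp; apply/rootP; rewrite section_polyE horner_sum big_seq big1 // => k hk.
    have : mpoly.mdeg k = d := hp k hk; rewrite mdeg4 => hd.
    rewrite hornerM hornerC hornerXn /monomial_part !expr0n.
    case: eqP => h0 /=; last by rewrite !mul0r mulr0 mul0r.
    case: eqP => h2 /=; last by rewrite mulr0 mul0r mulr0 mul0r.
    case: eqP => h3 /=; last by rewrite mulr0 mulr0 mul0r.
    by case: eqP => h1 /=; [lia|rewrite mulr0].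
  apply: (@root_size_gt1 _ 0); last by rewrite root_gcd !(r _ _ _ hG, r _ _ _ hH).
  by rewrite gcdp_eq0 negb_and -size_poly_gt0 sG.
have [[[s t] /= [st0 r0]]|noz] := pselect (exists st : K * K, (st.1 != 0 \/ st.2 != 0) /\ rho st.1 st.2 = 0).
  have [y [Gy Hy]] := zero s t r0; exists (plane_pt s y t); split => //; last by rewrite !mxE.
  apply/eqP => /rowP P; case: st0 => /eqP; apply.
    by have := P 0; rewrite !mxE.
  by have := P 2%:R; rewrite !mxE.
exfalso; apply: noz.
have [[[s t] /= [st0 r0]]|noz] := pselect (exists st : K * K, (st.1 != 0 \/ st.2 != 0) /\ rho st.1 st.2 = 0).
  by exists (s, t).
(* If the origin were the only zero, the eliminant would be constant on each line of fixed t != 0.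
   The polynomials rho(1, t) and rho(0, t) then agree for t != 0, hence also at t = 0, and rho(1, 0)
   = rho(0, 0) = 0. *)
exists (1, 0) => /=; split; first by left; exact: oner_neq0.
have cst t : t != 0 -> rho 1 t = rho 0 t.
  move=> t0; have [P hP] := lineR 0 1 t 0.
  have : size P = 1%N.
    apply/eqP; apply: contraT => sP; exfalso; have [x /rootP Px] := @closed_rootP K P sP.
    apply: noz; exists (x, t); split; first by right.
    by move: Px; rewrite hP add0r mul1r mul0r addr0.
  move=> /eqP /size_poly1P [c _ Pc]; have := hP 1; have := hP 0.
  by rewrite Pc !hornerC !mulr1 !mulr0 !addr0 !add0r => <-.
have [A hA] := lineR 1 0 0 1; have [B hB] := lineR 0 0 0 1.
have AB : A = B.
  have : (A - B) * 'X = 0.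
    apply: closed_poly_eq0 => t; rewrite hornerM hornerX hornerD hornerN hA hB !mul0r !mul1r !addr0 !add0r.
    by have [->|t0] := eqVneq t 0; [rewrite mulr0|rewrite cst // subrr mul0r].
  by move=> /eqP; rewrite mulf_eq0 polyX_eq0 orbF subr_eq0 => /eqP.
by have := hB 0; rewrite -AB hA !mul0r mulr0 !addr0 rho00.
Qed.

End PlaneSection.

Local Notation homog d p := (p \is mpoly.ishomog1 d mpoly.mdeg).

(** * Homogeneous polynomials and their factors *)

Section Homogeneous.
Variable K : fieldType.
Variable n : nat.
Local Notation MP := (mpoly.mpoly n K).

Lemma homogP d (p : MP) : reflect (forall m, m \in mpoly.msupp p -> mpoly.mdeg m = d) (homog d p).
Proof. by apply: (iffP (mpoly.dhomogP _ _ _)). Qed.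

Lemma curve_homog d (p : MP) (x : 'rV[K]_n) (q : {poly K}) : homog d p ->
  curve (fun i => x ord0 i *: q) p = pev x p *: q ^+ d.
Proof.
move=> /homogP hp; rewrite /curve /mpoly.mmap /pev mpoly.mevalE scaler_suml.
rewrite big_seq [RHS]big_seq; apply: eq_bigr => m hm.
rewrite -(hp m hm) mpoly.mdegE /mpoly.mmap1 -mul_polyC polyCM -mulrA; congr (_ * _).
rewrite rmorph_prod -prodrXr -big_split /=; apply: eq_bigr => i _.
by rewrite exprZn -mul_polyC polyC_exp.
Qed.

(** Compare linear coefficients in p((1 + X) x) = (1 + X)^d p(x). *)
Lemma euler d (p : MP) (x : 'rV[K]_n) : homog d p -> dp x x p = d%:R * pev x p.
Proof.
move=> hp; have := curve_homog x (1 + 'X) hp.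
rewrite (_ : curve _ p = curve (line x x) p); last first.
  congr curve; apply/funext => i; rewrite /line scalerDr -mul_polyC mulr1 //.
move=> /(congr1 (coefp 1)) /=; rewrite coefZ -/(dp x x p) => ->; rewrite mulrC; congr (_ * _).
elim: d {hp} => [|d ih]; first by rewrite expr0 coef1.
rewrite exprS mulrDl mul1r coefD coefXM /= ih -natr1; congr (_ + _).
by elim: d {ih} => [|d ih]; rewrite ?expr0 ?coef1 // exprS mulrDl mul1r coefD coefXM /= addr0.
Qed.

(** Replacing each variable Y_i by Y_i X collects the homogeneous components as coefficients in X.
    Being a ring morphism, it turns homogeneous factorizations into factorizations of a monomial in
    X. *)
Definition grading (p : MP) : {poly MP} := mpoly.mmap (polyC \o @mpoly.mpolyC n K) (fun i => ('Y_i)%:P * 'X) p.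

Lemma gradingE p : grading p = \sum_(m <- mpoly.msupp p)
   (mpoly.mcoeff m p *: mpoly.mpolyX K m)%:P * 'X^(mpoly.mdeg m).
Proof.
rewrite /grading /mpoly.mmap; apply: eq_bigr => m _.
rewrite -mpoly.mul_mpolyC polyCM -mulrA; congr (_ * _).
rewrite mpoly.mpolyXE_id rmorph_prod mpoly.mdegE -prodrXr /mpoly.mmap1 -big_split /=.
by apply: eq_bigr => i _; rewrite exprMn rmorphXn.
Qed.

Lemma grading_homog d p : homog d p -> grading p = p%:P * 'X^d.
Proof.
move=> /homogP hp; rewrite gradingE [in RHS](mpoly.mpolyE p) rmorph_sum mulr_suml.
by rewrite big_seq [RHS]big_seq; apply: eq_bigr => m /hp ->.
Qed.

Lemma homog_grading d p : grading p = p%:P * 'X^d -> homog d p.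
Proof.
move=> E; apply/homogP => m hm; apply/eqP; apply: contraTT hm => md.
rewrite mpoly.mcoeff_msupp negbK.
have := congr1 (fun q : {poly MP} => mpoly.mcoeff m q`_(mpoly.mdeg m)) E.
rewrite coefCM coefXn (negPf md) mulr0 mpoly.mcoeff0 gradingE coef_sum raddf_sum /= => <-.
have [ms|ms] := boolP (m \in mpoly.msupp p); last first.
  rewrite big_seq big1 ?mpoly.memN_msupp_eq0 // => m' hm'.
  rewrite coefCM coefXn; case: eqP => _; last by rewrite mulr0 mpoly.mcoeff0.
  rewrite mulr1 mpoly.mcoeffZ mpoly.mcoeffX; case: eqP => [mm|_]; last by rewrite mulr0.
  by rewrite mm in hm'; rewrite hm' in ms.
rewrite (bigD1_seq m) //= big1 ?addr0.
  by rewrite coefCM coefXn eqxx mulr1 mpoly.mcoeffZ mpoly.mcoeffX eqxx mulr1.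
move=> m' mm; rewrite coefCM coefXn; case: eqP => _; last by rewrite mulr0 mpoly.mcoeff0.
by rewrite mulr1 mpoly.mcoeffZ mpoly.mcoeffX (negPf mm) mulr0.
Qed.

End Homogeneous.

Lemma poly_strip_X (A : idomainType) (p : {poly A}) : p != 0 -> exists q k, p = q * 'X^k /\ q`_0 != 0.
Proof.
move=> p0; have [k] : exists k, p`_k != 0.
  by exists (size p).-1; rewrite -lead_coefE lead_coef_eq0.
move=> pk; have ex : exists k, p`_k != 0 by exists k.
case: (ex_minnP ex) => j pj jmin; exists (drop_poly j p), j; split.
  rewrite -[LHS](poly_take_drop j) [take_poly j p](_ : _ = 0) ?add0r //.
  apply/polyP => i; rewrite coef_take_poly coef0; case: ltnP => // ij.
  by apply/eqP; apply: contraTT ij => /jmin; rewrite -leqNgt.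
by rewrite coef_drop_poly add0n.
Qed.

(** After the powers of X are stripped off, both cofactors have nonzero constant terms. Their
    product is therefore [c] itself, and both are constant. *)
Lemma monomial_factor (A : idomainType) (p q : {poly A}) (c : A) d : c != 0 ->
  p * q = c%:P * 'X^d -> exists a e, p = a%:P * 'X^e.
Proof.
move=> c0 E.
have : p * q != 0 by rewrite E mulf_neq0 ?polyC_eq0 ?expf_neq0 ?polyX_eq0.
rewrite mulf_eq0 negb_or => /andP[/poly_strip_X [p1 [e [pE p10]]] /poly_strip_X [q1 [f [qE q10]]]].
exists p1`_0, e; rewrite pE; congr (_ * _).
have {}E : p1 * q1 * 'X^(e + f) = c%:P * 'X^d.
  by rewrite -E pE qE exprD mulrACA.
have pq0 : (p1 * q1)`_0 != 0 by rewrite coef0M mulf_neq0.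
have efd : (e + f)%N = d.
  apply/eqP; rewrite eqn_leq; apply/andP; split; rewrite leqNgt; apply/negP => h.
    have := congr1 (coefp d) E; rewrite /= coefMXn h coefCM coefXn eqxx mulr1 => /esym/eqP.
    by rewrite (negPf c0).
  have := congr1 (coefp (e + f)) E; rewrite /= coefMXn ltnn subnn coefCM coefXn (ltn_eqF h) mulr0 => /eqP.
  by rewrite (negPf pq0).
have {}E : p1 * q1 = c%:P.
  by apply: (mulIf (_ : 'X^d != 0)); rewrite ?expf_neq0 ?polyX_eq0 // -E efd.
have := congr1 (fun r : {poly A} => size r) E; rewrite size_polyC c0 /=.
have p1n : p1 != 0 by apply: contraNneq p10 => ->; rewrite coef0.
have q1n : q1 != 0 by apply: contraNneq q10 => ->; rewrite coef0.
rewrite size_mul // => sz; apply: size1_polyC.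
by have := size_poly_gt0 p1; have := size_poly_gt0 q1; rewrite p1n q1n; move: sz; lia.
Qed.

Lemma homog_factor (K : fieldType) n (G H : mpoly.mpoly n K) d :
  G * H != 0 -> homog d (G * H) -> exists e, homog e G.
Proof.
move=> GH0 hGH.
have := grading_homog hGH; rewrite {1}/grading rmorphM => /(monomial_factor GH0) [a [e E]].
have ga (p : mpoly.mpoly n K) : (grading p).[1] = p.
  rewrite gradingE horner_sum [RHS]mpoly.mpolyE; apply: eq_bigr => m _.
  by rewrite hornerM hornerC hornerXn expr1n mulr1.
exists e; apply: homog_grading; rewrite {1}/grading E.
by rewrite -[in RHS](ga G) /grading E hornerM hornerC hornerXn expr1n mulr1.
Qed.

(** * Power covers *)

Section PowerCover.
Variable K : numClosedFieldType.
Local Notation MP := (mpoly.mpoly 4 K).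
Variables (W : 'M[K]_4) (k : nat).
Hypotheses (uW : W \in unitmx) (k0 : (0 < k)%N).

(** The cover x |-> (x_j^k)_j W. The rows of [W] are the vertices of the tetrahedron, and its faces
    are y_j = 0 in the coordinates y = v W^-1. *)
Definition power_map (i : 'I_4) : MP := \sum_j mpolyC 4 (W j i) * 'Y_j ^+ k.

Definition powers (x : 'rV[K]_4) : 'rV[K]_4 := \row_j x ord0 j ^+ k.

Lemma pev_sum n (v : 'rV[K]_n) (I : Type) (r : seq I) (p : I -> mpoly.mpoly n K) :
  pev v (\sum_(i <- r) p i) = \sum_(i <- r) pev v (p i).
Proof. exact: raddf_sum. Qed.

Lemma pmap_power x : pmap power_map x = powers x *m W.
Proof.
apply/rowP => i; rewrite !mxE pev_sum; apply: eq_bigr => j _.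
by rewrite pevM pevC pevXn pevX mxE mulrC.
Qed.

Lemma dp_sum n (v t : 'rV[K]_n) (I : Type) (r : seq I) (p : I -> mpoly.mpoly n K) :
  dp v t (\sum_(i <- r) p i) = \sum_(i <- r) dp v t (p i).
Proof. by elim/big_rec2: _ => [|i y1 y2 _ <-]; rewrite ?dp0 ?dpD. Qed.

Lemma dpmap_power x t :
  dpmap power_map x t = (\row_j (k%:R * x ord0 j ^+ k.-1 * t ord0 j)) *m W.
Proof.
apply/rowP => i; rewrite !mxE dp_sum; apply: eq_bigr => j _.
rewrite mxE dpM dpC mul0r addr0 pevC; case: k k0 => // k' _.
by rewrite dpXn dpX pevX mulrC.
Qed.

Definition power_cover (F : MP) : MP := subst power_map F.

Lemma power_cover_homog d F : homog d F -> homog (d * k)%N (power_cover F).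
Proof.
move=> /homogP hF; rewrite /power_cover /subst /mpoly.mmap.
rewrite big_seq; apply: rpred_sum => m /hF md; rewrite mpoly.mul_mpolyC; apply: mpoly.dhomogZ.
rewrite /mpoly.mmap1 -md mpoly.mdegE big_distrl /=.
elim/big_rec2: _ => [|i p e _ he]; first exact: mpoly.dhomog1.
apply: mpoly.dhomogM he; rewrite mulnC; apply: mpoly.dhomogMn.
apply: rpred_sum => j _; rewrite mpoly.mul_mpolyC; apply: mpoly.dhomogZ.
have := @mpoly.dhomogMn 4 K mpoly.mdeg 1 'Y_j k; rewrite mul1n; apply.
by rewrite mpoly.dhomogX /= mpoly.mdeg1.
Qed.

Lemma powers_eq0 x : powers x = 0 -> x = 0.
Proof.
move=> /rowP h; apply/rowP => i; have := h i; rewrite !mxE => /eqP.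
by rewrite expf_eq0 k0 /= => /eqP.
Qed.

Lemma natk : k%:R != 0 :> K.
Proof. by rewrite pnatr_eq0 -lt0n. Qed.

Lemma D4pt_power_cover F (x : 'rV[K]_4) : (forall i, x ord0 i != 0) ->
  D4pt F (powers x *m W) -> D4pt (power_cover F) x.
Proof.
move=> x0 hF; apply: D4pt_subst; rewrite pmap_power // => t a.
rewrite dpmap_power scalemxAl => /(can_inj (mulmxK uW)) /rowP h.
exists (a / k%:R); apply/rowP => j; have := h j; rewrite !mxE.
have xk : x ord0 j ^+ k = x ord0 j ^+ k.-1 * x ord0 j by rewrite -exprSr prednK.
have xk0 : x ord0 j ^+ k.-1 != 0 by rewrite expf_neq0.
rewrite xk => E; apply: (mulfI xk0); apply: (mulfI natk).
rewrite mulrA E; field; exact: natk.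
Qed.

Variables (d : nat) (F : MP).
Hypotheses (d0 : (0 < d)%N) (hF : homog d F).

(* Only the points of the plane y_0 = y_3 matter; y_i dF = 0 rather than dF = 0
   accounts for the ramification of the power map along y_i = 0. *)
Definition toric_critical_D4 := forall y : 'rV[K]_4, y != 0 -> y ord0 0 = y ord0 3%:R ->
  (forall i, y ord0 i * dp (y *m W) (row i W) F = 0) ->
  D4pt F (y *m W) /\ forall i, y ord0 i != 0.

Hypothesis crit : toric_critical_D4.

(** If F vanished at the vertex 1, Euler's identity would give the only nontrivial critical
    condition there, and the vertex, which lies on faces, would contradict [crit]. This nonvanishing
    is what [common_zero_on_plane] asks of the factors. *)
Lemma power_cover_e1 : pev (e1 K) (power_cover F) != 0.
Proof.
have pe : powers (e1 K) = e1 K.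
  apply/rowP => i; rewrite !mxE eqxx /=; case: eqP => _ /=; first by rewrite expr1n.
  by rewrite expr0n eqn0Ngt k0.
rewrite pev_subst pmap_power pe; apply/negP => /eqP Fe.
have [||i|_ /(_ 0)] := @crit (e1 K).
- by apply/eqP => /rowP /(_ 1) /eqP; rewrite !mxE /= oner_eq0.
- by rewrite !mxE.
- have [->|i1] := eqVneq i 1; first by rewrite rowE -/(e1 K) (euler _ hF) Fe !mulr0.
  by rewrite mxE (negPf i1) andbF mul0r.
by rewrite mxE eqxx.
Qed.

Theorem power_cover_irreducible :
  [/\ power_cover F != 0, power_cover F \isn't a GRing.unit
    & forall G H : MP, power_cover F = G * H -> G \is a GRing.unit \/ H \is a GRing.unit].
Proof.
have Fe1 := power_cover_e1; have hFk := power_cover_homog hF.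
have F0 : power_cover F != 0 by apply: contraNneq Fe1 => ->; rewrite pev0.
have dk : (0 < d * k)%N by rewrite muln_gt0 d0.
have homog_const e (p : MP) c : homog e p -> p = mpolyC 4 c -> p != 0 -> e = 0%N.
  move=> hp pc p0; apply: (mpoly.dhomog_uniq p0 hp); rewrite pc -[mpolyC 4 c]mulr1 mpoly.mul_mpolyC.
  by apply: mpoly.dhomogZ; exact: mpoly.dhomog1.
split => //.
  apply/negP => /andP[/eqP pc _]; have := homog_const _ _ _ hFk pc F0; lia.
move=> G H E.
have GH0 : G * H != 0 by rewrite -E.
have [m hG] := homog_factor GH0 (eq_ind _ (fun p => homog (d * k)%N p) hFk _ E).
have [n hH] : exists n, homog n H.
  apply: (@homog_factor _ _ H G (d * k)%N); rewrite mulrC // -E //.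
move: GH0; rewrite mulf_eq0 negb_or => /andP[G0 H0].
have unit0 (p : MP) : p != 0 -> homog 0 p -> p \is a GRing.unit.
  move=> p0 /homogP hp.
  have pc : p = mpolyC 4 (mpoly.mcoeff mpoly.mnm0 p).
    apply/mpoly.mpolyP => q; rewrite mpoly.mcoeffC; case: eqP => [->|q0]; rewrite ?mulr1 //.
    rewrite mulr0; apply: mpoly.memN_msupp_eq0; apply/negP => /hp /eqP.
    by rewrite mpoly.mdeg_eq0 => /eqP.
  apply/andP; split; first exact/eqP.
  by rewrite unitfE; apply: contraNneq p0 => c0; rewrite pc c0 mpoly.mpolyC0.
case: m hG => [|m] hG; first by left; exact: unit0.
case: n hH => [|n] hH; first by right; exact: unit0.
exfalso.
have := Fe1; rewrite E pevM mulf_eq0 negb_or => /andP[Ge He].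
have [x [x0 x03 Gx Hx]] := common_zero_on_plane (ltn0Sn m) (ltn0Sn n) hG hH Ge He.
(* At a common zero of the factors the whole differential vanishes. By the chain rule k x_i^(k-1)
   dF(row i) = 0, and multiplication by x_i gives the condition y_i dF(row i) = 0 for y_i =
   x_i^k. *)
have dF t : dp x t (power_cover F) = 0 by rewrite E dpM Gx Hx mul0r mulr0 addr0.
have [||i|hD y0] := @crit (powers x).
- by apply: contraNneq x0 => /powers_eq0 ->.
- by rewrite !mxE x03.
- have := dF (delta_mx 0 i); rewrite dp_subst pmap_power dpmap_power.
  have -> : (\row_j (k%:R * x ord0 j ^+ k.-1 * (delta_mx 0 i : 'rV[K]_4) ord0 j)) *m W
      = (k%:R * x ord0 i ^+ k.-1) *: row i W.
    rewrite rowE scalemxAl; congr (_ *m _); apply/rowP => j; rewrite !mxE eqxx /=.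
    by case: eqP => [->|_] //=; rewrite !mulr0.
  rewrite -[_ *: _]addr0 dp_lin dp_t0 addr0 mxE => h.
  set D := dp _ _ _ in h *; apply: (mulfI natk); rewrite mulr0.
  have -> : x ord0 i ^+ k = x ord0 i ^+ k.-1 * x ord0 i by rewrite -exprSr prednK.
  have -> : k%:R * (x ord0 i ^+ k.-1 * x ord0 i * D) = x ord0 i * (k%:R * x ord0 i ^+ k.-1 * D) by ring.
  by rewrite h mulr0.
have x0' i : x ord0 i != 0.
  by apply: contraNneq (y0 i) => xi; rewrite mxE xi expr0n eqn0Ngt k0.
have := D4pt_power_cover x0' hD; rewrite E => hD'.
exact: D4pt_irreducible_germ hD' Gx Hx.
Qed.

End PowerCover.

Lemma base_expansion_inj N n (f g : nat -> nat) : (forall i, (i < n)%N -> (f i < N)%N) ->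
  (forall i, (i < n)%N -> (g i < N)%N) ->
  (\sum_(i < n) f i * N ^ i = \sum_(i < n) g i * N ^ i)%N -> forall i, (i < n)%N -> f i = g i.
Proof.
elim: n f g => [//|n ih] f g hf hg.
have shift (h : nat -> nat) : (\sum_(i < n.+1) h i * N ^ i = h 0 + (\sum_(i < n) h i.+1 * N ^ i) * N)%N.
  rewrite big_ord_recl expn0 muln1; congr (_ + _)%N; rewrite big_distrl /=.
  by apply: eq_bigr => i _; rewrite -mulnA -expnSr.
rewrite !shift => E.
have N0 : (0 < N)%N by apply: leq_ltn_trans (hf 0 _).
have f0 : f 0 = g 0.
  by have := congr1 (modn^~ N) E; rewrite /= !(addnC _ (_ * _)%N) !modnMDl !modn_small ?hf ?hg.
case=> [//|i] hi.
apply: (ih (fun i => f i.+1) (fun i => g i.+1)) => //; [by move=> j hj; exact: hf|by move=> j hj; exact: hg|].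
move: E; rewrite f0 => /addnI /eqP; rewrite eqn_mul2r => /orP[/eqP N00|/eqP //].
by rewrite N00 in N0.
Qed.

(** * Polynomial identities from values, and linear symmetries *)

Section Extensionality.
Variable K : closedFieldType.

(* Kronecker substitution x_i := X^(N^i) separates the monomials. *)
Lemma mpoly_ext n (p q : mpoly.mpoly n K) : (forall v, pev v p = pev v q) -> p = q.
Proof.
move=> h; apply/eqP; rewrite -subr_eq0; apply/eqP; set r := p - q.
have {}h v : pev v r = 0 by rewrite pevD pevN h subrr.
pose N := mpoly.msize r.
pose g (i : 'I_n) : {poly K} := 'X^(N ^ i).
have cg : curve g r = \sum_(m <- mpoly.msupp r) (mpoly.mcoeff m r)%:P * 'X^(\sum_(i < n) m i * N ^ i).
  apply: eq_bigr => m _; congr (_ * _); rewrite /mpoly.mmap1 -prodrXr.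
  by apply: eq_bigr => i _; rewrite /g -exprM mulnC.
have c0 : curve g r = 0.
  apply: closed_poly_eq0 => x; rewrite -(h (\row_i x ^+ (N ^ i))).
  elim/mpoly_ring_ind: (r) => [c|i|p1 p2 h1 h2|p1 p2 h1 h2].
  - by rewrite curveC hornerC pevC.
  - by rewrite curveX hornerXn pevX mxE.
  - by rewrite curveD hornerD h1 h2 pevD.
  - by rewrite curveM hornerM h1 h2 pevM.
apply/mpoly.mpolyP => m; rewrite mpoly.mcoeff0.
have [ms|/mpoly.memN_msupp_eq0 //] := boolP (m \in mpoly.msupp r).
have lt m' i : m' \in mpoly.msupp r -> (m' i < N)%N.
  move=> /mpoly.msize_mdeg_lt; apply: leq_ltn_trans.
  by rewrite mpoly.mdegE (bigD1 i) //= leq_addr.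
have := congr1 (coefp (\sum_(i < n) m i * N ^ i)) c0; rewrite /= coef0 cg coef_sum.
rewrite (bigD1_seq m) //= coefCM coefXn eqxx mulr1 big_seq_cond big1 ?addr0 // => m' /andP[ms' mm].
rewrite coefCM coefXn; case: eqP => [E|]; last by rewrite mulr0.
case/eqP: mm; apply/esym/mpoly.mnmP => i.
pose ext (u : mpoly.multinom n) j := if insub j is Some k then u k else 0%N.
have extE u (j : 'I_n) : ext u j = u j by rewrite /ext valK.
have := @base_expansion_inj N n (ext m) (ext m').
move=> /(_ _ _ _ i (ltn_ord i)); rewrite !extE; apply.
- by move=> j hj; rewrite -[j]/(val (Ordinal hj)) extE; exact: lt.
- by move=> j hj; rewrite -[j]/(val (Ordinal hj)) extE; exact: lt.
- by rewrite (eq_bigr (fun j : 'I_n => m j * N ^ j)%N) ?E; [apply: eq_bigr|] => j _; rewrite extE.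
Qed.

Local Notation MP := (mpoly.mpoly 4 K).

Definition linear_map (M : 'M[K]_4) (i : 'I_4) : MP := \sum_j mpolyC 4 (M j i) * 'Y_j.

Lemma pmap_linear M x : pmap (linear_map M) x = x *m M.
Proof.
apply/rowP => i; rewrite !mxE /linear_map.
transitivity (\sum_j pev x (mpolyC 4 (M j i) * 'Y_j)); first exact: raddf_sum.
by apply: eq_bigr => j _; rewrite pevM pevC pevX mulrC.
Qed.

Lemma dpmap_linear M x t : dpmap (linear_map M) x t = t *m M.
Proof.
apply/rowP => i; rewrite !mxE /linear_map.
elim/big_rec2: _ => [|j y1 y2 _ <-]; rewrite ?dp0 ?dpD //.
by rewrite dpM dpC dpX pevC mul0r addr0 mulrC.
Qed.

(** By extensionality the pullback of [F] along M^-1 is the polynomial c^-1 F, and the D4 condition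
    is transported by [D4pt_subst]. *)
Lemma D4pt_symmetry (F : MP) (M : 'M[K]_4) (c : K) v : M \in unitmx -> c != 0 ->
  (forall x, pev (x *m M) F = c * pev x F) -> D4pt F v -> D4pt F (v *m M).
Proof.
move=> uM c0 hM hv.
have E : subst (linear_map (invmx M)) F = mpolyC 4 c^-1 * F.
  apply: mpoly_ext => x; rewrite pev_subst pmap_linear pevM pevC.
  by rewrite -{2}[x](mulmxKV uM) hM mulKf.
have h1 : D4pt (mpolyC 4 c^-1 * F) (v *m M).
  rewrite -E; apply: D4pt_subst; rewrite pmap_linear mulmxK // => t a.
  rewrite dpmap_linear => h; exists a.
  by rewrite -[t](mulmxKV uM) h scalemxAl.
have := D4pt_scale c0 h1.
by rewrite mulrA -mpoly.mpolyCM mulfV // mpoly.mpolyC1 mul1r.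
Qed.

Lemma homog_scale d (F : MP) (x : 'rV[K]_4) l : homog d F -> pev (l *: x) F = l ^+ d * pev x F.
Proof.
move=> /homogP hF; rewrite /pev !mpoly.mevalE mulr_sumr.
rewrite big_seq [RHS]big_seq; apply: eq_bigr => m /hF <-.
rewrite mulrCA; congr (_ * _); rewrite mpoly.mdegE -prodrXr -big_split /=.
by apply: eq_bigr => i _; rewrite mxE exprMn.
Qed.

Lemma D4pt_dilate d (F : MP) (v : 'rV[K]_4) l : homog d F -> l != 0 -> D4pt F v -> D4pt F (l *: v).
Proof.
move=> hF l0; rewrite -mul_mx_scalar; apply: (@D4pt_symmetry _ _ (l ^+ d)).
- by rewrite unitmxE det_scalar unitfE expf_neq0.
- by rewrite expf_neq0.
- by move=> x; rewrite mul_mx_scalar (homog_scale _ _ hF).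
Qed.

End Extensionality.

Lemma roots_of_unity (K : numClosedFieldType) k : (0 < k)%N ->
  exists z : 'I_k -> K, injective z /\ forall i, z i ^+ k = 1.
Proof.
move=> k0; pose p : {poly K} := 'X^k - 1; have [r Dp] := closed_field_poly_normal p.
rewrite (monicP _) ?monicXnsubC // scale1r in Dp.
have sz : size r = k by apply: succn_inj; rewrite -(size_prod_XsubC r id) -Dp size_XnsubC.
have ur : uniq r by rewrite -separable_prod_XsubC -Dp separable_Xn_sub_1 // pnatr_eq0 -lt0n.
exists (fun i : 'I_k => r`_i); split.
  move=> i j /eqP; rewrite nth_uniq ?sz // => /eqP; exact: val_inj.
move=> i; have : root p r`_i by rewrite Dp root_prod_XsubC mem_nth ?sz.
by rewrite /root /p !hornerE subr_eq0 => /eqP.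
Qed.

(** * Counting the D4 points of the covers *)

Section Counting.
Variable R : realType.
Local Notation C := (Cplx R).
Local Notation MP := (mpoly.mpoly 4 C).

Lemma counting_ge (T : choiceType) (A : set T) (s : seq T) : uniq s ->
  (forall x, x \in s -> A x) -> (((size s)%:R : R)%:E <= counting A)%E.
Proof.
move=> us sA; rewrite /counting; case: asboolP => [fA|_]; last exact: leey.
rewrite lee_fin ler_nat; apply: uniq_leq_size => // x /sA Ax.
by rewrite in_fset_set // inE.
Qed.

(** The points found on the covers have no zero coordinate, so the chart 0 reaches all of them. *)
Lemma D4_points_line d (F : MP) (x : 'rV[C]_4) : homog d F -> x ord0 0 != 0 -> D4pt F x ->
  D4_points F <[x]>%VS.
Proof.
move=> hF x0 hx; split.
  rewrite /proj3 /= dim_vline; case: eqP => // xz.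
  by move: x0; rewrite xz mxE eqxx.
pose a : 'rV[C]_3 := \row_j ((x ord0 0)^-1 * x ord0 (lift 0 j)).
have la : affine_lift 0 a = (x ord0 0)^-1 *: x.
  apply/rowP => j; rewrite !mxE; case: (unliftP 0 j) => [k ->|->].
    by rewrite mxE.
  by rewrite mulVf.
exists 0, a; split.
  have i0 : (x ord0 0)^-1 != 0 by rewrite invr_eq0.
  apply/eqP; rewrite eqEsubv; apply/andP; split; apply/vlineP.
    by exists (x ord0 0); rewrite la scalerA mulfV // scale1r.
  by exists (x ord0 0)^-1; rewrite la.
by apply: D4pt_analytic; rewrite la; apply: D4pt_dilate hF _ hx; rewrite invr_eq0.
Qed.

Theorem mu_D4_power_cover (F : MP) (W : 'M[C]_4) (d N : nat) (v : 'I_N -> 'rV[C]_4) :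
  (0 < d)%N -> homog d F -> W \in unitmx -> toric_critical_D4 W F ->
  (forall j, D4pt F (v j)) -> (forall j i, (v j *m invmx W) ord0 i != 0) ->
  (forall i j a, v i = a *: v j -> i = j) ->
  forall k, (1 <= k)%N -> (((N * k ^ 3)%N%:R)%:E <= mu_D4 R (d * k)%N)%E.
Proof.
move=> d0 hF uW hcrit hD hW hprop k k0.
have hFk := power_cover_homog W k hF.
apply: le_trans (_ : (counting (D4_points (power_cover W k F)) <= _)%E); last first.
  apply: ereal_sup_ubound; exists (power_cover W k F) => //; split => //.
  exact: (power_cover_irreducible uW k0 d0 hF hcrit).
have [z [zinj z1]] := roots_of_unity C k0.
pose y j i : C := (v j *m invmx W) ord0 i.
pose r j i : C := k.-root (y j i).
have rk j i : r j i ^+ k = y j i by rewrite /r rootCK.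
(* The k-th roots may be chosen freely in each coordinate. Fixing the root of unity of coordinate 0
   to 1 removes the common factor and leaves k^3 projective points over each [v j]. *)
pose x (e : 'I_N * ('I_k * 'I_k * 'I_k)) : 'rV[C]_4 :=
  \row_i (nth 0 [:: 1; z e.2.1.1; z e.2.1.2; z e.2.2] i * r e.1 i).
have xk e : powers k (x e) *m W = v e.1.
  rewrite -[RHS](mulmxKV uW); congr (_ *m _); apply/rowP => i.
  rewrite !mxE exprMn rk [X in X * _](_ : _ = 1) ?mul1r //; first by rewrite /y mxE.
  by case: i => [[|[|[|[|i]]]] li] //; rewrite /= ?expr1n ?z1.
have x0 e i : x e ord0 i != 0.
  have : (powers k (x e)) ord0 i != 0.
    by rewrite -[powers k (x e)](mulmxK uW) xk.
  by rewrite mxE expf_eq0 k0.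
have line_inj : injective (fun e => <[x e]>%VS).
  move=> e f /= E; have : x e \in <[x f]>%VS by rewrite -E memv_line.
  move=> /vlineP [a xe].
  have e1 : e.1 = f.1.
    apply: (hprop _ _ (a ^+ k)); rewrite -!xk xe scalemxAl; congr (_ *m _).
    by apply/rowP => i; rewrite !mxE exprMn.
  have xei i : x e ord0 i = a * x f ord0 i by rewrite xe mxE.
  have r0 i : r e.1 i != 0.
    by apply: contraNneq (x0 e i) => ri; rewrite mxE ri mulr0.
  have a1 : a = 1.
    have E0 := xei 0; rewrite [x e _ _]mxE [x f _ _]mxE -e1 [nth _ _ _]/= mul1r in E0.
    by apply: (mulIf (r0 0)); rewrite mul1r -E0.
  have zz (i : 'I_4) : nth 0 [:: 1; z e.2.1.1; z e.2.1.2; z e.2.2] i = nth 0 [:: 1; z f.2.1.1; z f.2.1.2; z f.2.2] i :> C.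
    by have := xei i; rewrite a1 mul1r [x e _ _]mxE [x f _ _]mxE -e1 => /(mulIf (r0 i)).
  case: e f e1 zz {E xe xei r0} => [e1 [[e2 e3] e4]] [f1 [[f2 f3] f4]] /= -> zz.
  have /zinj -> := zz 1; have /zinj -> := zz 2%:R; have /zinj -> := zz 3%:R; by [].
have -> : (N * k ^ 3)%N = size [seq <[x e]>%VS | e <- enum {: 'I_N * ('I_k * 'I_k * 'I_k)}].
  by rewrite size_map -cardE !card_prod !card_ord !expnS expn0 muln1 !mulnA.
apply: counting_ge; first by rewrite map_inj_uniq // enum_uniq.
move=> L /mapP [e _ ->]; apply: (D4_points_line hFk) => //.
by apply: D4pt_power_cover => //; rewrite xk.
Qed.

End Counting.

(** * Points over Z[w, i] *)

(* a + b w + c i + d w i with w a primitive cube root of unity *)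
Definition quad : Type := (Z * Z * Z * Z)%type.

Definition qadd (x y : quad) : quad :=
  let: (a, b, c, d) := x in let: (a', b', c', d') := y in
  ((a + a')%BZ, (b + b')%BZ, (c + c')%BZ, (d + d')%BZ).

Definition qmul (x y : quad) : quad :=
  let: (a, b, c, d) := x in let: (a', b', c', d') := y in
  ((a * a' - b * b' - (c * c' - d * d'))%BZ,
   (a * b' + b * a' - b * b' - (c * d' + d * c' - d * d'))%BZ,
   (a * c' - b * d' + (c * a' - d * b'))%BZ,
   (a * d' + b * c' - b * d' + (c * b' + d * a' - d * b'))%BZ).

Definition qint (a : Z) : quad := (a, 0%BZ, 0%BZ, 0%BZ).
Definition q0 := qint 0%BZ. Definition q1 := qint 1%BZ. Definition qN1 := qint (-1)%BZ.
Definition qw : quad := (0%BZ, 1%BZ, 0%BZ, 0%BZ).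
Definition qw2 : quad := ((-1)%BZ, (-1)%BZ, 0%BZ, 0%BZ).
Definition qi : quad := (0%BZ, 0%BZ, 1%BZ, 0%BZ).

(** For n > 0 the 3-adic valuations of the two sides would have different parities. *)
Lemma sqr_eq3sqr (m n : nat) : (m ^ 2 = 3 * n ^ 2)%N -> n = 0%N.
Proof.
move=> E; apply/eqP; apply: contraT; rewrite -lt0n => n0.
have m0 : (0 < m)%N by move: (congr1 (leq 1) E); rewrite muln_gt0 !expn_gt0 n0 !orbF.

by have := congr1 (fun x => odd (logn 3 x)) E; rewrite lognM ?expn_gt0 ?n0 // !lognX /= oddD !oddM.
Qed.

Lemma Z_sqr_eq3sqr (x y : Z) : (x * x = 3 * (y * y))%BZ -> x = 0%BZ /\ y = 0%BZ.
Proof.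
move=> E; have : y = 0%BZ.
  have : Z.abs_nat y = 0%N by apply: (@sqr_eq3sqr (Z.abs_nat x)); rewrite !expnS !expn0; nia.
  lia.
by move=> y0; split => //; rewrite y0 in E; nia.
Qed.

Section Embedding.
Variable K : numClosedFieldType.

Definition zK (z : Z) : K := (int_of_Z z)%:~R.

Lemma zKD x y : zK (x + y)%BZ = zK x + zK y.
Proof. by rewrite /zK (rmorphD (int_of_Z : {rmorphism Z -> int})) rmorphD. Qed.
Lemma zKM x y : zK (x * y)%BZ = zK x * zK y.
Proof. by rewrite /zK (rmorphM (int_of_Z : {rmorphism Z -> int})) rmorphM. Qed.
Lemma zKN x : zK (- x)%BZ = - zK x.
Proof. by rewrite /zK (rmorphN (int_of_Z : {rmorphism Z -> int})) rmorphN. Qed.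
Lemma zKB x y : zK (x - y)%BZ = zK x - zK y.
Proof. by rewrite -[(x - y)%BZ]/(x + - y)%BZ zKD zKN. Qed.
Lemma zK0 : zK 0%BZ = 0. Proof. by []. Qed.
Lemma zK1 : zK 1%BZ = 1. Proof. by []. Qed.
Lemma zK_eq0 x : zK x = 0 -> x = 0%BZ.
Proof. by move=> /eqP; rewrite /zK intr_eq0 => /eqP h; apply: (can_inj int_of_ZK); rewrite h. Qed.

Definition omega : K := (-1 + 'i * sqrtC 3%:R) / 2%:R.

Lemma omega2 : omega ^+ 2 = - 1 - omega.
Proof.
have n2 : 2%:R != 0 :> K by rewrite pnatr_eq0.
have e : (-1 + 'i * sqrtC 3%:R : K) ^+ 2 = - 2%:R - 2%:R * ('i * sqrtC 3%:R).
  rewrite sqrrD sqrrN expr1n exprMn sqrCi sqrtCK; ring.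
by rewrite /omega expr_div_n e; field.
Qed.

Definition phi (q : quad) : K :=
  let: (a, b, c, d) := q in zK a + zK b * omega + (zK c + zK d * omega) * 'i.

Lemma phiD x y : phi (qadd x y) = phi x + phi y.
Proof.
case: x => [[[a b] c] d]; case: y => [[[a' b'] c'] d'] /=.
rewrite !zKD; ring.
Qed.

Lemma phiM x y : phi (qmul x y) = phi x * phi y.
Proof.
case: x => [[[a b] c] d]; case: y => [[[a' b'] c'] d'] /=.
rewrite !(zKD, zKB, zKM).
move: (zK a) (zK b) (zK c) (zK d) (zK a') (zK b') (zK c') (zK d') => {a b c d a' b' c' d'} a b c d a' b' c' d'.
have i2 : 'i * 'i = -1 :> K by rewrite -expr2 sqrCi.
have w2 : omega * omega = -1 - omega :> K by rewrite -expr2 omega2.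
have -> : (a + b * omega + (c + d * omega) * 'i) * (a' + b' * omega + (c' + d' * omega) * 'i) =
  (a * a' + (a * b' + b * a') * omega + b * b' * (omega * omega)) +
  (c * c' + (c * d' + d * c') * omega + d * d' * (omega * omega)) * ('i * 'i) +
  ((a * c' + (a * d' + b * c') * omega + b * d' * (omega * omega)) +
   (c * a' + (c * b' + d * a') * omega + d * b' * (omega * omega))) * 'i by ring.
rewrite i2 w2; ring.
Qed.

Lemma phi0 : phi q0 = 0. Proof. by rewrite /phi /q0 /qint !zK0 !(mul0r, addr0). Qed.
Lemma phi_int a : phi (qint a) = zK a. Proof. by rewrite /phi /qint !zK0 !(mul0r, addr0). Qed.
Lemma phi1 : phi q1 = 1. Proof. exact: phi_int. Qed.
Lemma phiN1 : phi qN1 = -1. Proof. by rewrite phi_int. Qed.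
Lemma phiw : phi qw = omega. Proof. by rewrite /phi ?/qw ?/qi zK0 zK1 !(mul0r, mul1r, add0r, addr0). Qed.
Lemma phiw2 : phi qw2 = omega ^+ 2.
Proof. by rewrite omega2 /phi /qw2 zK0 !(mul0r, addr0) (zKN 1%BZ) zK1 mulN1r. Qed.
Lemma phii : phi qi = 'i. Proof. by rewrite /phi ?/qw ?/qi zK0 zK1 !(mul0r, mul1r, add0r, addr0). Qed.

Lemma norm_omega_eq0 A B : zK A + zK B * omega = 0 -> (A * A - A * B + B * B)%BZ = 0%BZ.
Proof.
move=> AB; apply: zK_eq0; rewrite !(zKD, zKB, zKM).
have w2 : omega * omega = -1 - omega :> K by rewrite -expr2 omega2.
have -> : zK A * zK A - zK A * zK B + zK B * zK B = (zK A + zK B * omega) * (zK A - zK B - zK B * omega)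
     + zK B * zK B * (omega * omega + 1 + omega) by ring.
by rewrite AB w2 mul0r add0r; ring.
Qed.

(** Multiplying by the conjugate under i |-> -i leaves A + B w = 0, so A = B = 0 by the norm form of
    Z[w]. With e = 2 a - b and f = 2 c - d this reads e b = - f d and e^2 + f^2 = 3 (b^2 + d^2). If
    b^2 + d^2 is not 0, it follows that f^2 = 3 b^2, hence f = b = 0, then e^2 = 3 d^2 and d = 0, a
    contradiction. *)
Lemma phi_eq0 q : phi q = 0 -> q = q0.
Proof.
case: q => [[[a b] c] d] /= E.
have i2 : 'i * 'i = -1 :> K by rewrite -expr2 sqrCi.
have w2 : omega * omega = -1 - omega :> K by rewrite -expr2 omega2.
pose A := (a * a - b * b + c * c - d * d)%BZ; pose B := (2 * a * b - b * b + 2 * c * d - d * d)%BZ.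
have AB : zK A + zK B * omega = 0.
  have -> : zK A + zK B * omega = (zK a + zK b * omega + (zK c + zK d * omega) * 'i) *
       (zK a + zK b * omega - (zK c + zK d * omega) * 'i).
    have z2 : zK 2%BZ = 2%:R by [].
    rewrite /A /B !(zKD, zKB, zKM) z2.
    move: (zK a) (zK b) (zK c) (zK d) => a' b' c' d'.
    have -> : (a' + b' * omega + (c' + d' * omega) * 'i) * (a' + b' * omega - (c' + d' * omega) * 'i)
      = (a' * a' + 2%:R * a' * b' * omega + b' * b' * (omega * omega)) -
        (c' * c' + 2%:R * c' * d' * omega + d' * d' * (omega * omega)) * ('i * 'i) by ring.
    rewrite i2 w2; ring.
  by rewrite E mul0r.
have N0 : (A * A - A * B + B * B)%BZ = 0%BZ by exact: norm_omega_eq0 AB.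
have A0 : A = 0%BZ by nia.
have B0 : B = 0%BZ by nia.
have n : (b * b + d * d)%BZ = (a * a + c * c)%BZ by rewrite /A in A0; lia.
pose e := (2 * a - b)%BZ; pose f := (2 * c - d)%BZ.
have h1 : (e * b = - (f * d))%BZ by rewrite /e /f; rewrite /B in B0; lia.
have h2 : (e * e + f * f = 3 * (b * b + d * d))%BZ by rewrite /e /f; rewrite /B in B0; lia.
have bd : (b * b + d * d)%BZ = 0%BZ.
  apply/eqP; apply: contraT => /eqP nz; exfalso.
  have [_ b0] : (f = 0 /\ b = 0)%BZ.
    apply: Z_sqr_eq3sqr.
    apply: (Z.mul_reg_r _ _ (b * b + d * d)%BZ nz).
    have -> : (f * f * (b * b + d * d) = f * f * (b * b) + (f * d) * (f * d))%BZ by ring.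
    have -> : (f * d = - (e * b))%BZ by lia.
    have -> : (f * f * (b * b) + - (e * b) * - (e * b) = (e * e + f * f) * (b * b))%BZ by ring.
    by rewrite h2; ring.
  have [_ d0] : (e = 0 /\ d = 0)%BZ.
    apply: Z_sqr_eq3sqr.
    have fd : (f * d = 0)%BZ by rewrite b0 in h1; lia.
    have d0 : d <> 0%BZ by move=> d0; apply: nz; rewrite b0 d0.
    have f0 : f = 0%BZ by nia.
    rewrite b0 f0 in h2; lia.
  by apply: nz; rewrite b0 d0.
have [b0 d0] : (b = 0 /\ d = 0)%BZ by nia.
have [a0 c0] : (a = 0 /\ c = 0)%BZ by rewrite b0 d0 in n; nia.
by rewrite a0 b0 c0 d0.
Qed.

Lemma phi_inj : injective phi.
Proof.
move=> x y E; have : phi (qadd x (qmul qN1 y)) = 0 by rewrite phiD phiM phiN1 mulN1r E subrr.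
move/phi_eq0; case: x {E} => [[[a b] c] d]; case: y => [[[a' b'] c'] d'].
have -> : qmul qN1 (a', b', c', d') = ((- a')%BZ, (- b')%BZ, (- c')%BZ, (- d')%BZ).
  by rewrite /qN1 /qint /qmul; congr (_, _, _, _); ring.
by case=> h1 h2 h3 h4; congr (_, _, _, _); lia.
Qed.
End Embedding.
Arguments phi K q : simpl never.
Arguments zK K z : simpl never.

(* The j-th entry of [g] lists the coefficients of the j-th linear form. *)
Definition forms := seq (seq (quad * nat)).

Definition act (g : forms) (x : seq quad) : seq quad :=
  [seq foldr (fun ci => qadd (qmul ci.1 (nth q0 x ci.2))) q0 l | l <- g].

(** Meant for commuting diagonal generators of order [m]: each is applied with all exponents from 0
    to m - 1. *)
Fixpoint sweep m (gs : seq forms) (L : seq (seq quad)) : seq (seq quad) :=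
  if gs is g :: gs' then
    sweep m gs' (flatten [seq traject (act g) x m | x <- L])
  else L.

Definition acts (gs : seq forms) (x : seq quad) : seq quad := foldl (fun y g => act g y) x gs.

(* An entry (k, w) of [tree] applies the maps of w to the point found k + 1 steps earlier. *)
Definition grow (g : nat -> forms) (p : seq quad) (tree : seq (nat * seq nat)) : seq (seq quad) :=
  foldl (fun L e => acts (map g e.2) (nth p L e.1) :: L) [:: p] tree.

(** [tree] lists representatives modulo the diagonal symmetries, and [phases] selects the diagonal
    generators that spread each of them out. *)
Definition orbit_points (g : nat -> forms) p tree m (phases : seq quad -> seq nat) : seq (seq quad) :=
  flatten [seq sweep m [seq g j | j <- phases x] [:: x] | x <- grow g p tree].

(* One coordinate is kept fixed, the point being projective. *)
Definition free_coords (k : nat) (x : seq quad) : seq nat :=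
  [seq (k + i)%N | i <- behead [seq i <- iota 0 4 | nth q0 x i != q0]].

(** Proposes an inverse modulo a prime [m], with exponent m - 2 as in Fermat's theorem; [code]
    verifies that the product is 1. *)
Fixpoint powmod (m x : Z) (n : positive) : Z :=
  match n with
  | xH => x
  | xO n' => powmod m (Z.modulo (x * x)%BZ m) n'
  | xI n' => Z.modulo (x * powmod m (Z.modulo (x * x)%BZ m) n')%BZ m
  end.

(** Reduction of Z[w, i] modulo [m], multiplicative when [w] and [i] are residues with w^2 + w + 1 =
    0 and i^2 + 1 = 0. A prime congruent to 1 modulo 12 has such residues. *)
Definition rho (w i : Z) (q : quad) : Z :=
  let: (a, b, c, d) := q in (a + b * w + (c + d * w) * i)%BZ.

(* -1 flags a point at which one of the linear forms L vanishes modulo m. *)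
Definition code (m w i : Z) (L : forms) (x : seq quad) : Z :=
  if [seq Z.modulo (rho w i q) m | q <- act L x] is [:: r0; r1; r2; r3] then
    let t := powmod m r0 (Z.to_pos (m - 2)%BZ) in
    if (Z.eqb (Z.modulo (t * r0)%BZ m) 1%BZ && ~~ Z.eqb r1 0%BZ && ~~ Z.eqb r2 0%BZ && ~~ Z.eqb r3 0%BZ)%B
    then (Z.modulo (t * r1)%BZ m + m * Z.modulo (t * r2)%BZ m)%BZ
    else (-1)%BZ
  else (-1)%BZ.

(** A strictly increasing path that starts at -1 certifies at once that the flag -1 does not occur
    and that the codes are pairwise distinct. *)
Definition distinct_codes m w i L (N : nat) (pts : seq (seq quad)) : bool :=
  (size pts == N) && path Z.ltb (-1)%BZ (sort Z.leb (map (code m w i L) pts)).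

(** An inverse up to the scalar [s], which avoids denominators; it is tested on the basis
    vectors. *)
Definition comp_scalar (g h : forms) (s : quad) : bool :=
  all (fun i => act h (act g (mkseq (fun j => if j == i then q1 else q0) 4)) ==
     mkseq (fun j => if j == i then s else q0) 4) (iota 0 4).

(** * Residues of projective coordinates *)

Section Residues.
Variables (m w i kw ki : Z).
Hypotheses (Ew : (w * w + w + 1 = m * kw)%BZ) (Ei : (i * i + 1 = m * ki)%BZ).

Lemma rhoM x y : exists k, (rho w i (qmul x y) = rho w i x * rho w i y + k * m)%BZ.
Proof.
case: x => [[[a b] c] d]; case: y => [[[a' b'] c'] d'] /=.
exists (- (kw * (b * b' - d * d' + (b * d' + d * b') * i) + ki * ((c + d * w) * (c' + d' * w))))%BZ.
set u := (b * b' - d * d' + _)%BZ; set v := ((c + d * w) * (c' + d' * w))%BZ.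
have -> : (- (kw * u + ki * v) * m = - ((m * kw) * u + (m * ki) * v))%BZ by ring.
by rewrite -Ew -Ei /u /v; ring.
Qed.

(** The ratios x / x0 and y / y0 are equal, and [s], [t] are the inverses of the denominators modulo
    [m]. *)
Lemma residue_ratio (x y x0 y0 : quad) (s t : Z) :
  qmul x y0 = qmul x0 y ->
  Z.modulo (s * Z.modulo (rho w i x0) m)%BZ m = 1%BZ ->
  Z.modulo (t * Z.modulo (rho w i y0) m)%BZ m = 1%BZ ->
  Z.modulo (s * Z.modulo (rho w i x) m)%BZ m = Z.modulo (t * Z.modulo (rho w i y) m)%BZ m.
Proof.
move=> E; rewrite !Zmult_mod_idemp_r => hs ht.
have [k hk] := rhoM x y0; have [l hl] := rhoM x0 y.
move: hs ht (congr1 (rho w i) E); rewrite hk hl.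
move: (rho w i x) (rho w i y) (rho w i x0) (rho w i y0) => X Y X0 Y0 hs ht {}E.
have E' : Z.modulo (X * Y0)%BZ m = Z.modulo (X0 * Y)%BZ m.
  by rewrite -(Z_mod_plus_full (X * Y0) k) E Z_mod_plus_full.
have -> : Z.modulo (s * X)%BZ m = Z.modulo (s * X * (t * Y0))%BZ m.
  by rewrite -[RHS]Zmult_mod_idemp_r ht Z.mul_1_r.
have -> : (s * X * (t * Y0) = s * t * (X * Y0))%BZ by ring.
rewrite -Zmult_mod_idemp_r E' Zmult_mod_idemp_r.
have -> : (s * t * (X0 * Y) = t * Y * (s * X0))%BZ by ring.
by rewrite -Zmult_mod_idemp_r hs Z.mul_1_r.
Qed.
End Residues.

(** * From computed points to points over K *)

Section Interpretation.
Variable K : numClosedFieldType.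
Local Notation phi := (@phi K).

Definition vec (x : seq quad) : 'rV[K]_4 := \row_j phi (nth q0 x j).

(** Ordinals in constructor form, on which evaluation of expressions reduces by computation. *)
Definition idx (n : nat) : 'I_4 :=
  match n with
  | 0 => @Ordinal 4 0 isT | 1 => @Ordinal 4 1 isT | 2 => @Ordinal 4 2 isT | _ => @Ordinal 4 3 isT
  end.

Lemma idxE (i : 'I_4) : idx i = i.
Proof. by apply: val_inj; case: i => [[|[|[|[|i]]]] hi]. Qed.

Lemma idxK n : (n < 4)%N -> idx n = n :> nat.
Proof. by case: n => [|[|[|[|n]]]]. Qed.

Definition lform (l : seq (quad * nat)) (v : 'I_4 -> K) : K :=
  foldr (fun ci s => phi ci.1 * v (idx ci.2) + s) 0 l.

Definition wf_forms (g : forms) := (size g == 4)%N && all (all (fun ci => ci.2 < 4)%N) g.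

Definition forms_mx (g : forms) : 'M[K]_4 := \matrix_(i, j) lform (nth [::] g j) (fun k => (k == i)%:R).

Lemma lform_sum l (v : 'I_4 -> K) : lform l v = \sum_i v i * lform l (fun k => (k == i)%:R).
Proof.
elim: l => [|[c k] l ih] /=; first by rewrite big1 // => i _; rewrite mulr0.
under eq_bigr do rewrite mulrDr; rewrite big_split /= -ih; congr (_ + _).
rewrite (bigD1 (idx k)) //= eqxx mulr1 big1 ?addr0; first exact: mulrC.
by move=> i; rewrite eq_sym => /negPf ->; rewrite !mulr0.
Qed.

Lemma mul_forms_mx g (v : 'rV[K]_4) j : (v *m forms_mx g) ord0 j = lform (nth [::] g j) (v ord0).
Proof. by rewrite lform_sum !mxE; apply: eq_bigr => i _; rewrite mxE. Qed.

Lemma vec_act g x : wf_forms g -> vec (act g x) = vec x *m forms_mx g.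
Proof.
move=> /andP[/eqP sg /allP hg]; apply/rowP => j; rewrite mul_forms_mx mxE (nth_map [::]) ?sg //.
have : all (fun ci => ci.2 < 4)%N (nth [::] g j) by apply: hg; rewrite mem_nth ?sg.
elim: (nth _ _ _) => [|[c k] l ih] /=; first by move=> _; exact: phi0.
by move=> /andP[k4 /ih]; rewrite phiD phiM mxE idxK // => <-.
Qed.

Lemma comp_scalarP g h s : wf_forms g -> wf_forms h -> comp_scalar g h s ->
  forms_mx g *m forms_mx h = (phi s)%:M.
Proof.
move=> hg hh /allP hs; apply/row_matrixP => i; rewrite row_mul rowE.
have vm a : vec (mkseq (fun j => if j == i :> nat then a else q0) 4) = phi a *: delta_mx 0 i.
  apply/rowP => j; rewrite !mxE nth_mkseq // eqxx /= -(inj_eq val_inj) /=.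
  by case: eqP => _; rewrite ?mulr1 // phi0 mulr0.
have := hs i; rewrite mem_iota /= ltn_ord => /(_ isT) /eqP /(congr1 vec).
rewrite !vec_act // !vm phi1 scale1r => ->.
by rewrite rowE mul_mx_scalar.
Qed.

Section Orbit.
Variables (F : mpoly.mpoly 4 K) (g : nat -> forms) (p : seq quad).
Definition preserves_D4 (h : forms) := forall x, D4pt F (vec x) -> D4pt F (vec (act h x)).
Hypotheses (hp : D4pt F (vec p)) (hg : forall j, preserves_D4 (g j)).

Lemma sweep_D4 m hs L : (forall h, h \in hs -> preserves_D4 h) ->
  (forall x, x \in L -> D4pt F (vec x)) -> forall x, x \in sweep m hs L -> D4pt F (vec x).
Proof.
elim: hs L => [//|h hs ih] L hh hL /=; apply: ih => [h' hh'|x].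
  by apply: hh; rewrite inE hh' orbT.
move=> /flatten_mapP [y /hL hy /trajectP [k _ ->]].
elim: k => [//|k hk]; rewrite iterS; apply: hh => //; exact: mem_head.
Qed.

Lemma grow_D4 tree x : x \in grow g p tree -> D4pt F (vec x).
Proof.
rewrite /grow; have : forall x, x \in [:: p] -> D4pt F (vec x) by move=> y; rewrite inE => /eqP ->.
elim: tree [:: p] => [L hL|e tree ih L hL] /=; first exact: hL.
apply: ih => y; rewrite inE => /orP[/eqP ->|/hL //].
have : D4pt F (vec (nth p L e.1)).
  have [lt|ge] := ltnP e.1 (size L); first by apply: hL; rewrite mem_nth.
  by rewrite nth_default.
by rewrite /acts; elim: e.2 (nth p L e.1) => [//|j w ihw] z hz /=; apply/ihw/hg.
Qed.

Lemma orbit_points_D4 tree m phases x : x \in orbit_points g p tree m phases -> D4pt F (vec x).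
Proof.
move=> /flatten_mapP [y hy]; apply: sweep_D4.
  by move=> h /mapP [j _ ->]; exact: hg.
by move=> z; rewrite inE => /eqP ->; exact: grow_D4 hy.
Qed.
End Orbit.

(** Up to the factor [s], the forms [L] compute the tetrahedral coordinates v h^-1. Nonzero residues
    show that no point lies on a face. Proportional points would have equal ratios of coordinates,
    hence equal codes. *)
Lemma distinct_codesP m w i kw ki L h s N pts :
  (w * w + w + 1 = m * kw)%BZ -> (i * i + 1 = m * ki)%BZ ->
  wf_forms L -> wf_forms h -> comp_scalar h L s -> s <> q0 ->
  distinct_codes m w i L N pts ->
  exists v : 'I_N -> 'rV[K]_4,
    [/\ forall j, exists2 x, x \in pts & v j = vec x,
        forall j k, (v j *m invmx (forms_mx h)) ord0 k != 0
      & forall j k a, v j = a *: v k -> j = k].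
Proof.
move=> Ew Ei wL wh hLs s0 /andP[/eqP sz].
pose c := code m w i L; rewrite -/c => hpath.
have c_ok : all (fun x => Z.ltb (-1)%BZ (c x)) pts.
  have tr : transitive Z.ltb by move=> x y z; lia.
  have := order_path_min tr hpath; rewrite all_sort all_map; exact: sub_all.
have c_uniq : uniq (map c pts).
  have tr : transitive Z.ltb by move=> x y z; lia.
  have ir : irreflexive Z.ltb by move=> x; lia.
  have := path_sorted hpath => /(sorted_uniq tr ir); by rewrite sort_uniq.
have c_val x : x \in pts -> exists r0 r1 r2 r3 t, [/\ act L x = [:: r0; r1; r2; r3],
     Z.modulo (t * Z.modulo (rho w i r0) m)%BZ m = 1%BZ, [/\ Z.modulo (rho w i r1) m <> 0%BZ, Z.modulo (rho w i r2) m <> 0%BZ & Z.modulo (rho w i r3) m <> 0%BZ]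
     & c x = (Z.modulo (t * Z.modulo (rho w i r1) m)%BZ m + m * Z.modulo (t * Z.modulo (rho w i r2) m)%BZ m)%BZ].
  move=> /(allP c_ok); rewrite /c /code.
  case: (act L x) => [|r0 [|r1 [|r2 [|r3 [|r4 l]]]]] //=.
  case: ifP => // /andP[/andP[/andP[h0 h1] h2] h3] _.
  do 5![eexists]; split; [by []| |split|by []]; lia.
have phis : phi s != 0 by apply/eqP => /phi_eq0.
have inv_h : invmx (forms_mx h) = (phi s)^-1 *: forms_mx L.
  have E := comp_scalarP wh wL hLs.
  have [uh _] : (forms_mx h \in unitmx) /\ True.
    split => //; have := congr1 (fun A => ((phi s)^-1) *: A) E.
    by rewrite scale_scalar_mx mulVf // scalemxAr => /mulmx1_unit [].
  apply: (can_inj (mulKmx uh)); rewrite mulmxV // -scalemxAr E scale_scalar_mx mulVf //.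
have vL x : x \in pts -> exists r, [/\ vec x *m forms_mx L = \row_j phi (nth q0 r j), act L x = r & size r = 4%N].
  move=> hx; exists (act L x); split => //; first by rewrite -vec_act.
  by have [r0 [r1 [r2 [r3 [t [-> _ _ _]]]]]] := c_val _ hx.
have rho0 r : phi r = 0 -> Z.modulo (rho w i r) m = 0%BZ.
  by move=> /phi_eq0 ->; rewrite /rho /q0 /qint !Z.mul_0_l !Z.add_0_l Zmod_0_l.
exists (fun j => vec (nth [::] pts j)); split.
- by move=> j; exists (nth [::] pts j); rewrite // mem_nth ?sz.
- move=> j k; have hx : nth [::] pts j \in pts by rewrite mem_nth ?sz.
  rewrite inv_h -scalemxAr mxE mulf_neq0 ?invr_eq0 //.
  have [r0 [r1 [r2 [r3 [t [E h0 [h1 h2 h3] _]]]]]] := c_val _ hx.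
  rewrite -vec_act // mxE E; apply/negP => /eqP.
  case: k => [[|[|[|[|k]]]] lk] //= /rho0 //.
  by move=> e; move: h0; rewrite e Z.mul_0_r; case: (m).
- move=> j k a E; have hx : nth [::] pts j \in pts by rewrite mem_nth ?sz.
  have hy : nth [::] pts k \in pts by rewrite mem_nth ?sz.
  have [r0 [r1 [r2 [r3 [t [Er h0 _ cx]]]]]] := c_val _ hx.
  have [u0 [u1 [u2 [u3 [t' [Eu h0' _ cy]]]]]] := c_val _ hy.
  have E' : vec (act L (nth [::] pts j)) = a *: vec (act L (nth [::] pts k)).
    by rewrite !vec_act // E scalemxAl.
  have Ei' (n : 'I_4) : phi (nth q0 [:: r0; r1; r2; r3] n) = a * phi (nth q0 [:: u0; u1; u2; u3] n).
    by move/rowP/(_ n): E'; rewrite !mxE Er Eu.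
  have e0 := Ei' 0; have e1 := Ei' 1; have e2 := Ei' 2%:R; rewrite /= in e0 e1 e2.
  have cross r u : phi r = a * phi u -> qmul r u0 = qmul r0 u.
    move=> er; apply: (@phi_inj K); rewrite !phiM er e0; ring.
  apply: ord_inj; apply/eqP; rewrite -(nth_uniq 0%BZ _ _ c_uniq) ?size_map ?sz //.
  rewrite !(nth_map [::]) ?sz // cx cy.
  by rewrite (residue_ratio Ew Ei (cross _ _ e1) h0 h0') (residue_ratio Ew Ei (cross _ _ e2) h0 h0').
Qed.
End Interpretation.

Notation "p %+ q" := (PA p q) (at level 50, left associativity).
Notation "p %* q" := (PM p q) (at level 40, left associativity).
Notation "p %^ k" := (PE p k) (at level 29).
Notation "c %:K" := (@PC _ 4 c) (at level 2, format "c %:K").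

Definition scale_forms (c : nat -> quad) : forms := mkseq (fun j => [:: (c j, j)]) 4.
Definition perm_forms (s : seq nat) : forms := [seq [:: (q1, j)] | j <- s].

(** Base 1000 notation, which keeps every numeral small as a unary natural number. *)
Notation "a ,, b" := (a * 1000%:R + b%N%:R) (at level 40, left associativity, only parsing).

(* The rows of this matrix are e1 - n, e2, e3, n with n = (n1, n2, n3, 1). *)
Definition tilt (n1 n2 n3 : Z) : forms :=
  [:: [:: (qint (1 - n1)%BZ, 0); (qint n1, 3)];
      [:: (qint (- n2)%BZ, 0); (q1, 1); (qint n2, 3)];
      [:: (qint (- n3)%BZ, 0); (q1, 2); (qint n3, 3)];
      [:: (qN1, 0); (q1, 3)]].

Definition tilt_inv (n1 n2 n3 : Z) : forms :=
  [:: [:: (q1, 0); (qint (- n1)%BZ, 3)]; [:: (q1, 1); (qint (- n2)%BZ, 3)];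
      [:: (q1, 2); (qint (- n3)%BZ, 3)]; [:: (q1, 0); (qint (1 - n1)%BZ, 3)]].

(** * Criteria for polynomials given by expressions *)

Section Expressions.
Variable K : numClosedFieldType.
Local Notation pexp := (pexp K 4).

Fixpoint pdeg (e : pexp) : option nat :=
  match e with
  | PC _ => Some 0
  | PX _ => Some 1
  | PA e1 e2 => if pdeg e1 == pdeg e2 then pdeg e1 else None
  | PM e1 e2 => if (pdeg e1, pdeg e2) is (Some m, Some n) then Some (m + n)%N else None
  | PE e1 k => omap (muln^~ k) (pdeg e1)
  end.

Lemma pden_homog e d : pdeg e = Some d -> homog d (pden e).
Proof.
elim: e d => [c|i|e1 h1 e2 h2|e1 h1 e2 h2|e1 h1 k] d /=.
- by case=> <-; rewrite -[mpoly.mpolyC _ _]mulr1 mpoly.mul_mpolyC; apply: mpoly.dhomogZ; exact: mpoly.dhomog1.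
- by case=> <-; rewrite mpoly.dhomogX /= mpoly.mdeg1.
- case: eqP => // E E1; apply: rpredD; [exact: h1|by apply: h2; rewrite -E].
- case: (pdeg e1) h1 => // m h1; case: (pdeg e2) h2 => // n h2 [<-].
  by apply: mpoly.dhomogM; [exact: h1|exact: h2].
- case: (pdeg e1) h1 => // m h1 [<-]; apply: mpoly.dhomogMn; exact: h1.
Qed.

Lemma D4pt_pexp (e u1 u2 z U q0 q1 q2 c0 c1 c2 c3 : pexp) (v : 'rV[K]_4) :
  (forall x, peval x e = peval x U * peval x z ^+ 2 +
     peval x z * (peval x q0 * peval x u1 ^+ 2 + peval x q1 * peval x u1 * peval x u2 + peval x q2 * peval x u2 ^+ 2) +
     (peval x c0 * peval x u1 ^+ 3 + peval x c1 * peval x u1 ^+ 2 * peval x u2 +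
      peval x c2 * peval x u1 * peval x u2 ^+ 2 + peval x c3 * peval x u2 ^+ 3)) ->
  let w := v ord0 in
  [/\ peval w u1 = 0, peval w u2 = 0 & peval w z = 0] ->
  [/\ peval w U != 0, peval w c0 != 0 & peval w c3 != 0] ->
  peval w c1 = 0 -> peval w c2 = 0 ->
  (forall t, pdiff w t u1 = 0 -> pdiff w t u2 = 0 -> pdiff w t z = 0 -> exists a, forall i, t i = a * w i) ->
  D4pt (pden e) v.
Proof.
move=> E w [h1 h2 hz] [hU h0 h3] hc1 hc2 ht.
exists (pden u1), (pden u2), (pden z), (pden U), (pden q0), (pden q1), (pden q2),
  (pden c0), (pden c1), (pden c2), (pden c3).
split; rewrite ?pev_pden //; last first.
  move=> t; rewrite !dp_pden => /ht h{}/h h{}/h [a ha]; exists a.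
  by apply/rowP => i; rewrite mxE ha.
apply: mpoly_ext => x.
by rewrite -!(pevM, pevD, pevXn) || rewrite !(pevM, pevD, pevXn) !pev_pden E.
Qed.

(* K0 s^3 + K2 s w^2 is a sum of cubes of s + w / (2 mu) and s - w / (2 mu) when 4 K2 mu^2 = 3 K0. *)
Lemma D4pt_cubic (e s w z U k0 k1 k2 k3 : pexp) (v : 'rV[K]_4) :
  (forall x, peval x e = peval x U * peval x z ^+ 2 +
     (peval x k0 * peval x s ^+ 3 + peval x k1 * peval x s ^+ 2 * peval x w +
      peval x k2 * peval x s * peval x w ^+ 2 + peval x k3 * peval x w ^+ 3)) ->
  let v0 := v ord0 in
  [/\ peval v0 s = 0, peval v0 w = 0 & peval v0 z = 0] ->
  [/\ peval v0 U != 0, peval v0 k0 != 0 & peval v0 k2 != 0] ->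
  peval v0 k1 = 0 -> peval v0 k3 = 0 ->
  (forall t, pdiff v0 t s = 0 -> pdiff v0 t w = 0 -> pdiff v0 t z = 0 -> exists a, forall i, t i = a * v0 i) ->
  D4pt (pden e) v.
Proof.
move=> E v0 [hs hw hz] [hU h0 h2] h1 h3 ht.
pose mu := sqrtC (3%:R * peval v0 k0 / (4%:R * peval v0 k2)).
have n2 n : n.+1%:R != 0 :> K by rewrite pnatr_eq0.
have mu2 : mu ^+ 2 = 3%:R * peval v0 k0 / (4%:R * peval v0 k2) by exact: sqrtCK.
have mu0 : mu != 0.
  have : mu ^+ 2 != 0 by rewrite mu2 !mulf_neq0 // invr_eq0 mulf_neq0.
  by rewrite expf_eq0.
have mi0 : (2%:R * mu)^-1 != 0 by rewrite invr_eq0 mulf_neq0.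
(* The coefficients of the cubic after s = (u1 + u2) / 2 and w = mu (u1 - u2). The value of [mu]
   annihilates the two mixed ones at [v]. *)
pose lo a b c d : pexp := (a / 8%:R)%:K %* k0 %+ (b / 4%:R * mu)%:K %* k1 %+ (c / 2%:R * mu ^+ 2)%:K %* k2 %+ (d * mu ^+ 3)%:K %* k3.
pose zero : pexp := 0%:K.
apply: (@D4pt_pexp e (s %+ ((2%:R * mu)^-1)%:K %* w) (s %+ (- (2%:R * mu)^-1)%:K %* w) z U zero zero zero
  (lo 1 1 1 1) (lo 3%:R 1 (-1) (- 3%:R)) (lo 3%:R (-1) (-1) 3%:R) (lo 1 (-1) 1 (-1))) => /=.
- move=> x; rewrite E; field; by rewrite mu0.
- by rewrite hs hw hz !mulr0 addr0.
- rewrite -/v0 h1 h3 mu2; split=> //.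
    have -> : 1 / 8%:R * peval v0 k0 + 1 / 4%:R * mu * 0 + 1 / 2%:R * (3%:R * peval v0 k0 / (4%:R * peval v0 k2)) * peval v0 k2 + 1 * mu ^+ 3 * 0 = peval v0 k0 / 2%:R by field; rewrite h2.
    by rewrite mulf_neq0 // invr_eq0.
  have -> : 1 / 8%:R * peval v0 k0 + -1 / 4%:R * mu * 0 + 1 / 2%:R * (3%:R * peval v0 k0 / (4%:R * peval v0 k2)) * peval v0 k2 + -1 * mu ^+ 3 * 0 = peval v0 k0 / 2%:R by field; rewrite h2.
  by rewrite mulf_neq0 // invr_eq0.
- rewrite -/v0 h1 h3 mu2; field; by rewrite h2.
- rewrite -/v0 h1 h3 mu2; field; by rewrite h2.
move=> t; rewrite -/v0 !mul0r !addr0 => e1 e2.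
have hs' : pdiff v0 t s = 0.
  apply: (mulfI (n2 1%N)); rewrite mulr0.
  have -> : 2%:R * pdiff v0 t s = (pdiff v0 t s + (2%:R * mu)^-1 * pdiff v0 t w) + (pdiff v0 t s + - (2%:R * mu)^-1 * pdiff v0 t w) by ring.
  by rewrite e1 e2 addr0.
apply: ht => //; move: e1; rewrite hs' add0r => /eqP; rewrite mulf_eq0 (negPf mi0) => /eqP //.
Qed.

Lemma forms_unit g h s : wf_forms g -> wf_forms h -> comp_scalar g h s -> s <> q0 ->
  forms_mx K g \in unitmx.
Proof.
move=> wg wh /(comp_scalarP K wg wh) E s0.
have s0' : phi K s != 0 by apply/eqP => /phi_eq0.
have : forms_mx K g *m ((phi K s)^-1 *: forms_mx K h) = 1%:M.
  by rewrite -scalemxAr E scale_scalar_mx mulVf.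
by move=> /mulmx1_unit [].
Qed.

Lemma forms_symmetry (e : pexp) g h s c v : wf_forms g -> wf_forms h -> comp_scalar g h s -> s <> q0 ->
  c != 0 ->
  (forall x : 'I_4 -> K, peval (fun j => lform (nth [::] g j) x) e = c * peval x e) ->
  D4pt (pden e) v -> D4pt (pden e) (v *m forms_mx K g).
Proof.
move=> wg wh gh s0 c0 E; apply: (D4pt_symmetry (forms_unit wg wh gh s0) c0) => x.
rewrite !pev_pden -E; congr (peval _ e); apply: boolp.funext => j; exact: mul_forms_mx.
Qed.

Lemma forms_critical (e : pexp) g h s c v : wf_forms g -> wf_forms h -> comp_scalar g h s -> s <> q0 ->
  (forall x : 'I_4 -> K, peval (fun j => lform (nth [::] g j) x) e = c * peval x e) ->
  (forall t, dp v t (pden e) = 0) -> forall t, dp (v *m forms_mx K g) t (pden e) = 0.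
Proof.
move=> wg wh gh s0 E hv t; have uM := forms_unit wg wh gh s0.
have EF : subst (linear_map (forms_mx K g)) (pden e) = mpoly.mpolyC 4 c * pden e.
  apply: mpoly_ext => x; rewrite pev_subst pmap_linear pevM pevC !pev_pden -E.
  by congr (peval _ e); apply: boolp.funext => j; exact: mul_forms_mx.
have := dp_subst (linear_map (forms_mx K g)) v (t *m invmx (forms_mx K g)) (pden e).
by rewrite pmap_linear dpmap_linear mulmxKV // EF dpM dpC hv mulr0 mul0r addr0.
Qed.

Lemma forms_symmetry_inv (e : pexp) g h s c v : wf_forms g -> wf_forms h -> comp_scalar g h s -> s <> q0 ->
  c != 0 ->
  (forall x : 'I_4 -> K, peval (fun j => lform (nth [::] g j) x) e = c * peval x e) ->
  D4pt (pden e) (v *m forms_mx K g) -> D4pt (pden e) v.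
Proof.
move=> wg wh gh s0 c0 E hv; have uM := forms_unit wg wh gh s0.
rewrite -[v](mulmxK uM); apply: (@D4pt_symmetry _ _ _ c^-1); rewrite ?unitmx_inv ?invr_eq0 // => x.
rewrite -{2}[x](mulmxKV uM) !pev_pden; set y := x *m _.
have -> : (y *m forms_mx K g) ord0 = fun j => lform (nth [::] g j) (y ord0).
  by apply: boolp.funext => j; exact: mul_forms_mx.
by rewrite E mulKf.
Qed.

(** The symmetric functions of the two nontrivial conjugates of a Lagrange resolvent, for [w], [w']
    the primitive cube roots of unity. *)
Lemma resolvent_sum_prod (w w' t u v : K) : w + w' = -1 -> w * w' = 1 ->
  [/\ (t + w' * u + w * v) + (t + w * u + w' * v) = 2%:R * t - (u + v),
      (t + w' * u + w * v) * (t + w * u + w' * v) = t ^+ 2 - t * (u + v) + u ^+ 2 + v ^+ 2 - u * v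
    & (t + w' * u + w * v) - (t + w * u + w' * v) = (w - w') * (v - u)].
Proof.
move=> h1 h2; split; last by ring.
  have -> : (t + w' * u + w * v) + (t + w * u + w' * v) = 2%:R * t + (w + w') * (u + v) by ring.
  by rewrite h1; ring.
have -> : (t + w' * u + w * v) * (t + w * u + w' * v) = t ^+ 2 + t * ((w + w') * (u + v)) +
  (w * w') * (u ^+ 2 + v ^+ 2) + ((w + w') ^+ 2 - 2%:R * (w * w')) * (u * v) by ring.
by rewrite h1 h2; ring.
Qed.

Lemma omega_conj : omega K + omega K ^+ 2 = -1 /\ omega K * omega K ^+ 2 = 1.
Proof.
have w2 : omega K ^+ 2 = - 1 - omega K by exact: omega2.
have ww : omega K * omega K = - 1 - omega K by rewrite -expr2 w2.
split; first by rewrite w2; ring.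
rewrite w2 mulrBr ww; ring.
Qed.

Lemma preserves_forms_symmetry (e : pexp) g : wf_forms g ->
  (forall v, D4pt (pden e) v -> D4pt (pden e) (v *m forms_mx K g)) -> preserves_D4 (pden e) g.
Proof. by move=> wg h x /h; rewrite vec_act. Qed.

Definition tuple4 (a b c d : K) (i : 'I_4) : K := nth 0 [:: a; b; c; d] i.

Lemma lform_row h (i j : 'I_4) : lform (nth [::] h j) (fun k => (k == i)%:R) = (row i (forms_mx K h)) ord0 j.
Proof. by rewrite !mxE. Qed.

Lemma ord4 (P : 'I_4 -> Prop) : P (idx 0) -> P (idx 1) -> P (idx 2) -> P (idx 3) -> forall i, P i.
Proof. by move=> h0 h1 h2 h3 i; rewrite -(idxE i); case: i => [[|[|[|[|i]]]] hi]. Qed.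

(** On y_0 = y_3 the conditions for i = 0 and i = 3 carry the same factor, and their sum is a
    derivative along the plane. The three resulting conditions only see the restriction of the form
    to the plane. *)
Lemma toric_critical_plane (e : pexp) (h : forms) :
  (forall y0 y1 y2 : K, [|| y0 != 0, y1 != 0 | y2 != 0] ->
    let x j := lform (nth [::] h j) (tuple4 y0 y1 y2 y0) in
    y0 * pdiff x (fun j => lform (nth [::] h j) (tuple4 1 0 0 1)) e = 0 ->
    y1 * pdiff x (fun j => lform (nth [::] h j) (tuple4 0 1 0 0)) e = 0 ->
    y2 * pdiff x (fun j => lform (nth [::] h j) (tuple4 0 0 1 0)) e = 0 ->
    D4pt (pden e) (\row_j x j) /\ [/\ y0 != 0, y1 != 0 & y2 != 0]) ->
  toric_critical_D4 (forms_mx K h) (pden e).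
Proof.
move=> H y y_n0 y03 hy.
set y0 := y ord0 (idx 0); set y1 := y ord0 (idx 1); set y2 := y ord0 (idx 2).
have y3 : y ord0 (idx 3) = y0.
  by rewrite -(idxE 0) -(idxE 3%:R) /= in y03; rewrite -y03.
have yE : y = \row_j tuple4 y0 y1 y2 y0 j.
  by apply/rowP; apply: ord4; rewrite mxE /tuple4 /= ?y3.
have xE : y *m forms_mx K h = \row_j lform (nth [::] h j) (tuple4 y0 y1 y2 y0).
  apply/rowP => j; rewrite mul_forms_mx mxE; congr (lform _ _).
  by apply: boolp.funext => i; rewrite {1}yE mxE.
have hp i : y ord0 i * pdiff (fun j => lform (nth [::] h j) (tuple4 y0 y1 y2 y0))
    (fun j => lform (nth [::] h j) (fun k => (k == i)%:R)) e = 0.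
  have := hy i; rewrite dp_pden xE => E; rewrite -[RHS]E; congr (_ * pdiff _ _ _).
    by apply: boolp.funext => j; rewrite mxE.
  by apply: boolp.funext => j; rewrite lform_row.
have tE i : (fun j : 'I_4 => lform (nth [::] h j) (fun k => (k == i)%:R)) = row i (forms_mx K h) ord0.
  by apply: boolp.funext => j; rewrite lform_row.
have sum2 : (fun j : 'I_4 => lform (nth [::] h j) (tuple4 1 0 0 1)) =
    ((1 : K) *: row (idx 0) (forms_mx K h) + row (idx 3) (forms_mx K h)) ord0.
  apply: boolp.funext => j; rewrite scale1r mxE -!lform_row; elim: (nth [::] h j) => [|[c k] l ih] /=.
    by rewrite addr0.
  rewrite ih; have -> : tuple4 1 0 0 1 (idx k) = (idx k == idx 0)%:R + (idx k == idx 3)%:R.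
    by case: k => [|[|[|k]]]; rewrite /tuple4 /= ?addr0 ?add0r.
  ring.
have one1 : (fun j : 'I_4 => lform (nth [::] h j) (tuple4 0 1 0 0)) = row (idx 1) (forms_mx K h) ord0.
  rewrite -tE; apply: boolp.funext => j; congr (lform _ _); apply: boolp.funext; exact: ord4.
have one2 : (fun j : 'I_4 => lform (nth [::] h j) (tuple4 0 0 1 0)) = row (idx 2) (forms_mx K h) ord0.
  rewrite -tE; apply: boolp.funext => j; congr (lform _ _); apply: boolp.funext; exact: ord4.
set x := (fun j => lform _ _) in hp.
pose xv : 'rV[K]_4 := \row_j x j.
have xvE : xv ord0 = x by apply: boolp.funext => j; rewrite mxE.
have {}hp i : y ord0 i * dp xv (row i (forms_mx K h)) (pden e) = 0.
  by rewrite dp_pden xvE -tE hp.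
have [||||hD [z0 z1 z2]] := H y0 y1 y2.
- apply: contraNT y_n0; rewrite !negb_or !negbK => /and3P[/eqP h0 /eqP h1 /eqP h2].
  by rewrite yE h0 h1 h2; apply/eqP/rowP; apply: ord4; rewrite !mxE.
- rewrite sum2 -/x -xvE -dp_pden dp_lin mul1r mulrDr hp add0r -y3 hp //.
- by rewrite one1 -/x -xvE -dp_pden hp.
- by rewrite one2 -/x -xvE -dp_pden hp.
by split; [rewrite xE | apply: ord4; rewrite ?y3].
Qed.

Local Arguments Z.sub : simpl never.
Local Arguments Z.opp : simpl never.
(** The rows e1 - n and n add up to e1, so n disappears from the condition. *)
Lemma toric_critical_tilt (e : pexp) n1 n2 n3 :
  (forall y0 y1 y2 : K, [|| y0 != 0, y1 != 0 | y2 != 0] ->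
    let x := tuple4 y0 y1 y2 0 in
    y0 * pdiff x (tuple4 1 0 0 0) e = 0 ->
    y1 * pdiff x (tuple4 0 1 0 0) e = 0 ->
    y2 * pdiff x (tuple4 0 0 1 0) e = 0 ->
    D4pt (pden e) (\row_j x j) /\ [/\ y0 != 0, y1 != 0 & y2 != 0]) ->
  toric_critical_D4 (forms_mx K (tilt n1 n2 n3)) (pden e).
Proof.
move=> H; have tiltE a b c : (fun j : 'I_4 => lform (nth [::] (tilt n1 n2 n3) j) (tuple4 a b c a)) = tuple4 a b c 0.
  apply: boolp.funext; apply: ord4; rewrite /tuple4 /= ?(phi_int, phi1, phiN1, zKB, zKN, zK1); ring.
by apply: toric_critical_plane => y0 y1 y2 n0 x; rewrite /x !tiltE; exact: H.
Qed.
End Expressions.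

(** * The octic *)

Section Octic.
Variable K : numClosedFieldType.
Local Notation sq n := (PX K (idx n) %^ 2).

(** The e_i are the elementary symmetric functions of the squares, so signed permutations of the
    coordinates preserve the form. *)
Definition octic : pexp K 4 :=
  let e1 := sq 0 %+ sq 1 %+ sq 2 %+ sq 3 in
  let e2 := sq 0 %* sq 1 %+ sq 0 %* sq 2 %+ sq 0 %* sq 3 %+ sq 1 %* sq 2 %+ sq 1 %* sq 3 %+ sq 2 %* sq 3 in
  let e3 := sq 0 %* sq 1 %* sq 2 %+ sq 0 %* sq 1 %* sq 3 %+ sq 0 %* sq 2 %* sq 3 %+ sq 1 %* sq 2 %* sq 3 in
  let e4 := sq 0 %* sq 1 %* sq 2 %* sq 3 in
  (e2 %+ e1 %^ 2) %^ 2 %+ 8%:R%:K %* (e1 %* (e3 %+ (-1)%:K %* (e1 %* e2)) %+ (-1)%:K %* e4).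

(** The section w = 0 has the local equation U z^2 + k0 s^3, a cusp. Since [k1] and [k3] are
    multiples of [w], the remaining cubic term is k2 s w^2, which completes the cusp to a D4
    point. *)
Lemma octic_cusp (v : 'rV[K]_4) : let x i := v ord0 (idx i) in
  x 3 = 0 -> x 0 ^+ 2 = - x 2 ^+ 2 -> x 1 ^+ 2 = - x 2 ^+ 2 -> x 2 != 0 -> D4pt (pden octic) v.
Proof.
move=> x x3 x0 x1 x2.
pose s := sq 0 %+ sq 1 %+ 2%:R%:K %* sq 2.
pose z := sq 1 %+ (-1)%:K %* sq 0.
pose c := sq 0 %+ sq 1.
pose w := PX K (idx 3).
pose U := c %^ 2 %+ (1 / 2%:R)%:K %* s %* c %+ (1 / 16%:R)%:K %* (z %^ 2 %+ (- 2%:R)%:K %* s %^ 2)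
  %+ (1 / 4%:R)%:K %* (s %+ c) %* w %^ 2 %+ (-1 / 2%:R)%:K %* w %^ 4.
pose k0 := (-1 / 2%:R)%:K %* c %+ (1 / 16%:R)%:K %* s.
pose k1 := (-1 / 4%:R)%:K %* (s %+ c) %* w.
pose k2 := (-1)%:K %* (s %+ c) %* c.
pose k3 := w %* ((1 / 2%:R)%:K %* s %^ 2 %+ 2%:R%:K %* c %* s %+ (- 7%:R / 4%:R)%:K %* (s %+ c) %^ 2)
  %+ (-1)%:K %* (s %+ c) %* w %^ 3 %+ w %^ 5.
have n2 n : n.+1%:R != 0 :> K by rewrite pnatr_eq0.
apply: (@D4pt_cubic _ octic s w z U k0 k1 k2 k3).
- by move=> y /=; field.
- by rewrite /= -/(x 0) -/(x 1) -/(x 2) -/(x 3) x0 x1 x3; split => //; ring.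
- rewrite /= -/(x 0) -/(x 1) -/(x 2) -/(x 3) x0 x1 x3; split.
  + have -> : forall y : K, (- y + - y) ^+ 2 + 1 / 2%:R * (- y + - y + 2%:R * y) * (- y + - y) +
      1 / 16%:R * ((- y + -1 * - y) ^+ 2 + - 2%:R * (- y + - y + 2%:R * y) ^+ 2) +
      1 / 4%:R * (- y + - y + 2%:R * y + (- y + - y)) * 0 ^+ 2 + -1 / 2%:R * 0 ^+ 4 = 4%:R * y ^+ 2 by move=> y; field.
    by rewrite mulf_neq0 ?expf_neq0.
  + have -> : forall y : K, -1 / 2%:R * (- y + - y) + 1 / 16%:R * (- y + - y + 2%:R * y) = y by move=> y; field.
    by rewrite expf_neq0.
  + have -> : forall y : K, -1 * (- y + - y + 2%:R * y + (- y + - y)) * (- y + - y) = - (4%:R * y ^+ 2) by move=> y; ring.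
    by rewrite oppr_eq0 mulf_neq0 ?expf_neq0.
- by rewrite /= -/(x 3) x3 mulr0.
- by rewrite /= -/(x 3) x3; ring.
move=> t /=; rewrite -/(x 0) -/(x 1) -/(x 2) => h1 h2 h3.
have x0n : x 0 != 0 by apply: contraNneq x2 => h; move: x0; rewrite h expr0n /= => /eqP; rewrite eq_sym oppr_eq0 expf_eq0.
have x1n : x 1 != 0 by apply: contraNneq x2 => h; move: x1; rewrite h expr0n /= => /eqP; rewrite eq_sym oppr_eq0 expf_eq0.
exists (t (idx 2) / x 2); apply: ord4; rewrite -/(x 0) -/(x 1) -/(x 2) -/(x 3).
- apply: (mulfI x0n); apply: (mulfI (n2 3%N)).
  have -> : 4%:R * (x 0 * t (idx 0)) = (2%:R * x 0 ^+ 1 * t (idx 0) + 2%:R * x 1 ^+ 1 * t (idx 1) +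
       (2%:R * (2%:R * x 2 ^+ 1 * t (idx 2)) + 0 * x 2 ^+ 2)) -
     (2%:R * x 1 ^+ 1 * t (idx 1) + (-1 * (2%:R * x 0 ^+ 1 * t (idx 0)) + 0 * x 0 ^+ 2)) - 4%:R * x 2 * t (idx 2) by ring.
  rewrite h1 h3 [RHS](_ : _ = 4%:R * (t (idx 2) / x 2) * x 0 ^+ 2); last by ring.
  by rewrite x0; field.
- apply: (mulfI x1n); apply: (mulfI (n2 3%N)).
  have -> : 4%:R * (x 1 * t (idx 1)) = (2%:R * x 0 ^+ 1 * t (idx 0) + 2%:R * x 1 ^+ 1 * t (idx 1) +
       (2%:R * (2%:R * x 2 ^+ 1 * t (idx 2)) + 0 * x 2 ^+ 2)) +
     (2%:R * x 1 ^+ 1 * t (idx 1) + (-1 * (2%:R * x 0 ^+ 1 * t (idx 0)) + 0 * x 0 ^+ 2)) - 4%:R * x 2 * t (idx 2) by ring.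
  rewrite h1 h3 [RHS](_ : _ = 4%:R * (t (idx 2) / x 2) * x 1 ^+ 2); last by ring.
  by rewrite x1; field.
- by field.
- by rewrite h2 x3 mulr0.
Qed.

(** The two cubic factors are exchanged by swapping x and y, so their difference and sum are
    divisible by x - y and x + y. *)
Lemma octic_boundary (x y : K) : x * (4%:R * x ^+ 3 - 6%:R * x ^+ 2 * y - 10%:R * x * y ^+ 2 - 2%:R * y ^+ 3) = 0 ->
  y * (4%:R * y ^+ 3 - 6%:R * y ^+ 2 * x - 10%:R * y * x ^+ 2 - 2%:R * x ^+ 3) = 0 -> x = 0 /\ y = 0.
Proof.
have n2 n : n.+1%:R != 0 :> K by rewrite pnatr_eq0.
have zero4 n (a : K) : n.+1%:R * a ^+ 4 = 0 -> a = 0.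
  by move=> /eqP; rewrite mulf_eq0 (negPf (n2 n)) expf_eq0 => /eqP.
have [-> _ h|x0] := eqVneq x 0.
  by split => //; apply: (zero4 3); rewrite -h; ring.
have [-> h _|y0] := eqVneq y 0.
  by split => //; apply: (zero4 3); rewrite -h; ring.
move=> /eqP; rewrite mulf_eq0 (negPf x0) => /eqP hA /eqP; rewrite mulf_eq0 (negPf y0) => /eqP hB.
have : (x - y) * (6%:R * x ^+ 2 + 10%:R * x * y + 6%:R * y ^+ 2) = 0.
  by rewrite -[RHS](subr0 0) -{1}hA -hB; ring.
have : (x + y) * (2%:R * x ^+ 2 - 18%:R * x * y + 2%:R * y ^+ 2) = 0.
  by rewrite -[RHS](addr0 0) -{1}hA -hB; ring.
move=> /eqP; rewrite mulf_eq0 => /orP[/eqP s0|/eqP q] /eqP; rewrite mulf_eq0 => /orP[/eqP d0|/eqP r].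
- have x00 : x = 0 by apply: (mulfI (n2 1%N)); rewrite mulr0 -[RHS](addr0 0) -{1}s0 -d0; ring.
  by rewrite x00 eqxx in x0.
- have e : y = - x by apply/eqP; rewrite -addr_eq0 addrC s0.
  have : 2%:R * x ^+ 2 = 0 by rewrite -r e; ring.
  by move=> /eqP; rewrite mulf_eq0 (negPf (n2 1%N)) expf_eq0 /= (negPf x0).
- have e : y = x by apply/esym/eqP; rewrite -subr_eq0 d0.
  have : 14%:R * x ^+ 2 = 0 by rewrite -[RHS]oppr0 -q e; ring.
  by move=> /eqP; rewrite mulf_eq0 (negPf (n2 13%N)) expf_eq0 /= (negPf x0).
- have : 64%:R * (x * y) = 0.
    have -> : 64%:R * (x * y) = (6%:R * x ^+ 2 + 10%:R * x * y + 6%:R * y ^+ 2) - 3%:R * (2%:R * x ^+ 2 - 18%:R * x * y + 2%:R * y ^+ 2) by ring.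
    by rewrite q r mulr0 subr0.
  by move=> /eqP; rewrite !mulf_eq0 (negPf (n2 63%N)) (negPf x0) (negPf y0).
Qed.

(* On x_4 = 0 the octic is the tricuspidal quartic a^2b^2 + b^2c^2 + c^2a^2 - 2abc(a + b + c)
   in a = y + z, b = z + x, c = x + y, where x, y, z are the squares of the coordinates. *)
Definition quartic_dx (x y z : K) : K :=
  let a := y + z in let b := z + x in let c := x + y in
  2%:R * (b * (c - a) ^+ 2 - c * a * (c + a)) + 2%:R * (c * (a - b) ^+ 2 - a * b * (a + b)).

(** Where abc is not 0, the inverses of a, b, c turn the quartic into the smooth conic A^2 + B^2 +
    C^2 - 2(AB + BC + CA). Its critical equations, such as A = B + C, are the relations of [dual]
    and have no common solution. On abc = 0 only the three cusps remain. *)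
Lemma quartic_critical (x y z : K) : [|| x != 0, y != 0 | z != 0] ->
  x * quartic_dx x y z = 0 -> y * quartic_dx y z x = 0 -> z * quartic_dx z x y = 0 ->
  [/\ x != 0, y != 0 & z != 0] /\
  [\/ y + z = 0 /\ z + x = 0, z + x = 0 /\ x + y = 0 | x + y = 0 /\ y + z = 0].
Proof.
have n2 n : n.+1%:R != 0 :> K by rewrite pnatr_eq0.
move=> n0 h1 h2 h3.
have x0 : x != 0.
  apply/eqP => x0; rewrite x0 in n0 h1 h2 h3.
  have [|| y0 z0] := @octic_boundary y z; [by rewrite -h2 /quartic_dx; ring|by rewrite -h3 /quartic_dx; ring|].
  by rewrite y0 z0 !eqxx in n0.
have y0 : y != 0.
  apply/eqP => y0; rewrite y0 in n0 h1 h2 h3.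
  have [|| x00 z0] := @octic_boundary x z; [by rewrite -h1 /quartic_dx; ring|by rewrite -h3 /quartic_dx; ring|].
  by rewrite x00 z0 !eqxx in n0.
have z0 : z != 0.
  apply/eqP => z0; rewrite z0 in n0 h1 h2 h3.
  have [|| x00 y00] := @octic_boundary x y; [by rewrite -h1 /quartic_dx; ring|by rewrite -h2 /quartic_dx; ring|].
  by rewrite x00 y00 !eqxx in n0.
split => //.
move: h1 h2 h3 => /eqP; rewrite mulf_eq0 (negPf x0) => /eqP h1 /eqP; rewrite mulf_eq0 (negPf y0) => /eqP h2 /eqP.
rewrite mulf_eq0 (negPf z0) => /eqP h3.
have [a [b [c [ea eb ec]]]] : exists a b c, [/\ a = y + z, b = z + x & c = x + y] by do 3!eexists.
rewrite /quartic_dx in h1 h2 h3.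
have ga : a * (b - c) ^+ 2 = b * c * (b + c).
  apply: (mulfI (n2 3%N)); apply/eqP; rewrite -subr_eq0; apply/eqP.
  by rewrite -[RHS](addr0 0) -[RHS]subr0 -{1}h2 -{1}h3 -h1 ea eb ec; ring.
have gb : b * (c - a) ^+ 2 = c * a * (c + a).
  apply: (mulfI (n2 3%N)); apply/eqP; rewrite -subr_eq0; apply/eqP.
  by rewrite -[RHS](addr0 0) -[RHS]subr0 -{1}h1 -{1}h3 -h2 ea eb ec; ring.
have gc : c * (a - b) ^+ 2 = a * b * (a + b).
  apply: (mulfI (n2 3%N)); apply/eqP; rewrite -subr_eq0; apply/eqP.
  by rewrite -[RHS](addr0 0) -[RHS]subr0 -{1}h1 -{1}h2 -h3 ea eb ec; ring.
rewrite -ea -eb -ec.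
have two0 (u w : K) : u * w ^+ 2 = 0 -> u = 0 \/ w = 0.
  by move/eqP; rewrite mulf_eq0 expf_eq0 /= => /orP[] /eqP ->; [left|right].
have abc0 : a = 0 /\ b = 0 \/ b = 0 /\ c = 0 \/ c = 0 /\ a = 0.
  have [a0|a0] := eqVneq a 0.
    rewrite a0 in gb; have : b * c ^+ 2 = 0 by rewrite -(subr0 c) gb; ring.
    by move=> /two0 [] h; tauto.
  have [b0|b0] := eqVneq b 0.
    rewrite b0 in gc; have : c * a ^+ 2 = 0 by rewrite -(subr0 a) gc; ring.
    by move=> /two0 [] h; tauto.
  have [c0|c0] := eqVneq c 0.
    rewrite c0 in ga; have : a * b ^+ 2 = 0 by rewrite -(subr0 b) ga; ring.
    by move=> /two0 [] h; tauto.
  have dual (u v w : K) : u != 0 -> v != 0 -> w != 0 -> u * (v - w) ^+ 2 = v * w * (v + w) ->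
      v * (w - u) ^+ 2 = w * u * (w + u) -> w * (u - v) ^+ 2 = u * v * (u + v) -> v * w = w * u + u * v.
    move=> u0 v0 w0 E1 E2 E3; apply: (mulfI (mulf_neq0 (n2 1%N) (mulf_neq0 v0 w0))); apply/eqP; rewrite -subr_eq0; apply/eqP.
    have -> : 2%:R * (v * w) * (v * w) - 2%:R * (v * w) * (w * u + u * v) =
      v * (v * (w - u) ^+ 2 - w * u * (w + u)) + w * (w * (u - v) ^+ 2 - u * v * (u + v))
       - u * (u * (v - w) ^+ 2 - v * w * (v + w)) by ring.
    by rewrite E1 E2 E3 !subrr !(mulr0, addr0, oppr0).
  have d1 := dual _ _ _ a0 b0 c0 ga gb gc.
  have d2 := dual _ _ _ b0 c0 a0 gb gc ga.
  suff : 2%:R * (a * b) = 0 by move/eqP; rewrite !mulf_eq0 (negPf (n2 1%N)) (negPf a0) (negPf b0).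
  have -> : 2%:R * (a * b) = (c * a + a * b - b * c) + (a * b + b * c - c * a) by ring.
  by rewrite -d1 -d2 !subrr addr0.
by case: abc0 => [[-> ->]|[[-> ->]|[-> ->]]]; [constructor 1|constructor 2|constructor 3].
Qed.

(** The default value of [nth] is itself a symmetry, so that invariance can be claimed for every
    index. *)
Definition octic_gen (j : nat) : forms := nth (perm_forms [:: 1; 0; 2; 3])
  [:: perm_forms [:: 1; 0; 2; 3]; perm_forms [:: 1; 2; 3; 0];
   scale_forms (fun j => if j == 1%N then qN1 else q1);
   scale_forms (fun j => if j == 2 then qN1 else q1);
   scale_forms (fun j => if j == 3 then qN1 else q1)] j.

Lemma octic_symmetry j v : D4pt (pden octic) v -> D4pt (pden octic) (v *m forms_mx K (octic_gen j)).
Proof.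
have o0 : 1 != 0 :> K by exact: oner_neq0.
have [lt|ge] := ltnP j 5; last first.
  rewrite /octic_gen nth_default //.
  apply: (@forms_symmetry _ octic _ (perm_forms [:: 1; 0; 2; 3]) q1 1) => // x.
  by rewrite /= !phi1; ring.
case: j lt => [|[|[|[|[|j]]]]] // _; rewrite /octic_gen /=.
- apply: (@forms_symmetry _ octic _ (perm_forms [:: 1; 0; 2; 3]) q1 1) => // x.
  by rewrite /= !phi1; ring.
- apply: (@forms_symmetry _ octic _ (perm_forms [:: 3; 0; 1; 2]) q1 1) => // x.
  by rewrite /= !phi1; ring.
- apply: (@forms_symmetry _ octic _ (scale_forms (fun j => if j == 1%N then qN1 else q1)) q1 1) => // x.
  by rewrite /= !phi1 !phiN1; ring.
- apply: (@forms_symmetry _ octic _ (scale_forms (fun j => if j == 2 then qN1 else q1)) q1 1) => // x.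
  by rewrite /= !phi1 !phiN1; ring.
- apply: (@forms_symmetry _ octic _ (scale_forms (fun j => if j == 3 then qN1 else q1)) q1 1) => // x.
  by rewrite /= !phi1 !phiN1; ring.
Qed.

Lemma cyclic_coords (a b c d : K) :
  (\row_j tuple4 a b c d j) *m forms_mx K (perm_forms [:: 1; 2; 0; 3]) = \row_j tuple4 b c a d j.
Proof.
by apply/rowP; apply: ord4; rewrite mul_forms_mx mxE /= phi1 mul1r addr0 mxE.
Qed.

Lemma octic_cyclic v : D4pt (pden octic) v -> D4pt (pden octic) (v *m forms_mx K (perm_forms [:: 1; 2; 0; 3])).
Proof.
apply: (@forms_symmetry _ octic _ (perm_forms [:: 2; 0; 1; 3]) q1 1) => // x.
by rewrite /= !phi1; ring.
Qed.

Lemma octic_toric n1 n2 n3 : toric_critical_D4 (forms_mx K (tilt n1 n2 n3)) (pden octic).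
Proof.
apply: toric_critical_tilt => y0 y1 y2 n0 x h0 h1 h2.
have sq0 (y : K) : (y ^+ 2 != 0) = (y != 0) by rewrite expf_eq0.
have n2' : 2%:R != 0 :> K by rewrite pnatr_eq0.
have [||||[z0 z1 z2] hc] := @quartic_critical (y0 ^+ 2) (y1 ^+ 2) (y2 ^+ 2).
- by rewrite !sq0.
- apply: (mulfI n2'); rewrite mulr0 -[RHS]h0 /x /tuple4 /=; rewrite /quartic_dx; ring.
- apply: (mulfI n2'); rewrite mulr0 -[RHS]h1 /x /tuple4 /=; rewrite /quartic_dx; ring.
- apply: (mulfI n2'); rewrite mulr0 -[RHS]h2 /x /tuple4 /=; rewrite /quartic_dx; ring.
rewrite !sq0 in z0 z1 z2; split=> //.
have cusp a b c : b ^+ 2 + c ^+ 2 = 0 -> c ^+ 2 + a ^+ 2 = 0 -> c != 0 ->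
    D4pt (pden octic) (\row_j tuple4 a b c 0 j).
  move=> /eqP; rewrite addr_eq0 => /eqP hb /eqP; rewrite addrC addr_eq0 => /eqP ha c0.
  by apply: octic_cusp; rewrite !mxE.
case: hc => -[ha hb]; first exact: cusp.
- by have := octic_cyclic (cusp _ _ _ ha hb z0); rewrite cyclic_coords => /octic_cyclic; rewrite cyclic_coords.
- by have := octic_cyclic (cusp _ _ _ ha hb z1); rewrite cyclic_coords.
Qed.

(** Twelve positions of the entries i and 0 among the coordinates, with four choices of signs
    each. *)
Definition octic_points := orbit_points octic_gen [:: q1; q1; qi; q0]
  [:: (0, [:: 1]); (0, [:: 0]); (1, [:: 1]); (1, [:: 1]); (1, [:: 0]); (2, [:: 1]); (2, [:: 1]); (2, [:: 1]); (1, [:: 0]); (2, [:: 1]); (2, [:: 1])]%N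
  2 (free_coords 1).

(** Modulo 37 the residue 26 is a primitive cube root of unity and 31 a square root of -1. The
    vertex n = (-2, -2, -2, 1) keeps all faces off the points. *)
Lemma octic_points_distinct : distinct_codes 37 26 31 (tilt_inv (-2)%BZ (-2)%BZ (-2)%BZ) 48 octic_points.
Proof. by vm_compute. Qed.

Lemma octic_points_D4 x : x \in octic_points -> D4pt (pden octic) (vec K x).
Proof.
apply: orbit_points_D4.
  have i0 : 'i != 0 :> K by rewrite -sqrf_eq0 sqrCi oppr_eq0 oner_neq0.
  by apply: octic_cusp; rewrite !mxE /= ?phi0 ?phi1 ?phii ?sqrCi ?opprK ?expr1n.
move=> j; apply: preserves_forms_symmetry; last exact: octic_symmetry.
by case: j => [|[|[|[|[|j]]]]] //; rewrite /octic_gen nth_default.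
Qed.
End Octic.

Theorem mu_D4_octic (R : realType) k : (1 <= k)%N -> (((48 * k ^ 3)%N%:R)%:E <= mu_D4 R (8 * k)%N)%E.
Proof.
have nz : q1 <> q0 by [].
(* The cofactors come from 26^2 + 26 + 1 = 37 . 19 and 31^2 + 1 = 37 . 26. *)
have [v [hv v0 vinj]] := @distinct_codesP (Cplx R) 37 26 31 19 26 (tilt_inv (-2)%BZ (-2)%BZ (-2)%BZ)
  (tilt (-2)%BZ (-2)%BZ (-2)%BZ) q1 48 _ erefl erefl erefl erefl erefl nz octic_points_distinct.
apply: (@mu_D4_power_cover _ (pden (octic (Cplx R))) _ 8 48 v isT _ _ _ _ v0 vinj).
- exact: pden_homog.
- exact: (@forms_unit _ _ (tilt_inv (-2)%BZ (-2)%BZ (-2)%BZ) q1).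
- exact: octic_toric.
- by move=> j; have [x hx ->] := hv j; exact: octic_points_D4.
Qed.

(** * The surface of degree 12 *)

Section Duodecic.
Variable K : numClosedFieldType.
Local Notation X n := (PX K (idx n)).

(* An invariant of the complex reflection group G_29. *)
Definition duodecic : pexp K 4 :=
  let y n := X n %^ 4 in
  let s1 := y 0 %+ y 1 %+ y 2 %+ y 3 in
  let s2 := y 0 %* y 1 %+ y 0 %* y 2 %+ y 0 %* y 3 %+ y 1 %* y 2 %+ y 1 %* y 3 %+ y 2 %* y 3 in
  let s3 := y 0 %* y 1 %* y 2 %+ y 0 %* y 1 %* y 3 %+ y 0 %* y 2 %* y 3 %+ y 1 %* y 2 %* y 3 in
  let e := X 0 %* X 1 %* X 2 %* X 3 in
  13%:R%:K %* s1 %^ 3 %+ (- 180%:R)%:K %* (s1 %* s2) %+ (5%:R ,, 400)%:K %* s3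
  %+ 522%:R%:K %* (e %* s1 %^ 2) %+ (- 3240%:R)%:K %* (e %* s2) %+ 4176%:R%:K %* (e %^ 2 %* s1)
  %+ (- (7%:R ,, 344))%:K %* e %^ 3.

(* Applied to the elementary symmetric functions of x_1, ..., x_4, returns those of x_1^2, ..., x_4^2. *)
Definition graeffe (a : K * K * K * K) : K * K * K * K :=
  let: (a1, a2, a3, a4) := a in
  (a1 ^+ 2 - 2%:R * a2, a2 ^+ 2 - 2%:R * a1 * a3 + 2%:R * a4, a3 ^+ 2 - 2%:R * a2 * a4, a4 ^+ 2).

Definition elem (x y z w : K) : K * K * K * K :=
  (x + y + z + w, x * y + x * z + x * w + y * z + y * w + z * w,
   x * y * z + x * y * w + x * z * w + y * z * w, x * y * z * w).

(** Applying [graeffe] twice passes to the fourth powers. In this form the symmetry under the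
    reflection and the expansion at a D4 point become identities in a few symmetric functions. *)
Definition duodecic_sym (a : K * K * K * K) : K :=
  let: (s1, s2, s3, _) := graeffe (graeffe a) in let e := a.2 in
  13%:R * s1 ^+ 3 - 180%:R * (s1 * s2) + (5%:R ,, 400) * s3 + 522%:R * (e * s1 ^+ 2)
  - 3240%:R * (e * s2) + 4176%:R * (e ^+ 2 * s1) - (7%:R ,, 344) * e ^+ 3.

Lemma graeffe_elem x y z w : graeffe (elem x y z w) = elem (x ^+ 2) (y ^+ 2) (z ^+ 2) (w ^+ 2).
Proof. by rewrite /graeffe /elem; congr (_, _, _, _); ring. Qed.

Lemma peval_duodecic (x : 'I_4 -> K) :
  peval x duodecic = duodecic_sym (elem (x (idx 0)) (x (idx 1)) (x (idx 2)) (x (idx 3))).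
Proof.
rewrite /duodecic_sym !graeffe_elem /elem /=; have sq2 (a : K) : (a ^+ 2) ^+ 2 = a ^+ 4 by rewrite -exprM.
rewrite !sq2; move: (_ ^+ 4) (_ ^+ 4) (_ ^+ 4) (_ ^+ 4) => a b c d.
move: (x _ * x _ * x _ * x _) => e; ring.
Qed.

Lemma elem_reflect a b c d : elem (a - b - c - d) (b - a - c - d) (c - a - b - d) (d - a - b - c) =
  let: (a1, a2, a3, a4) := elem a b c d in
  (- 2%:R * a1, 4%:R * a2, 2%:R * a1 ^+ 3 - 8%:R * a1 * a2 + 8%:R * a3,
   - a1 ^+ 4 + 4%:R * a1 ^+ 2 * a2 - 8%:R * a1 * a3 + 16%:R * a4).
Proof. by rewrite /elem; congr (_, _, _, _); ring. Qed.

(** The linear map is, up to sign, twice the reflection in the root (1, 1, 1, 1), hence the factor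
    2^12 in degree 12. *)
Lemma duodecic_sym_reflect a1 a2 a3 a4 :
  duodecic_sym (- 2%:R * a1, 4%:R * a2, 2%:R * a1 ^+ 3 - 8%:R * a1 * a2 + 8%:R * a3,
   - a1 ^+ 4 + 4%:R * a1 ^+ 2 * a2 - 8%:R * a1 * a3 + 16%:R * a4) = 64%:R ^+ 2 * duodecic_sym (a1, a2, a3, a4).
Proof. by rewrite /duodecic_sym /graeffe /=; ring. Qed.

(** The polynomials from here to [duo_D] are the coefficients of the form expanded in [z], [m] and
    [n], where [z] is the sum of the coordinates and [t] the mean of the first three;
    [duodecic_expansion] certifies them. *)
Definition duo_U (z m n t : pexp K 4) : pexp K 4 :=
    t %^ 10 %* ((8%:R ,, 640) * 1000%:R)%:K %+ n %* t %^ 7 %* (- ((70%:R ,, 398) * 1000%:R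
    + 720%:R))%:K %+ n %^ 2 %* t %^ 4 %* ((19%:R ,, 859) ,, 904)%:K %+ n %^ 3 %* t %*
    (116%:R ,, 208)%:K %+ m %* (t %^ 8 %* ((9%:R ,, 849) ,, 600)%:K %+ n %* t
    %^ 5 %* (- ((34%:R ,, 903) ,, 872))%:K %+ n %^ 2 %* t %^ 2 %* (- ((4%:R * 1000%:R +
    127%:R) ,, 760))%:K) %+ m %^ 2 %* (t %^ 6 %* (- ((48%:R ,, 828) ,, 96))%:K
    %+ n %* t %^ 3 %* (- ((1%:R ,, 280) ,, 448))%:K %+ n %^ 2 %* (75%:R * 1000%:R +
    168%:R)%:K) %+ m %^ 3 %* (t %^ 4 %* (- ((73%:R ,, 211) ,, 40))%:K %+ n %* t %* (-
    (451%:R ,, 8))%:K) %+ m %^ 4 %* t %^ 2 %* ((21%:R ,, 41) ,, 856)%:K %+ z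
    %* (t %^ 9 %* (- ((21%:R ,, 600) * 1000%:R))%:K %+ n %* t %^ 6 %* ((50%:R ,, 621) *
    1000%:R + 760%:R)%:K %+ n %^ 2 %* t %^ 3 %* (- ((6%:R ,, 284) ,, 304))%:K %+ n %^ 3 %*
    (- (7%:R ,, 344))%:K %+ m %* (t %^ 7 %* (- ((19%:R ,, 699) ,, 200))%:K %+
    n %* t %^ 4 %* ((14%:R ,, 372) ,, 640)%:K %+ n %^ 2 %* t %* (817%:R * 1000%:R +
    776%:R)%:K) %+ m %^ 2 %* (t %^ 5 %* ((29%:R ,, 696) ,, 544)%:K %+ n %* t %^ 2 %* (-
    (769%:R ,, 824))%:K) %+ m %^ 3 %* t %^ 3 %* ((19%:R ,, 828) ,, 800)%:K %+
    m %^ 4 %* t %* (- ((4%:R ,, 525) ,, 632))%:K) %+ z %^ 2 %* (t %^ 8 %* ((24%:R *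
    1000%:R + 516%:R) * 1000%:R)%:K %+ n %* t %^ 5 %* (- ((24%:R ,, 215) ,, 328))%:K %+ n
    %^ 2 %* t %^ 2 %* ((1%:R ,, 95) ,, 336)%:K %+ m %* (t %^ 6 %* ((16%:R * 1000%:R +
    768%:R) ,, 512)%:K %+ n %* t %^ 3 %* (- ((3%:R ,, 441) ,, 744))%:K %+ n %^
    2 %* (- (62%:R ,, 640))%:K) %+ m %^ 2 %* (t %^ 4 %* (- ((12%:R ,, 103) * 1000%:R +
    344%:R))%:K %+ n %* t %* (344%:R ,, 88)%:K) %+ m %^ 3 %* t %^ 2 %* (- ((2%:R ,, 525) *
    1000%:R + 256%:R))%:K %+ m %^ 4 %* (377%:R ,, 136)%:K) %+ z %^ 3 %* (t %^ 7 %* (- ((16%:R *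
    1000%:R + 632%:R) * 1000%:R))%:K %+ n %* t %^ 4 %* ((7%:R ,, 702) ,, 560)%:K %+ n %^ 2
    %* t %* (- (101%:R ,, 520))%:K %+ m %* (t %^ 5 %* (- ((7%:R ,, 915) * 1000%:R +
    968%:R))%:K %+ n %* t %^ 2 %* (451%:R ,, 8)%:K) %+ m %^ 2 %* (t %^ 3 %* ((3%:R ,, 358)
    * 1000%:R + 584%:R)%:K %+ n %* (- (39%:R ,, 528))%:K) %+ m %^ 3 %* t %* (118%:R * 1000%:R +
    584%:R)%:K) %+ z %^ 4 %* (t %^ 6 %* ((7%:R ,, 470) ,, 432)%:K %+ n %* t %^ 3 %* (-
    ((1%:R ,, 601) ,, 928))%:K %+ n %^ 2 %* (4%:R ,, 176)%:K %+ m %* (t %^ 4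
    %* ((2%:R ,, 247) ,, 480)%:K %+ n %* t %* (- (25%:R ,, 56))%:K) %+ m %^ 2
    %* t %^ 2 %* (- (601%:R ,, 992))%:K) %+ z %^ 5 %* (t %^ 5 %* (- ((2%:R ,, 322) *
    1000%:R + 648%:R))%:K %+ n %* t %^ 2 %* (209%:R ,, 736)%:K %+ m %* t %^ 3 %* (- (385%:R * 1000%:R
    + 560%:R))%:K %+ m %^ 2 %* t %* (60%:R ,, 912)%:K) %+ z %^ 6 %* (t %^ 4 %* (506%:R * 1000%:R +
    718%:R)%:K %+ n %* t %* (- (15%:R ,, 786))%:K %+ m %* t %^ 2 %* (37%:R ,, 206)%:K %+ m
    %^ 2 %* (- (2%:R ,, 538))%:K) %+ z %^ 7 %* (t %^ 3 %* (- (76%:R ,, 698))%:K %+ n %*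
    (522%:R)%:K %+ m %* t %* (- (1%:R ,, 566))%:K) %+ z %^ 8 %* t %^ 2 %* (7%:R ,, 722)%:K
    %+ z %^ 9 %* t %* (- (468%:R))%:K %+ z %^ 10 %* (13%:R)%:K.
Definition duo_B (z m n t : pexp K 4) : pexp K 4 :=
    m %* t %^ 7 %* ((49%:R ,, 766) ,, 400)%:K %+ m %^ 2 %* t %^ 5 %* ((128%:R * 1000%:R +
    117%:R) ,, 376)%:K %+ m %^ 3 %* t %^ 3 %* (- ((47%:R ,, 962) ,, 368))%:K
    %+ m %^ 4 %* t %* (279%:R ,, 936)%:K.
Definition duo_Bn (z m n t : pexp K 4) : pexp K 4 :=
    t %^ 8 %* ((62%:R ,, 208) * 1000%:R)%:K %+ n %* t %^ 5 %* (- ((32%:R ,, 581) * 1000%:R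
    + 440%:R))%:K %+ n %^ 2 %* t %^ 2 %* (- (520%:R ,, 992))%:K %+ m %* (t %^ 6 %* ((46%:R * 1000%:R +
    811%:R) ,, 520)%:K %+ n %* t %^ 3 %* ((9%:R ,, 968) ,, 832)%:K %+ n %^ 2
    %* (38%:R ,, 880)%:K) %+ m %^ 2 %* (t %^ 4 %* ((6%:R ,, 920) ,, 640)%:K %+
    n %* t %* (- (225%:R ,, 504))%:K) %+ m %^ 3 %* t %^ 2 %* ((2%:R ,, 706) * 1000%:R +
    48%:R)%:K %+ m %^ 4 %* (- (93%:R ,, 312))%:K.
Definition duo_C (z m n t : pexp K 4) : pexp K 4 :=
    t %^ 9 %* (- ((27%:R ,, 648) * 1000%:R))%:K %+ n %* t %^ 6 %* ((21%:R ,, 720) *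
    1000%:R + 960%:R)%:K %+ n %^ 2 %* t %^ 3 %* (694%:R ,, 656)%:K %+ n %^ 3 %* (5%:R * 1000%:R +
    400%:R)%:K %+ m %* (t %^ 7 %* (- ((26%:R ,, 749) ,, 440))%:K %+ n %* t %^ 4 %* (-
    ((9%:R ,, 968) ,, 832))%:K %+ n %^ 2 %* t %* (- (155%:R ,, 520))%:K) %+ m
    %^ 2 %* (t %^ 5 %* (- ((5%:R ,, 536) ,, 512))%:K %+ n %* t %^ 2 %* (451%:R * 1000%:R +
    8%:R)%:K) %+ m %^ 3 %* (t %^ 3 %* (- ((3%:R ,, 608) ,, 64))%:K %+ n %* (38%:R *
    1000%:R + 880%:R)%:K) %+ m %^ 4 %* t %* (373%:R ,, 248)%:K.
Definition duo_D (z m n t : pexp K 4) : pexp K 4 :=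
    t %^ 8 %* (- ((24%:R ,, 883) ,, 200))%:K %+ m %* t %^ 6 %* (- ((85%:R * 1000%:R +
    411%:R) ,, 584))%:K %+ m %^ 2 %* t %^ 4 %* ((47%:R ,, 962) ,, 368)%:K %+ m
    %^ 3 %* t %^ 2 %* (- (559%:R ,, 872))%:K %+ m %^ 4 %* (- (186%:R ,, 624))%:K.

Lemma duodecic_expansion (z m n t : pexp K 4) (y : 'I_4 -> K) :
  let w := peval y z - 3%:R * peval y t in
  let e2 := 3%:R * peval y t ^+ 2 - 3%:R * peval y m in
  let e3 := peval y n + peval y t ^+ 3 - 3%:R * peval y t * peval y m in
  duodecic_sym (peval y z, e2 + 3%:R * peval y t * w, e3 + w * e2, w * e3) =
  peval y (duo_U z m n t) * peval y z ^+ 2 + peval y z * (peval y (duo_B z m n t) * peval y m)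
  + (peval y (duo_C z m n t) + peval y z * peval y (duo_Bn z m n t)) * peval y n
  + peval y (duo_D z m n t) * peval y m ^+ 2.
Proof.
rewrite /duodecic_sym /graeffe /=.
move: (peval y z) (peval y m) (peval y n) (peval y t) => Z M N T; ring.
Qed.

(** Cardano's parametrization: the symmetric functions of the three values t + w' u + w v only
    involve t, u v and u^3 + v^3. *)
Lemma elem_resolvent (w w' t u v x : K) : w + w' = -1 -> w * w' = 1 ->
  let m := u * v in let n := u ^+ 3 + v ^+ 3 in
  let e2 := 3%:R * t ^+ 2 - 3%:R * m in let e3 := n + t ^+ 3 - 3%:R * t * m in
  elem (t + u + v) (t + w' * u + w * v) (t + w * u + w' * v) x =
  (3%:R * t + x, e2 + 3%:R * t * x, e3 + x * e2, x * e3).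
Proof.
move=> h1 h2 m n e2 e3.
have [hs hp _] := resolvent_sum_prod t u v h1 h2.
rewrite /elem; move: (t + w' * u + w * v) (t + w * u + w' * v) hs hp => a b hs hp.
have -> : t + u + v + a + b + x = 3%:R * t + x by rewrite -[_ + a + b]addrA hs; ring.
have -> : (t + u + v) * a + (t + u + v) * b + (t + u + v) * x + a * b + a * x + b * x = e2 + 3%:R * t * x.
  have -> : (t + u + v) * a + (t + u + v) * b + (t + u + v) * x + a * b + a * x + b * x =
    (t + u + v) * (a + b) + (t + u + v) * x + a * b + x * (a + b) by ring.
  by rewrite hs hp /e2 /m; ring.
have -> : (t + u + v) * a * b + (t + u + v) * a * x + (t + u + v) * b * x + a * b * x = e3 + x * e2.
  have -> : (t + u + v) * a * b + (t + u + v) * a * x + (t + u + v) * b * x + a * b * x =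
    (t + u + v) * (a * b) + (t + u + v) * (a + b) * x + (a * b) * x by ring.
  by rewrite hs hp /e3 /e2 /m /n; ring.
have -> : (t + u + v) * a * b * x = x * e3; last by [].
have -> : (t + u + v) * a * b * x = (t + u + v) * (a * b) * x by ring.
by rewrite hp /e3 /m /n; ring.
Qed.

Definition resolvent (w w' : K) : pexp K 4 :=
  (1 / 3%:R)%:K %* (X 0 %+ w%:K %* X 1 %+ w'%:K %* X 2).

(** The point is fixed by the permutations of the first three coordinates. In the resolvents u1, u2
    an invariant expansion only involves m = u1 u2 and n = u1^3 + u2^3, so its cubic part in u1, u2
    is automatically diagonal. The absence of the terms 1, z and m makes the point D4. *)
Lemma duodecic_node (v : 'rV[K]_4) : let x i := v ord0 (idx i) in
  x 0 = 1 -> x 1 = 1 -> x 2 = 1 -> x 3 = - 3%:R -> D4pt (pden duodecic) v.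
Proof.
move=> x x0 x1 x2 x3; have [hs hp] := omega_conj K.
set w := omega K in hs hp *; set w' := w ^+ 2 in hs hp *.
have n2 n : n.+1%:R != 0 :> K by rewrite pnatr_eq0.
have nz a b : a.+1%:R * 1000%:R + b%:R != 0 :> K.
  by rewrite -natrM -natrD pnatr_eq0 addn_eq0 muln_eq0.
pose t := resolvent 1 1; pose u1 := resolvent w w'; pose u2 := resolvent w' w.
pose z := X 0 %+ X 1 %+ X 2 %+ X 3.
pose m := u1 %* u2; pose n := u1 %^ 3 %+ u2 %^ 3.
pose c := duo_C z m n t %+ z %* duo_Bn z m n t.
have ww : w' * w' = w.
  have -> : w' * w' = w * (w * w') by rewrite /w'; ring.
  by rewrite hp mulr1.
have w2 : w * w = w' by rewrite -expr2.
have w1 : w' = - 1 - w by rewrite -hs addrAC subrr add0r.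
have coords (y : 'I_4 -> K) : [/\ y (idx 0) = peval y t + peval y u1 + peval y u2,
    y (idx 1) = peval y t + w' * peval y u1 + w * peval y u2 &
    y (idx 2) = peval y t + w * peval y u1 + w' * peval y u2].
  rewrite /t /u1 /u2 /=; move: (y (idx 0)) (y (idx 1)) (y (idx 2)) => a b d.
  split.
  - have -> : 1 / 3%:R * (a + 1 * b + 1 * d) + 1 / 3%:R * (a + w * b + w' * d) + 1 / 3%:R * (a + w' * b + w * d)
      = (3%:R * a + (1 + (w + w')) * b + (1 + (w + w')) * d) / 3%:R by field.
    by rewrite hs; field.
  - have -> : 1 / 3%:R * (a + 1 * b + 1 * d) + w' * (1 / 3%:R * (a + w * b + w' * d)) + w * (1 / 3%:R * (a + w' * b + w * d))
      = ((1 + (w + w')) * a + (1 + 2%:R * (w * w')) * b + (1 + (w' * w' + w * w)) * d) / 3%:R by field.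
    by rewrite ww w2 hs hp; field.
  - have -> : 1 / 3%:R * (a + 1 * b + 1 * d) + w * (1 / 3%:R * (a + w * b + w' * d)) + w' * (1 / 3%:R * (a + w' * b + w * d))
      = ((1 + (w + w')) * a + (1 + (w' * w' + w * w)) * b + (1 + 2%:R * (w * w')) * d) / 3%:R by field.
    by rewrite ww w2 hs hp; field.
have pu1 : peval (v ord0) u1 = 0.
  by rewrite /= -/(x 0) -/(x 1) -/(x 2) x0 x1 x2 !mulr1 -addrA hs subrr mulr0.
have pu2 : peval (v ord0) u2 = 0.
  by rewrite /= -/(x 0) -/(x 1) -/(x 2) x0 x1 x2 !mulr1 -addrA [w' + w]addrC hs subrr mulr0.
have pz : peval (v ord0) z = 0 by rewrite /= -/(x 0) -/(x 1) -/(x 2) -/(x 3) x0 x1 x2 x3; ring.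
have pt : peval (v ord0) t = 1 by rewrite /= -/(x 0) -/(x 1) -/(x 2) x0 x1 x2; field.
(* The term D m^2 = (u2 D) u1^2 u2 is booked under [c1], whose value at the point is 0 because of
   the factor u2. *)
apply: (@D4pt_pexp _ duodecic u1 u2 z (duo_U z m n t) 0%:K (duo_B z m n t) 0%:K
  c (u2 %* duo_D z m n t) 0%:K c v).
- move=> y; rewrite peval_duodecic; have [-> -> ->] := coords y.
  rewrite (elem_resolvent _ _ _ _ hs hp).
  have zE : y (idx 3) = peval y z - 3%:R * peval y t.
    by rewrite /z /t /=; field.
  rewrite zE [3%:R * _ + (_ - _)]addrC subrK.
  rewrite (duodecic_expansion z m n t y) /c.
  cbn [peval]; rewrite /m /n; cbn [peval].
  move: (peval y (duo_U _ _ _ _)) (peval y (duo_B _ _ _ _)) (peval y (duo_Bn _ _ _ _)) (peval y (duo_C _ _ _ _)) (peval y (duo_D _ _ _ _)).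
  move: (peval y u1) (peval y u2) (peval y z) => a b d U0 B0 B1 C0 D0; ring.
- by [].
- have nE : peval (v ord0) n = 0 by rewrite /n; cbn [peval]; rewrite pu1 pu2; ring.
  have mE : peval (v ord0) m = 0 by rewrite /m; cbn [peval]; rewrite pu1 mul0r.
  have cE : peval (v ord0) c = - (27%:R ,, 648) * 1000%:R.
    rewrite /c /duo_C /duo_Bn; cbn [peval]; rewrite pz nE mE pt; ring.
  have c0 : peval (v ord0) c != 0.
    by rewrite cE mulNr oppr_eq0 mulf_neq0 // (nz 26%N 648%N).
  split => //.
  have -> : peval (v ord0) (duo_U z m n t) = (8%:R ,, 640) * 1000%:R.
    rewrite /duo_U; cbn [peval]; rewrite pz nE mE pt; ring.
  by rewrite mulf_neq0 // (nz 7%N 640%N).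
- by cbn [peval]; rewrite pu2 mul0r.
- by [].
move=> s d1 d2 d3.
have [e0 e1 e2] := coords s.
have lin (p q : K) : pdiff (v ord0) s (resolvent p q) = peval s (resolvent p q).
  by rewrite /=; ring.
have dz : peval s z = 0 by rewrite -[RHS]d3.
rewrite (_ : peval s u1 = 0) 1?(_ : peval s u2 = 0) -?lin // !mulr0 !addr0 in e0 e1 e2.
exists (s (idx 0)); apply: ord4; rewrite -/(x 0) -/(x 1) -/(x 2) -/(x 3) ?x0 ?x1 ?x2 ?x3 ?mulr1 //.
- by rewrite e0 e1.
- by rewrite e0 e2.
by move: dz; rewrite /= e0 e1 e2 => dz; rewrite -[LHS]subr0 -dz; ring.
Qed.

(** On x_4 = 0 the form is 13 s1^3 - 180 s1 s2 + 5400 s3 in the fourth powers, and [dx] is its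
    partial derivative. Differences of partial derivatives factor as 180 (b - a)(30 c - s1), which
    forces two variables to coincide; each remaining case leaves a nonzero constant times a
    power. *)
Lemma cubic_critical (x y z : K) : [|| x != 0, y != 0 | z != 0] ->
  let dx a b c := 39%:R * (a + b + c) ^+ 2 - 180%:R * (a * b + b * c + c * a)
     - 180%:R * (a + b + c) * (b + c) + (5%:R ,, 400) * (b * c) in
  x * dx x y z = 0 -> y * dx y z x = 0 -> z * dx z x y = 0 -> False.
Proof.
have n2 n : n.+1%:R != 0 :> K by rewrite pnatr_eq0.
have nz a b : a.+1%:R * 1000%:R + b%:R != 0 :> K.
  by rewrite -natrM -natrD pnatr_eq0 addn_eq0 muln_eq0.
move=> n0 dx h1 h2 h3.
have cube0 n (a : K) : n.+1%:R * a ^+ 3 = 0 -> a = 0.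
  by move=> /eqP; rewrite mulf_eq0 (negPf (n2 n)) expf_eq0 => /eqP.
have sqr0 n (a : K) : n.+1%:R * a ^+ 2 = 0 -> a = 0.
  by move=> /eqP; rewrite mulf_eq0 (negPf (n2 n)) expf_eq0 => /eqP.
have prod0 (a b : K) : a != 0 -> a * b = 0 -> b = 0.
  by move=> a0 /eqP; rewrite mulf_eq0 (negPf a0) => /eqP.
have boundary (a b : K) : a * dx a b 0 = 0 -> b * dx b 0 a = 0 -> a = 0 /\ b = 0.
  have [-> _ h|a0] := eqVneq a 0; first by split => //; apply: (cube0 38%N); rewrite -h /dx; ring.
  have [-> h _|b0] := eqVneq b 0; first by split => //; apply: (cube0 38%N); rewrite -h /dx; ring.
  move=> /(prod0 _ _ a0) ha /(prod0 _ _ b0) hb; exfalso.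
  have /eqP : (180%:R * (a + b)) * (a - b) = 0.
    have -> : (180%:R * (a + b)) * (a - b) = dx a b 0 - dx b 0 a by rewrite /dx; ring.
    by rewrite ha hb subrr.
  rewrite mulf_eq0 => /orP[/eqP s0|/eqP d0].
    have e : b = - a.
      by apply/eqP; rewrite -addr_eq0 addrC; apply/eqP/(prod0 180%:R).
    by move/eqP: a0; apply; apply: (sqr0 179%N); rewrite -ha e /dx; ring.
  have e : b = a by apply/esym/eqP; rewrite -subr_eq0 d0.
  move/eqP: a0; apply; apply: (sqr0 383%N); rewrite -[RHS]oppr0 -ha e /dx; ring.
have x0 : x != 0.
  apply/eqP => x0; rewrite x0 in n0 h1 h2 h3.
  have [|| y0 z0] := @boundary y z; [by []|by []|].
  by rewrite y0 z0 !eqxx in n0.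
have y0 : y != 0.
  apply/eqP => y0; rewrite y0 in n0 h1 h2 h3.
  have [|| z0 x00] := @boundary z x; [by []|by []|].
  by rewrite x00 z0 !eqxx in n0.
have z0 : z != 0.
  apply/eqP => z0; rewrite z0 in n0 h1 h2 h3.
  have [|| x00 y00] := @boundary x y; [by []|by []|].
  by rewrite x00 y00 !eqxx in n0.
have {}h1 := prod0 _ _ x0 h1; have {}h2 := prod0 _ _ y0 h2; have {}h3 := prod0 _ _ z0 h3.
have diff (a b c : K) : dx a b c = 0 -> dx b c a = 0 -> b = a \/ a + b + c = 30%:R * c.
  move=> ha hb; have /eqP : (180%:R * (b - a)) * (30%:R * c - (a + b + c)) = 0.
    have -> : (180%:R * (b - a)) * (30%:R * c - (a + b + c)) = dx a b c - dx b c a by rewrite /dx; ring.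
    by rewrite ha hb subrr.
  rewrite !mulf_eq0 (negPf (n2 179%N)) /= => /orP[/eqP d0|/eqP d0]; [left|right].
    by apply/eqP; rewrite -subr_eq0 d0.
  by apply/esym/eqP; rewrite -subr_eq0 d0.
have pair (a b c : K) : b = a -> a != 0 -> dx a b c = 0 -> dx b c a = 0 -> dx c a b = 0 -> False.
  move=> -> a0 ha hb hc; case: (diff a c a hb hc) => [e|].
    rewrite e in ha; move/eqP: a0; apply; apply: (sqr0 0%N).
    by apply: (prod0 (4%:R ,, 131)); [exact: (nz 3%N)|rewrite -ha /dx; ring].
  move=> e; have {}e : c = 28%:R * a.
    have -> : c = (a + c + a) - 2%:R * a by ring.
    by rewrite e; ring.
  move/eqP: a0; apply; apply: (sqr0 0%N); apply: (prod0 (19%:R ,, 440)); first exact: (nz 18%N).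
  by rewrite -ha e /dx; ring.
have [e|s3] := diff _ _ _ h1 h2; first exact: pair e x0 h1 h2 h3.
have [e|s1] := diff _ _ _ h2 h3; first exact: pair e y0 h2 h3 h1.
have [e|s2] := diff _ _ _ h3 h1; first exact: pair e z0 h3 h1 h2.
have E (a b : K) : 30%:R * a = 30%:R * b -> a = b by exact: mulfI.
have zx : x = z by apply: E; rewrite -s1 -s3; ring.
have zy : y = z by apply: E; rewrite -s2 -s3; ring.
by rewrite zx in h1 h2 h3 x0; rewrite zy in h1 h2 h3; exact: pair erefl x0 h1 h2 h3.
Qed.

Definition reflection_forms : forms :=
  mkseq (fun j => [seq (if i == j then q1 else qN1, i) | i <- iota 0 4]) 4.

Definition qni : quad := qmul qN1 qi.

(** The diagonal generators have determinant 1: besides the fourth powers, they must fix the product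
    of the coordinates. *)
Definition duodecic_gen (j : nat) : forms := nth (perm_forms [:: 1; 0; 2; 3])
  [:: perm_forms [:: 1; 0; 2; 3]; perm_forms [:: 1; 2; 3; 0]; reflection_forms;
   scale_forms (nth q0 [:: q1; qi; q1; qni]);
   scale_forms (nth q0 [:: q1; q1; qi; qni])] j.

Lemma duodecic_symmetry j v : D4pt (pden duodecic) v -> D4pt (pden duodecic) (v *m forms_mx K (duodecic_gen j)).
Proof.
have [lt|ge] := ltnP j 5; last first.
  rewrite /duodecic_gen nth_default //.
  apply: (@forms_symmetry _ duodecic _ (perm_forms [:: 1; 0; 2; 3]) q1 1) => // x.
  rewrite mul1r !peval_duodecic; congr (duodecic_sym _).
  by rewrite /elem /= !phi1; congr (_, _, _, _); ring.
have i4 (y : K) : ('i * y) ^+ 4 = y ^+ 4.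
  by rewrite exprMn -[4%N]/(2 * 2)%N exprM sqrCi sqrrN expr1n mul1r.
have ni4 (y : K) : (-1 * 'i * y) ^+ 4 = y ^+ 4.
  by rewrite -mulrA mulN1r -[4%N]/(2 * 2)%N exprM sqrrN -exprM i4.
have phini : phi K qni = -1 * 'i by rewrite phiM phiN1 phii.
case: j lt => [|[|[|[|[|j]]]]] // _; rewrite /duodecic_gen /=.
- apply: (@forms_symmetry _ duodecic _ (perm_forms [:: 1; 0; 2; 3]) q1 1) => // x.
  rewrite mul1r !peval_duodecic; congr (duodecic_sym _).
  by rewrite /elem /= !phi1; congr (_, _, _, _); ring.
- apply: (@forms_symmetry _ duodecic _ (perm_forms [:: 3; 0; 1; 2]) q1 1) => // x.
  rewrite mul1r !peval_duodecic; congr (duodecic_sym _).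
  by rewrite /elem /= !phi1; congr (_, _, _, _); ring.
- apply: (@forms_symmetry _ duodecic _ reflection_forms (qint 4) (64%:R ^+ 2)) => // x.
  rewrite !peval_duodecic /= !phi1 !phiN1.
  move: (x (idx 0)) (x (idx 1)) (x (idx 2)) (x (idx 3)) => a b c d.
  have -> : 1 * a + (-1 * b + (-1 * c + (-1 * d + 0))) = a - b - c - d by ring.
  have -> : -1 * a + (1 * b + (-1 * c + (-1 * d + 0))) = b - a - c - d by ring.
  have -> : -1 * a + (-1 * b + (1 * c + (-1 * d + 0))) = c - a - b - d by ring.
  have -> : -1 * a + (-1 * b + (-1 * c + (1 * d + 0))) = d - a - b - c by ring.
  by rewrite elem_reflect; case: (elem a b c d) => [[[a1 a2] a3] a4]; rewrite duodecic_sym_reflect.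
- apply: (@forms_symmetry _ duodecic _ (scale_forms (nth q0 [:: q1; qni; q1; qi])) q1 1) => // x.
  have e4 (a b c d : K) : a * ('i * b) * c * (-1 * 'i * d) = - ('i * 'i) * (a * b * c * d) by ring.
  by rewrite mul1r /= !phi1 !phii !phini !mul1r !addr0 !i4 !ni4 e4 -expr2 sqrCi opprK mul1r.
- apply: (@forms_symmetry _ duodecic _ (scale_forms (nth q0 [:: q1; q1; qni; qi])) q1 1) => // x.
  have e4 (a b c d : K) : a * b * ('i * c) * (-1 * 'i * d) = - ('i * 'i) * (a * b * c * d) by ring.
  by rewrite mul1r /= !phi1 !phii !phini !mul1r !addr0 !i4 !ni4 e4 -expr2 sqrCi opprK mul1r.
Qed.

Lemma duodecic_toric n1 n2 n3 : toric_critical_D4 (forms_mx K (tilt n1 n2 n3)) (pden duodecic).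
Proof.
apply: toric_critical_tilt => y0 y1 y2 n0 x h0 h1 h2; exfalso.
have pow0 (y : K) : (y ^+ 4 != 0) = (y != 0) by rewrite expf_eq0.
have n4 : 4%:R != 0 :> K by rewrite pnatr_eq0.
apply: (@cubic_critical (y0 ^+ 4) (y1 ^+ 4) (y2 ^+ 4)); first by rewrite !pow0.
- apply: (mulfI n4); rewrite mulr0 -[RHS]h0 /x /tuple4 /=; ring.
- apply: (mulfI n4); rewrite mulr0 -[RHS]h1 /x /tuple4 /=; ring.
- apply: (mulfI n4); rewrite mulr0 -[RHS]h2 /x /tuple4 /=; ring.
Qed.

(** Ten points modulo the 16 combinations of the two diagonal generators of order 4. *)
Definition duodecic_points := orbit_points duodecic_gen [:: q1; q1; q1; qint (-3)%BZ]
  [:: (0, [:: 1]); (1, [:: 3; 2]); (2, [:: 4; 2]); (2, [:: 1]); (2, [:: 0]); (3, [:: 1]); (3, [:: 1]); (4, [:: 3; 2]); (4, [:: 0])]%N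
  4 (fun=> [:: 3; 4]%N).

Lemma duodecic_points_distinct : distinct_codes 157 12 129 (tilt_inv (-4)%BZ 0%BZ 0%BZ) 160 duodecic_points.
Proof. by vm_compute. Qed.

Lemma duodecic_points_D4 x : x \in duodecic_points -> D4pt (pden duodecic) (vec K x).
Proof.
apply: orbit_points_D4.
  by apply: duodecic_node; rewrite !mxE /= ?phi0 ?phi1 ?phi_int.
move=> j; apply: preserves_forms_symmetry; last exact: duodecic_symmetry.
by case: j => [|[|[|[|[|j]]]]] //; rewrite /duodecic_gen nth_default.
Qed.
End Duodecic.

Theorem mu_D4_duodecic (R : realType) k : (1 <= k)%N -> (((160 * k ^ 3)%N%:R)%:E <= mu_D4 R (12 * k)%N)%E.
Proof.
have nz : q1 <> q0 by [].
have [v [hv v0 vinj]] := @distinct_codesP (Cplx R) 157 12 129 1 106 (tilt_inv (-4)%BZ 0%BZ 0%BZ)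
  (tilt (-4)%BZ 0%BZ 0%BZ) q1 160 _ erefl erefl erefl erefl erefl nz duodecic_points_distinct.
apply: (@mu_D4_power_cover _ (pden (duodecic (Cplx R))) _ 12 160 v isT _ _ _ _ v0 vinj).
- exact: pden_homog.
- exact: (@forms_unit _ _ (tilt_inv (-4)%BZ 0%BZ 0%BZ) q1).
- exact: duodecic_toric.
- by move=> j; have [x hx ->] := hv j; exact: duodecic_points_D4.
Qed.

(** * The surface of degree 24 *)

Section Degree24.
Variable K : numClosedFieldType.
Local Notation X n := (PX K (idx n)).
Local Notation pexp := (pexp K 4).

(* The invariants of degree 6, 9, 12 of the Hessian group, as functions of the cubes of the coordinates. *)
Definition inv6 (x y z : K) := (x + y + z) ^+ 2 - 12%:R * (x * y + y * z + z * x).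
Definition inv9 (x y z : K) := (x - y) * (y - z) * (z - x).
Definition inv12 (x y z : K) := (x + y + z) * ((x + y + z) ^+ 3 + 216%:R * (x * y * z)).

(* An invariant of the complex reflection group G_32; t is the cube of x_4, tc and c2 stand for
   t inv9 and inv9^2, the only combinations of the odd quantities t and inv9 that occur. *)
Definition form24_inv (t2 tc c2 p r : K) : K :=
  288%:R * t2 ^+ 4 - (1%:R ,, 728) * t2 ^+ 3 * p + (645%:R ,, 120) * t2 ^+ 2 * tc + (121%:R ,, 488) * t2 ^+ 2 * p ^+ 2
  - (125%:R ,, 520) * t2 ^+ 2 * r + ((2%:R ,, 931) ,, 840) * t2 * tc * p + (27%:R ,, 312) * t2 * p ^+ 3 - (29%:R ,, 40) * t2 * p * r
  + ((2%:R ,, 404) ,, 800) * t2 * c2 + (24%:R ,, 720) * tc * p ^+ 2 - (42%:R * 1000%:R) * tc * r - 67%:R * p ^+ 4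
  + 230%:R * p ^+ 2 * r + 125%:R * r ^+ 2 + (28%:R ,, 800) * c2 * p.

Definition form24_cubes (x y z t : K) : K :=
  form24_inv (t ^+ 2) (t * inv9 x y z) (inv9 x y z ^+ 2) (inv6 x y z) (inv12 x y z).

Definition pinv6 (x y z : pexp) := (x %+ y %+ z) %^ 2 %+ (- (12%:R))%:K %* (x %* y %+ y %* z %+ z %* x).
Definition pinv9 (x y z : pexp) := (x %+ (- (1%:R))%:K %* y) %* (y %+ (- (1%:R))%:K %* z) %* (z %+ (- (1%:R))%:K %* x).
Definition pinv12 (x y z : pexp) := (x %+ y %+ z) %* ((x %+ y %+ z) %^ 3 %+ (216%:R)%:K %* (x %* y %* z)).

Definition form24_tail (p c r : pexp) : pexp :=
  (- (67%:R))%:K %* p %^ 4 %+ (230%:R)%:K %* (p %^ 2 %* r) %+ (125%:R)%:K %* r %^ 2 %+ (28%:R ,, 800)%:K %* (p %* c %^ 2).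

(** The form is x_4^3 times this quotient plus [form24_tail], its restriction to x_4 = 0. At points
    of that plane the quotient is the coefficient of the second cube in the normal form. *)
Definition form24_quot (t p c r : pexp) : pexp :=
  (288%:R)%:K %* t %^ 7 %+ (- (1%:R ,, 728))%:K %* (t %^ 5 %* p) %+ (645%:R ,, 120)%:K %* (t %^ 4 %* c)
  %+ (121%:R ,, 488)%:K %* (t %^ 3 %* p %^ 2) %+ (- (125%:R ,, 520))%:K %* (t %^ 3 %* r) %+ ((2%:R ,, 931) ,, 840)%:K %* (t %^ 2 %* (p %* c))
  %+ (27%:R ,, 312)%:K %* (t %* p %^ 3) %+ (- (29%:R ,, 40))%:K %* (t %* (p %* r)) %+ ((2%:R ,, 404) ,, 800)%:K %* (t %* c %^ 2)
  %+ (24%:R ,, 720)%:K %* (c %* p %^ 2) %+ (- (42%:R * 1000%:R))%:K %* (c %* r).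

Definition form24 : pexp :=
  let y n := X n %^ 3 in
  let p := pinv6 (y 0) (y 1) (y 2) in
  let c := pinv9 (y 0) (y 1) (y 2) in
  let r := pinv12 (y 0) (y 1) (y 2) in
  y 3 %* form24_quot (y 3) p c r %+ form24_tail p c r.

Lemma peval_inv (x y z : pexp) (v : 'I_4 -> K) :
  [/\ peval v (pinv6 x y z) = inv6 (peval v x) (peval v y) (peval v z),
      peval v (pinv9 x y z) = inv9 (peval v x) (peval v y) (peval v z) &
      peval v (pinv12 x y z) = inv12 (peval v x) (peval v y) (peval v z)].
Proof. by rewrite /inv6 /inv9 /inv12; split=> /=; ring. Qed.

Lemma peval_form24 (x : 'I_4 -> K) :
  peval x form24 = form24_cubes (x (idx 0) ^+ 3) (x (idx 1) ^+ 3) (x (idx 2) ^+ 3) (x (idx 3) ^+ 3).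
Proof.
rewrite /form24 /form24_cubes /form24_inv; have [] := peval_inv (X 0 %^ 3) (X 1 %^ 3) (X 2 %^ 3) x.
cbn [peval]; move=> <- <- <-.
move: (pinv6 _ _ _) (pinv9 _ _ _) (pinv12 _ _ _) => p c r; rewrite /form24_tail /form24_quot; cbn [peval].
move: (peval x p) (peval x c) (peval x r) (x (idx 3)) => P C R T; ring.
Qed.

(* The first partial derivative, in the cubes of x_1, x_2, x_3, of the restriction to x_4 = 0;
   the restriction being invariant under cyclic permutations, it gives the others as well. *)
Definition grad24 (x y z : K) : K :=
  let e := x + y + z in let p := inv6 x y z in let c := inv9 x y z in let r := inv12 x y z in
  (- 268%:R * p ^+ 3 + 460%:R * p * r + (28%:R ,, 800) * c ^+ 2) * (2%:R * e - 12%:R * (y + z))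
  + (57%:R ,, 600) * p * c * ((y - z) * (y + z - 2%:R * x))
  + (230%:R * p ^+ 2 + 250%:R * r) * (4%:R * e ^+ 3 + 216%:R * (x * y * z) + 216%:R * e * (y * z)).

Lemma inv_cyclic x y z : [/\ inv6 y z x = inv6 x y z, inv9 y z x = inv9 x y z & inv12 y z x = inv12 x y z].
Proof. by rewrite /inv6 /inv9 /inv12; split; ring. Qed.

Lemma pdiff_form24 (v t : 'I_4 -> K) : v (idx 3) = 0 ->
  let x := v (idx 0) in let y := v (idx 1) in let z := v (idx 2) in
  pdiff v t form24 = 3%:R * x ^+ 2 * t (idx 0) * grad24 (x ^+ 3) (y ^+ 3) (z ^+ 3)
   + 3%:R * y ^+ 2 * t (idx 1) * grad24 (y ^+ 3) (z ^+ 3) (x ^+ 3)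
   + 3%:R * z ^+ 2 * t (idx 2) * grad24 (z ^+ 3) (x ^+ 3) (y ^+ 3).
Proof.
move=> v3 x y z; rewrite /form24 /form24_tail; cbn [pdiff peval]; rewrite v3.
set P := pinv6 _ _ _; set C := pinv9 _ _ _; set R := pinv12 _ _ _.
have [] := peval_inv (X 0 %^ 3) (X 1 %^ 3) (X 2 %^ 3) v; cbn [peval]; rewrite -/P -/C -/R -/x -/y -/z => -> -> ->.
have -> : pdiff v t P = 3%:R * x ^+ 2 * t (idx 0) * (2%:R * (x ^+ 3 + y ^+ 3 + z ^+ 3) - 12%:R * (y ^+ 3 + z ^+ 3))
  + 3%:R * y ^+ 2 * t (idx 1) * (2%:R * (x ^+ 3 + y ^+ 3 + z ^+ 3) - 12%:R * (z ^+ 3 + x ^+ 3))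
  + 3%:R * z ^+ 2 * t (idx 2) * (2%:R * (x ^+ 3 + y ^+ 3 + z ^+ 3) - 12%:R * (x ^+ 3 + y ^+ 3)).
  rewrite /P /pinv6 /= -/x -/y -/z; ring.
have -> : pdiff v t C = 3%:R * x ^+ 2 * t (idx 0) * ((y ^+ 3 - z ^+ 3) * (y ^+ 3 + z ^+ 3 - 2%:R * x ^+ 3))
  + 3%:R * y ^+ 2 * t (idx 1) * ((z ^+ 3 - x ^+ 3) * (z ^+ 3 + x ^+ 3 - 2%:R * y ^+ 3))
  + 3%:R * z ^+ 2 * t (idx 2) * ((x ^+ 3 - y ^+ 3) * (x ^+ 3 + y ^+ 3 - 2%:R * z ^+ 3)).
  rewrite /C /pinv9 /= -/x -/y -/z; ring.
have -> : pdiff v t R = 3%:R * x ^+ 2 * t (idx 0) * (4%:R * (x ^+ 3 + y ^+ 3 + z ^+ 3) ^+ 3 + 216%:R * (x ^+ 3 * y ^+ 3 * z ^+ 3) + 216%:R * (x ^+ 3 + y ^+ 3 + z ^+ 3) * (y ^+ 3 * z ^+ 3))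
  + 3%:R * y ^+ 2 * t (idx 1) * (4%:R * (x ^+ 3 + y ^+ 3 + z ^+ 3) ^+ 3 + 216%:R * (x ^+ 3 * y ^+ 3 * z ^+ 3) + 216%:R * (x ^+ 3 + y ^+ 3 + z ^+ 3) * (z ^+ 3 * x ^+ 3))
  + 3%:R * z ^+ 2 * t (idx 2) * (4%:R * (x ^+ 3 + y ^+ 3 + z ^+ 3) ^+ 3 + 216%:R * (x ^+ 3 * y ^+ 3 * z ^+ 3) + 216%:R * (x ^+ 3 + y ^+ 3 + z ^+ 3) * (x ^+ 3 * y ^+ 3)).
  rewrite /R /pinv12 /= -/x -/y -/z; ring.
have [p1 c1 r1] := inv_cyclic (x ^+ 3) (y ^+ 3) (z ^+ 3).
have [p2 c2 r2] := inv_cyclic (y ^+ 3) (z ^+ 3) (x ^+ 3).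
rewrite /grad24 p2 c2 r2 p1 c1 r1.
move: (peval v (form24_quot _ _ _ _)) (pdiff v t (form24_quot _ _ _ _)) => q q'.
move: (inv6 _ _ _) (inv9 _ _ _) (inv12 _ _ _) => p c r.
move: (3%:R * x ^+ 2 * t (idx 0)) (3%:R * y ^+ 2 * t (idx 1)) (3%:R * z ^+ 2 * t (idx 2)).
move: (x ^+ 3) (y ^+ 3) (z ^+ 3) => a b d s0 s1 s2; rewrite /=; ring.
Qed.

(** On the line x_3 = x_4 = 0 the form is U (a^2 + b^2)^2, with a, b the cubes of x_1, x_2. As x_3
    and x_4 occur only through their cubes, the rest is A x_3^3 + Q x_4^3, already diagonal. [A] is
    assembled from the divided differences p1, c1, r1 of the three invariants. *)
Lemma form24_node (v : 'rV[K]_4) : let x i := v ord0 (idx i) in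
  x 2 = 0 -> x 3 = 0 -> x 0 != 0 -> (x 0 ^+ 3) ^+ 2 + (x 1 ^+ 3) ^+ 2 = 0 -> D4pt (pden form24) v.
Proof.
move=> x x2 x3 x0 hx.
pose a := X 0 %^ 3; pose b := X 1 %^ 3; pose d := X 2 %^ 3; pose t := X 3 %^ 3.
pose e := a %+ b.
pose p := pinv6 a b d; pose c := pinv9 a b d; pose r := pinv12 a b d.
pose p0 := e %^ 2 %+ (- (12%:R))%:K %* (a %* b).
pose p1 := d %+ (- (10%:R))%:K %* e.
pose r0 := e %^ 4.
pose r1 := (4%:R)%:K %* e %^ 3 %+ (6%:R)%:K %* (e %^ 2 %* d) %+ (4%:R)%:K %* (e %* d %^ 2) %+ d %^ 3
  %+ (216%:R)%:K %* (a %* b %* (e %+ d)).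
pose c0 := (- (1%:R))%:K %* ((a %+ (- (1%:R))%:K %* b) %* (a %* b)).
pose c1 := (a %+ (- (1%:R))%:K %* b) %* (e %+ (- (1%:R))%:K %* d).
pose A := (- (67%:R))%:K %* (p1 %* (p %+ p0) %* (p %^ 2 %+ p0 %^ 2))
  %+ (230%:R)%:K %* (p1 %* (p %+ p0) %* r %+ p0 %^ 2 %* r1) %+ (125%:R)%:K %* (r1 %* (r %+ r0))
  %+ (28%:R ,, 800)%:K %* (p1 %* c %^ 2 %+ p0 %* c1 %* (c %+ c0)).
pose z := a %^ 2 %+ b %^ 2.
pose U := (288%:R)%:K %* (a %^ 4 %+ (- (8%:R))%:K %* (a %^ 2 %* b %^ 2) %+ b %^ 4).
apply: (@D4pt_pexp _ form24 (X 2) (X 3) z U 0%:K 0%:K 0%:K A 0%:K 0%:K (form24_quot t p c r) v).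
- move=> y; rewrite /form24 -/a -/b -/d -/t -/p -/c -/r.
  have hp : peval y p = peval y p0 + peval y d * peval y p1.
    rewrite /p /p0 /p1 /pinv6 /e; cbn [peval]; move: (peval y a) (peval y b) (peval y d) => *; ring.
  have hc : peval y c = peval y c0 + peval y d * peval y c1.
    rewrite /c /c0 /c1 /pinv9 /e; cbn [peval]; move: (peval y a) (peval y b) (peval y d) => *; ring.
  have hr : peval y r = peval y r0 + peval y d * peval y r1.
    rewrite /r /r0 /r1 /pinv12 /e; cbn [peval]; move: (peval y a) (peval y b) (peval y d) => *; ring.
  have h0 : (- (67%:R)) * peval y p0 ^+ 4 + 230%:R * (peval y p0 ^+ 2 * peval y r0) + 125%:R * peval y r0 ^+ 2
      + (28%:R ,, 800) * (peval y p0 * peval y c0 ^+ 2) = peval y U * peval y z ^+ 2.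
    rewrite /p0 /r0 /c0 /U /z /e; cbn [peval]; move: (peval y a) (peval y b) => *; ring.
  have hd : peval y d = y (idx 2) ^+ 3 by [].
  have htt : peval y t = y (idx 3) ^+ 3 by [].
  rewrite -h0 /form24_tail /A; cbn [peval]; rewrite hp hc hr htt hd.
  move: (peval y p0) (peval y p1) (peval y c0) (peval y c1) (peval y r0) (peval y r1) => P0 P1 C0 C1 R0 R1.
  move: (peval y (form24_quot _ _ _ _)) (peval y U) (peval y z) (y (idx 2)) (y (idx 3)) => q U0 z0 d0 t0; ring.
- by rewrite /=; split => //; rewrite -/(x 0) -/(x 1).
- set w := v ord0; have [a0 a0E] : exists a0, x 0 ^+ 3 = a0 by exists (x 0 ^+ 3).
  have [b0 b0E] : exists b0, x 1 ^+ 3 = b0 by exists (x 1 ^+ 3).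
  rewrite a0E b0E in hx.
  have wa : peval w a = a0 by exact: a0E.
  have wb : peval w b = b0 by exact: b0E.
  have wd : peval w d = 0 by rewrite -[LHS]/(x 2 ^+ 3) x2 expr0n.
  have wt : peval w t = 0 by rewrite -[LHS]/(x 3 ^+ 3) x3 expr0n.
  have a00 : a0 != 0 by rewrite -a0E expf_neq0.
  have b2 : b0 ^+ 2 = - a0 ^+ 2 by apply/eqP; rewrite -addr_eq0 addrC hx.
  have b00 : b0 != 0 by rewrite -sqrf_eq0 b2 oppr_eq0 expf_eq0.
  have n2 n : n.+1%:R != 0 :> K by rewrite pnatr_eq0.
  have ab0 : 2%:R * a0 * b0 != 0 by rewrite mulf_neq0 // mulf_neq0 // (n2 1%N).
  have e0 : a0 + b0 != 0.
    rewrite -sqrf_eq0 sqrrD b2 [Y in Y != 0](_ : _ = 2%:R * a0 * b0) //; ring.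
  have d0 : a0 - b0 != 0.
    by rewrite -sqrf_eq0 sqrrB b2 [Y in Y != 0](_ : _ = - (2%:R * a0 * b0)); [rewrite oppr_eq0|ring].
  have wp : inv6 a0 b0 0 = - 10%:R * (a0 * b0).
    have -> : inv6 a0 b0 0 = a0 ^+ 2 + b0 ^+ 2 - 10%:R * (a0 * b0) by rewrite /inv6; ring.
    by rewrite b2; ring.
  have wr : inv12 a0 b0 0 = - 4%:R * a0 ^+ 4.
    have -> : inv12 a0 b0 0 = (a0 ^+ 2 + b0 ^+ 2 + 2%:R * a0 * b0) ^+ 2 by rewrite /inv12; ring.
    rewrite b2; have -> : (a0 ^+ 2 + - a0 ^+ 2 + 2%:R * a0 * b0) ^+ 2 = 4%:R * a0 ^+ 2 * b0 ^+ 2 by ring.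
    by rewrite b2; ring.
  have wc : inv9 a0 b0 0 = - (a0 - b0) * (a0 * b0) by rewrite /inv9; ring.
  have [hp hc hr] := peval_inv a b d w.
  rewrite -/p -/c -/r wa wb wd wp wc wr in hp hc hr.
  have nz m k : m.+1%:R * 1000%:R + k%:R != 0 :> K by rewrite -natrM -natrD pnatr_eq0 addn_eq0 muln_eq0.
  have h28 := nz 1%N 880%N.
  have h23 : ((2%:R ,, 304) * 1000%:R) != 0 :> K by exact: (mulf_neq0 (nz 1%N 304%N) (n2 999%N)).
  split.
  + have -> : peval w U = (2%:R ,, 880) * a0 ^+ 4.
      rewrite /U; cbn [peval]; rewrite wa wb.
      have -> : b0 ^+ 4 = (b0 ^+ 2) ^+ 2 by rewrite -exprM.
      by rewrite b2; ring.
    exact: (mulf_neq0 h28 (expf_neq0 4 a00)).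
  + have -> : peval w A = - (((2%:R ,, 304) * 1000%:R) * ((a0 + b0) * (a0 ^+ 5 * b0))).
      rewrite /A /p0 /p1 /r0 /r1 /c0 /c1 /e; cbn [peval]; rewrite hp hc hr wa wb wd.
      have e2 : (a0 + b0) ^+ 2 = 2%:R * a0 * b0 by rewrite sqrrD b2; ring.
      have e3 : (a0 + b0) ^+ 3 = 2%:R * a0 * b0 * (a0 + b0) by rewrite exprSr e2.
      have e4 : (a0 + b0) ^+ 4 = - 4%:R * a0 ^+ 4.
        have -> : (a0 + b0) ^+ 4 = ((a0 + b0) ^+ 2) ^+ 2 by rewrite -exprM.
        by rewrite e2 !exprMn b2; ring.
      have c2 : (- (a0 - b0) * (a0 * b0)) ^+ 2 = 2%:R * a0 ^+ 5 * b0.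
        have -> : (- (a0 - b0) * (a0 * b0)) ^+ 2 = (a0 ^+ 2 + b0 ^+ 2 - 2%:R * a0 * b0) * (a0 ^+ 2 * b0 ^+ 2) by ring.
        by rewrite b2; ring.
      have q2 : (- 10%:R * (a0 * b0)) ^+ 2 = - 100%:R * a0 ^+ 4.
        by rewrite !exprMn b2; ring.
      have q0 : (2%:R * a0 * b0 + (- (12%:R)) * (a0 * b0)) = - 10%:R * (a0 * b0) by ring.
      have c1E : (a0 + -1 * b0) * (a0 + b0 + -1 * 0) = 2%:R * a0 ^+ 2.
        have -> : (a0 + -1 * b0) * (a0 + b0 + -1 * 0) = a0 ^+ 2 - b0 ^+ 2 by ring.
        by rewrite b2; ring.
      rewrite c2 c1E e4 e3 e2 q0 q2.
      transitivity (- (((2%:R ,, 304) * 1000%:R) * ((a0 + b0) * (a0 ^+ 5 * b0))) - ((1%:R ,, 152) * 1000%:R) * a0 ^+ 4 * b0 * (a0 ^+ 2 + b0 ^+ 2)); first by ring.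
      by rewrite b2; ring.
    rewrite oppr_eq0; exact: (mulf_neq0 h23 (mulf_neq0 e0 (mulf_neq0 (expf_neq0 5 a00) b00))).
  have -> : peval w (form24_quot t p c r) = ((2%:R ,, 304) * 1000%:R) * ((a0 - b0) * (a0 * b0) * a0 ^+ 4).
    rewrite /form24_quot; cbn [peval]; rewrite wt hp hc hr.
    have -> : (- 10%:R * (a0 * b0)) ^+ 2 = - 100%:R * a0 ^+ 4 by rewrite !exprMn b2; ring.
    ring.
  exact: (mulf_neq0 h23 (mulf_neq0 (mulf_neq0 d0 (mulf_neq0 a00 b00)) (expf_neq0 4 a00))).
- by [].
- by [].
move=> s /= h2 h3; rewrite -/(x 0) -/(x 1) => h.
exists (s (idx 0) / x 0); apply: ord4; rewrite -/(x 0) -/(x 1) -/(x 2) -/(x 3) ?x2 ?x3 ?mulr0 //.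
  by rewrite mulfVK.
have n6 : 6%:R != 0 :> K by rewrite pnatr_eq0.
have x06 : x 0 ^+ 6 != 0 by rewrite expf_neq0.
apply: (mulfI x06); apply: (mulfI n6).
have y6 : x 1 ^+ 6 = - x 0 ^+ 6 by apply/eqP; rewrite -addr_eq0 addrC; apply/eqP; rewrite -[RHS]hx; ring.
transitivity (6%:R * (x 0 ^+ 5 * s (idx 0) * x 1)); last by field.
transitivity (6%:R * (- x 1 ^+ 6 * s (idx 1))); first by rewrite y6 opprK.
apply/eqP; rewrite -subr_eq0; apply/eqP; rewrite -[RHS](mulr0 (- x 1)) -h; ring.
Qed.

(** Cramer's rule: in the cubes of the coordinates, the Jacobian determinant of the invariants of
    degree 6, 9, 12 is -96 (e^3 - 27 x y z)^2. Its zeros are the nine lines of [crit24_lines]. *)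
Lemma jacobian24 (x y z : K) : let e := x + y + z in
  let px a b := 2%:R * e - 12%:R * (a + b) in
  let cx a b c := (b - c) * (b + c - 2%:R * a) in
  let rx a b := 4%:R * e ^+ 3 + 216%:R * (x * y * z) + 216%:R * e * (a * b) in
  forall u v w : K,
  u * px y z + v * cx x y z + w * rx y z = 0 -> u * px z x + v * cx y z x + w * rx z x = 0 ->
  u * px x y + v * cx z x y + w * rx x y = 0 -> e ^+ 3 != 27%:R * (x * y * z) -> [/\ u = 0, v = 0 & w = 0].
Proof.
move=> e px cx rx u v w h1 h2 h3 J0.
have J2 : 96%:R * (e ^+ 3 - 27%:R * (x * y * z)) ^+ 2 != 0.
  by rewrite mulf_neq0 ?pnatr_eq0 // expf_eq0 /= subr_eq0.
have E : 96%:R * (e ^+ 3 - 27%:R * (x * y * z)) ^+ 2 =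
  - (px y z * (cx y z x * rx x y - cx z x y * rx z x) - px z x * (cx x y z * rx x y - cx z x y * rx y z)
  + px x y * (cx x y z * rx z x - cx y z x * rx y z)).
  rewrite /px /cx /rx /e; ring.
move: E h1 h2 h3; move: (px y z) (px z x) (px x y) (cx x y z) (cx y z x) (cx z x y) (rx y z) (rx z x) (rx x y).
move=> p1 p2 p3 c1 c2 c3 r1 r2 r3 E h1 h2 h3; rewrite E in J2.
split; apply: (mulIf J2); rewrite mul0r.
- transitivity (- ((u * p1 + v * c1 + w * r1) * (c2 * r3 - c3 * r2) - (u * p2 + v * c2 + w * r2) * (c1 * r3 - c3 * r1)
    + (u * p3 + v * c3 + w * r3) * (c1 * r2 - c2 * r1))); first by ring.
  by rewrite h1 h2 h3; ring.
- transitivity ((u * p1 + v * c1 + w * r1) * (p2 * r3 - p3 * r2) - (u * p2 + v * c2 + w * r2) * (p1 * r3 - p3 * r1)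
    + (u * p3 + v * c3 + w * r3) * (p1 * r2 - p2 * r1)); first by ring.
  by rewrite h1 h2 h3; ring.
- transitivity (- ((u * p1 + v * c1 + w * r1) * (p2 * c3 - p3 * c2) - (u * p2 + v * c2 + w * r2) * (p1 * c3 - p3 * c1)
    + (u * p3 + v * c3 + w * r3) * (p1 * c2 - p2 * c1))); first by ring.
  by rewrite h1 h2 h3; ring.
Qed.

Lemma mulr_eq0l (a b : K) : a != 0 -> a * b = 0 -> b = 0.
Proof. by move=> a0 /eqP; rewrite mulf_eq0 (negPf a0) => /eqP. Qed.

Lemma expr_eq0 (a : K) n : a ^+ n.+1 = 0 -> a = 0.
Proof. by move=> /eqP; rewrite expf_eq0 => /eqP. Qed.

Lemma nat_neq0 n : n.+1%:R != 0 :> K.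
Proof. by rewrite pnatr_eq0. Qed.

Lemma nat1000_neq0 m k : m.+1%:R * 1000%:R + k%:R != 0 :> K.
Proof. by rewrite -natrM -natrD pnatr_eq0 addn_eq0 muln_eq0. Qed.

Lemma digit_gt0 (c : K) n k : 0 < c -> 0 < c * n.+1%:R + k%:R.
Proof. by move=> c0; apply: ltr_wpDr; [exact: ler0n|apply: mulr_gt0 => //; rewrite ltr0n]. Qed.

(** The vanishing of [inv9] makes two variables equal, and the other two invariants become binary
    forms without a common zero. *)
Lemma inv_eq0 (x y z : K) : inv6 x y z = 0 -> inv9 x y z = 0 -> inv12 x y z = 0 ->
  [/\ x = 0, y = 0 & z = 0].
Proof.
have two (a c : K) : inv6 a a c = 0 -> inv12 a a c = 0 -> a = 0 /\ c = 0.
  move=> hp hr.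
  have {}hp : c ^+ 2 - 20%:R * a * c - 8%:R * a ^+ 2 = 0 by rewrite -hp /inv6; ring.
  have c0 : a = 0 -> a = 0 /\ c = 0.
    by move=> a0; split => //; apply: (@expr_eq0 c 1); rewrite -hp a0; ring.
  have : (2%:R * a + c) * ((2%:R * a + c) ^+ 3 + 216%:R * a ^+ 2 * c) = 0 by rewrite -hr /inv12; ring.
  move=> /eqP; rewrite mulf_eq0 => /orP[/eqP h|/eqP h].
    apply: c0; apply: (@expr_eq0 a 1); apply: (mulr_eq0l (nat_neq0 35)).
    have e : c = - (2%:R * a) by apply/eqP; rewrite -addr_eq0 addrC h.
    by rewrite -hp e; ring.
  (* Remainder of the cubic modulo the quadratic form, with quotient c + 26 a. *)
  have : 108%:R * (a ^+ 2 * (2%:R * a + 7%:R * c)) = 0.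
    transitivity ((2%:R * a + c) ^+ 3 + 216%:R * a ^+ 2 * c - (c + 26%:R * a) * (c ^+ 2 - 20%:R * a * c - 8%:R * a ^+ 2)); first by ring.
    by rewrite h hp; ring.
  move/(mulr_eq0l (nat_neq0 107))/eqP; rewrite mulf_eq0 expf_eq0 /= => /orP[/eqP /c0 //|/eqP k].
  have cz : c = 0.
    apply: (@expr_eq0 c 1); apply: (mulr_eq0l (nat_neq0 107)).
    transitivity (- (4%:R * (c ^+ 2 - 20%:R * a * c - 8%:R * a ^+ 2)) - (16%:R * a - 16%:R * c) * (2%:R * a + 7%:R * c)); first by ring.
    by rewrite hp k; ring.
  by split => //; apply: (mulr_eq0l (nat_neq0 1)); rewrite -k cz; ring.
move=> hp hc hr; have [p1 _ r1] := inv_cyclic x y z; have [p2 _ r2] := inv_cyclic y z x.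
move: hc => /eqP; rewrite /inv9 !mulf_eq0 !subr_eq0 => /orP[/orP[]|] /eqP e.
- by rewrite e in hp hr *; have [||-> ->] := @two y z.
- by rewrite e in p1 r1 hp hr *; have [||-> ->] := @two z x; rewrite ?p1 ?r1.
- by rewrite e in p1 r1 p2 r2 hp hr *; have [||-> ->] := @two x y; rewrite ?p2 ?r2 ?p1 ?r1.
Qed.

(** Off the nine lines the gradients of the three invariants are independent. By the chain rule the
    partial derivatives of the form in p, c, r vanish, which forces p = c = r = 0. *)
Lemma grad24_eq0 (x y z : K) : grad24 x y z = 0 -> grad24 y z x = 0 -> grad24 z x y = 0 ->
  (x + y + z) ^+ 3 != 27%:R * (x * y * z) -> [/\ x = 0, y = 0 & z = 0].
Proof.
have [p1 c1 r1] := inv_cyclic x y z; have [p2 c2 r2] := inv_cyclic y z x.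
rewrite /grad24 p2 c2 r2 p1 c1 r1 => h1 h2 h3 J0.
set p := inv6 x y z in h1 h2 h3; set c := inv9 x y z in h1 h2 h3; set r := inv12 x y z in h1 h2 h3.
have [|||hu hv hw] := @jacobian24 x y z (- 268%:R * p ^+ 3 + 460%:R * p * r + (28%:R ,, 800) * c ^+ 2)
  ((57%:R ,, 600) * p * c) (230%:R * p ^+ 2 + 250%:R * r) _ _ _ J0.
- by rewrite -[RHS]h1; ring.
- by rewrite -[RHS]h2; ring.
- by rewrite -[RHS]h3; ring.
have {}hv : p * c = 0.
  apply: (mulr_eq0l (nat1000_neq0 56 600)); rewrite -[RHS]hv; ring.
have p0 : p = 0.
  move: hv => /eqP; rewrite mulf_eq0 => /orP[/eqP //|/eqP c0].
  apply: (@expr_eq0 p 2); apply: (mulr_eq0l (nat1000_neq0 16 280)).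
  transitivity (46%:R * p * (230%:R * p ^+ 2 + 250%:R * r) - 25%:R * (- 268%:R * p ^+ 3 + 460%:R * p * r + (28%:R ,, 800) * c ^+ 2)).
    by rewrite c0; ring.
  by rewrite hu hw; ring.
have r0 : r = 0 by apply: (mulr_eq0l (nat_neq0 249)); rewrite -[RHS]hw p0; ring.
apply: inv_eq0 => //.
apply: (@expr_eq0 _ 1); apply: (mulr_eq0l (nat1000_neq0 27 800)); rewrite -/c -[RHS]hu p0; ring.
Qed.

Definition grad_x (x y z : K) : K := 3%:R * x ^+ 2 * grad24 (x ^+ 3) (y ^+ 3) (z ^+ 3).

(** Up to a cyclic permutation these are the conditions on an edge of the triangle of
    [triangle_tilt], where y = -x. They become two cubics in A = x^6 and B = z^6 without a common
    zero. *)
Lemma boundary24 (a b : K) : let x := b - a in let y := a - b in let z := a + b in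
  a * (- grad_x x y z + grad_x y z x + grad_x z x y) = 0 ->
  b * (grad_x x y z - grad_x y z x + grad_x z x y) = 0 -> a = 0 /\ b = 0.
Proof.
move=> x y z h1 h2.
(* By Euler's identity the expression is 24 times the value of the form at (c, -c, c, 0), and the
   value at (1, -1, 1, 0) is -4492512. *)
have vertex (c : K) : c * (grad_x c (- c) c - grad_x (- c) c c + grad_x c c (- c)) = 0 -> c = 0.
  move=> h; apply: (@expr_eq0 c 23); apply: (mulr_eq0l (nat_neq0 23)).
  apply: (@mulr_eq0l ((4%:R ,, 492) ,, 512)).
    by apply: lt0r_neq0; do !apply: digit_gt0; rewrite ltr0n.
  by rewrite -[RHS]oppr0 -h /grad_x /grad24 /inv6 /inv9 /inv12; ring.
have [a0|a0] := eqVneq a 0.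
  split => //; apply: vertex; rewrite -[RHS]h2 /x /y /z a0 subr0 sub0r add0r //.
have [b0|b0] := eqVneq b 0.
  split => //; apply: vertex; rewrite -[RHS]h1 /x /y /z b0 subr0 sub0r addr0; ring.
exfalso; have {}h1 := mulr_eq0l a0 h1; have {}h2 := mulr_eq0l b0 h2.
have gz : grad_x z x y = 0.
  apply: (mulr_eq0l (nat_neq0 1)); transitivity (- grad_x x y z + grad_x y z x + grad_x z x y + (grad_x x y z - grad_x y z x + grad_x z x y)).
    by ring.
  by rewrite h1 h2 addr0.
have gxy : grad_x x y z - grad_x y z x = 0 by rewrite gz addr0 in h2.
have yx : y = - x by rewrite /x /y; ring.
rewrite yx in gz gxy; rewrite /grad_x in gz gxy.
set s := x ^+ 3; set u := z ^+ 3.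
have sN : (- x) ^+ 3 = - s by rewrite /s; ring.
rewrite sN -/s -/u in gz gxy.
pose A := s ^+ 2; pose B := u ^+ 2.
have hz : 2%:R * (1%:R ,, 152) * 3%:R * (z ^+ 2 * u * (B ^+ 3 + 36%:R * A * B ^+ 2 + (10%:R ,, 12) * A ^+ 2 * B - (8%:R ,, 912) * A ^+ 3)) = 0.
  by rewrite -[RHS]gz /A /B /grad24 /inv6 /inv9 /inv12; ring.
have hx : 2%:R * (4%:R ,, 608) * 3%:R * (x ^+ 2 * s * (3%:R * B ^+ 3 + (2%:R ,, 503) * A * B ^+ 2 - (6%:R ,, 684) * A ^+ 2 * B - 6%:R * A ^+ 3)) = 0.
  by rewrite -[RHS]gxy /A /B /grad24 /inv6 /inv9 /inv12 sqrrN; ring.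
have {}hz := mulr_eq0l (mulf_neq0 (mulf_neq0 (nat_neq0 1) (nat1000_neq0 0 152)) (nat_neq0 2)) hz.
have {}hx := mulr_eq0l (mulf_neq0 (mulf_neq0 (nat_neq0 1) (nat1000_neq0 3 608)) (nat_neq0 2)) hx.
have {}hz : z = 0 \/ B ^+ 3 + 36%:R * A * B ^+ 2 + (10%:R ,, 12) * A ^+ 2 * B - (8%:R ,, 912) * A ^+ 3 = 0.
  have [z0|z0] := eqVneq z 0; [by left|right].
  by apply: mulr_eq0l hz; rewrite /u mulf_neq0 ?expf_neq0.
have {}hx : x = 0 \/ 3%:R * B ^+ 3 + (2%:R ,, 503) * A * B ^+ 2 - (6%:R ,, 684) * A ^+ 2 * B - 6%:R * A ^+ 3 = 0.
  have [x0|x0] := eqVneq x 0; [by left|right].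
  by apply: mulr_eq0l hx; rewrite /s mulf_neq0 ?expf_neq0.
have As (n : nat) : A ^+ n.+1 = 0 -> x = 0 by move/expr_eq0/expr_eq0/expr_eq0.
have Bs (n : nat) : B ^+ n.+1 = 0 -> z = 0 by move/expr_eq0/expr_eq0/expr_eq0.
suff [x0 z0] : x = 0 /\ z = 0.
  move/eqP: a0; apply; apply: (mulr_eq0l (nat_neq0 1)).
  transitivity (z - x); first by rewrite /x /z; ring.
  by rewrite x0 z0 subrr.
case: hx => [x0|hx].
  have A0 : A = 0 by rewrite /A /s x0; ring.
  case: hz => [z0|]; first by split.
  by rewrite A0 => hz; split => //; apply: (Bs 2); rewrite -hz; ring.
case: hz => [z0|hz].
  have B0 : B = 0 by rewrite /B /u z0; ring.
  rewrite B0 in hx; split => //; apply: (As 2); apply: (mulr_eq0l (nat_neq0 5)).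
  by rewrite -[RHS]oppr0 -hx; ring.
(* A Bezout identity: the cofactors below combine the two cubics into a nonzero integer multiple of
   A^5. *)
have x0 : x = 0.
  apply: (As 4); apply: (@mulr_eq0l (((((9%:R ,, 889) ,, 207) * 1000%:R + 115%:R) * 1000%:R + 937%:R) * 1000%:R + 500%:R)).
    by apply: lt0r_neq0; do !apply: digit_gt0; rewrite ltr0n.
  transitivity (((- ((247%:R ,, 517) ,, 683)) * B ^+ 2 + (- (((9%:R ,, 128) ,, 259) * 1000%:R + 152%:R)) * A * B + (- ((((2%:R ,, 486) ,, 555) * 1000%:R + 547%:R) * 1000%:R + 562%:R)) * A ^+ 2)
       * (3%:R * B ^+ 3 + (2%:R ,, 503) * A * B ^+ 2 - (6%:R ,, 684) * A ^+ 2 * B - 6%:R * A ^+ 3)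
     + (((742%:R ,, 553) ,, 49) * B ^+ 2 + (((620%:R ,, 189) ,, 628) * 1000%:R + 241%:R) * A * B + (- ((((1%:R ,, 107) ,, 976) * 1000%:R + 636%:R) * 1000%:R + 294%:R)) * A ^+ 2)
       * (B ^+ 3 + 36%:R * A * B ^+ 2 + (10%:R ,, 12) * A ^+ 2 * B - (8%:R ,, 912) * A ^+ 3)); first by ring.
  by rewrite hx hz; ring.
split => //; apply: (Bs 2); rewrite -hz /A /s x0; ring.
Qed.

(** Both conditions contain the factor x^2 + y^2, which vanishes at the D4 points of the edge. The
    residual quartics are exchanged by swapping x and y, and their difference factors. *)
Lemma grad24_edge (x y : K) : x * (grad24 x y 0) = 0 -> y * grad24 y 0 x = 0 -> x ^+ 2 + y ^+ 2 = 0.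
Proof.
move=> h1 h2; apply/eqP; apply: contraT => s0.
have {}h1 : x * (2%:R * x ^+ 4 - 11%:R * x ^+ 2 * y ^+ 2 - 3%:R * y ^+ 4) = 0.
  have : ((1%:R ,, 152) * x) * ((x ^+ 2 + y ^+ 2) * (x * (2%:R * x ^+ 4 - 11%:R * x ^+ 2 * y ^+ 2 - 3%:R * y ^+ 4))) = 0.
    by rewrite -[RHS]h1 /grad24 /inv6 /inv9 /inv12; ring.
  have [-> _|x0] := eqVneq x 0; first by rewrite mul0r.
  by move/(mulr_eq0l (mulf_neq0 (nat1000_neq0 0 152) x0))/(mulr_eq0l s0).
have {}h2 : y * (2%:R * y ^+ 4 - 11%:R * x ^+ 2 * y ^+ 2 - 3%:R * x ^+ 4) = 0.
  have : ((1%:R ,, 152) * y) * ((x ^+ 2 + y ^+ 2) * (y * (2%:R * y ^+ 4 - 11%:R * x ^+ 2 * y ^+ 2 - 3%:R * x ^+ 4))) = 0.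
    by rewrite -[RHS]h2 /grad24 /inv6 /inv9 /inv12; ring.
  have [-> _|y0] := eqVneq y 0; first by rewrite mul0r.
  by move/(mulr_eq0l (mulf_neq0 (nat1000_neq0 0 152) y0))/(mulr_eq0l s0).
exfalso; move/eqP: s0; apply.
have [x0|x0] := eqVneq x 0.
  have -> : y = 0 by apply: (@expr_eq0 y 4); apply: (mulr_eq0l (nat_neq0 1)); rewrite -[RHS]h2 x0; ring.
  by rewrite x0; ring.
have [y0|y0] := eqVneq y 0.
  move/eqP: x0; case; apply: (@expr_eq0 x 4); apply: (mulr_eq0l (nat_neq0 1)); rewrite -[RHS]h1 y0; ring.
have {}h1 := mulr_eq0l x0 h1; have {}h2 := mulr_eq0l y0 h2.
have /eqP : 5%:R * ((x ^+ 2 + y ^+ 2) * (x ^+ 2 - y ^+ 2)) = 0.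
  by rewrite -[RHS](subr0 0) -{1}h1 -h2; ring.
rewrite mulf_eq0 (negPf (nat_neq0 4)) mulf_eq0 /= => /orP[/eqP //|/eqP d0].
exfalso; move/eqP: x0; apply; apply: (@expr_eq0 x 3); apply: (mulr_eq0l (nat_neq0 11)).
transitivity (- (2%:R * x ^+ 4 - 11%:R * x ^+ 2 * y ^+ 2 - 3%:R * y ^+ 4)
  + (x ^+ 2 - y ^+ 2) * (14%:R * x ^+ 2 + 3%:R * y ^+ 2)); first by ring.
by rewrite h1 d0; ring.
Qed.

Definition qtheta : quad := qadd qw (qmul qN1 qw2).

(** The Fourier matrix of Z/3 on three coordinates and t = w - w^2, a square root of -3, on the
    fourth: sqrt 3 times a unitary matrix. Hence the scalar 3 with its inverse and the factor 3^12
    on a form of degree 24. *)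
Definition fourier_forms (u v t : quad) : forms :=
  [:: [:: (q1, 0); (q1, 1); (q1, 2)]; [:: (q1, 0); (u, 1); (v, 2)]; [:: (q1, 0); (v, 1); (u, 2)]; [:: (t, 3)]]%N.

Definition signed_forms (s : seq (quad * nat)) : forms := [seq [:: c] | c <- s].

Definition form24_gen (j : nat) : forms := nth (perm_forms [:: 1; 2; 0; 3])
  [:: perm_forms [:: 1; 2; 0; 3];
      signed_forms [:: (q1, 1); (q1, 0); (q1, 2); (qN1, 3)]%N;
      signed_forms [:: (q1, 0); (qN1, 1); (q1, 3); (q1, 2)]%N;
      fourier_forms qw qw2 qtheta;
      scale_forms (nth q0 [:: q1; qw; q1; q1]);
      scale_forms (nth q0 [:: q1; q1; qw; q1]);
      scale_forms (nth q0 [:: q1; q1; q1; qw])] j.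

Definition form24_gen_inv (j : nat) : forms := nth (perm_forms [:: 2; 0; 1; 3])
  [:: perm_forms [:: 2; 0; 1; 3];
      signed_forms [:: (q1, 1); (q1, 0); (q1, 2); (qN1, 3)]%N;
      signed_forms [:: (q1, 0); (qN1, 1); (q1, 3); (q1, 2)]%N;
      fourier_forms qw2 qw (qmul qN1 qtheta);
      scale_forms (nth q0 [:: q1; qw2; q1; q1]);
      scale_forms (nth q0 [:: q1; q1; qw2; q1]);
      scale_forms (nth q0 [:: q1; q1; q1; qw2])] j.

Definition form24_scalar (j : nat) : quad := if j == 3 then qint 3 else q1.
Definition form24_factor (j : nat) : K := if j == 3 then 3%:R ^+ 12 else 1.

Lemma form24_inv_scale t2 tc c2 p r :
  form24_inv (- 27%:R * t2) (729%:R * tc) (- (19%:R ,, 683) * c2) (- 27%:R * p) (729%:R * r) =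
  3%:R ^+ 12 * form24_inv t2 tc c2 p r.
Proof. by rewrite /form24_inv; ring. Qed.

(** The hypotheses also admit w = w' = 1, so that one formula covers all three Fourier forms. The
    cubes have again the shape of resolvents, in t, 3 a1 and 3 a2. *)
Lemma fourier_cube (w w' x y z : K) : w * w' = 1 -> w * w = w' -> w' * w' = w ->
  let a1 := x ^+ 2 * y + y ^+ 2 * z + z ^+ 2 * x in let a2 := x ^+ 2 * z + y ^+ 2 * x + z ^+ 2 * y in
  (x + w * y + w' * z) ^+ 3 = (x ^+ 3 + y ^+ 3 + z ^+ 3 + 6%:R * (x * y * z)) + w' * (3%:R * a2) + w * (3%:R * a1).
Proof.
move=> p ww ww' a1 a2; have p' : w' * w = 1 by rewrite mulrC.
have -> : (x + w * y + w' * z) ^+ 3 = x ^+ 3 + (w * w * w) * y ^+ 3 + (w' * w' * w') * z ^+ 3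
  + 6%:R * (w * w') * (x * y * z) + 3%:R * (w * (x ^+ 2 * y) + w * (w * w') * (y ^+ 2 * z) + (w' * w') * (z ^+ 2 * x))
  + 3%:R * (w' * (x ^+ 2 * z) + (w * w) * (y ^+ 2 * x) + w' * (w * w') * (z ^+ 2 * y)) by ring.
rewrite ww ww' p p' /a1 /a2; ring.
Qed.

Lemma form24_invariant j (x : 'I_4 -> K) :
  peval (fun i : 'I_4 => lform (nth [::] (form24_gen j) i) x) form24 = form24_factor j * peval x form24.
Proof.
have cyc y : peval (fun i : 'I_4 => lform (nth [::] (perm_forms [:: 1; 2; 0; 3]) i) y) form24 = peval y form24.
  rewrite !peval_form24 /= !phi1 !mul1r !addr0 /form24_cubes.
  by have [-> -> ->] := inv_cyclic (y (idx 0) ^+ 3) (y (idx 1) ^+ 3) (y (idx 2) ^+ 3).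
have [lt|ge] := ltnP j 7; last first.
  rewrite /form24_gen /form24_factor nth_default // cyc.
  by case: eqP ge => [->|_] // _; rewrite mul1r.
have [ws wp] := omega_conj K; set w := omega K in ws wp; set w' := w ^+ 2 in ws wp.
have ww : w * w = w' by rewrite -expr2.
have ww' : w' * w' = w.
  have -> : w' * w' = w * (w * w') by rewrite /w'; ring.
  by rewrite wp mulr1.
have w3 (y : K) : (w * y) ^+ 3 = y ^+ 3.
  by rewrite exprMn exprS -/w' wp mul1r.
have cubeN (y : K) : (-1 * y) ^+ 3 = - y ^+ 3 by ring.
case: j lt => [|[|[|[|[|[|[|j]]]]]]] // _; rewrite /form24_gen /form24_factor.
- by rewrite cyc mul1r.
- rewrite mul1r !peval_form24 /= !phi1 !phiN1 !mul1r !addr0 /form24_cubes cubeN.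
  move: (x (idx 0) ^+ 3) (x (idx 1) ^+ 3) (x (idx 2) ^+ 3) (x (idx 3) ^+ 3) => a b c d.
  have -> : inv6 b a c = inv6 a b c by rewrite /inv6; ring.
  have -> : inv9 b a c = - inv9 a b c by rewrite /inv9; ring.
  have -> : inv12 b a c = inv12 a b c by rewrite /inv12; ring.
  by rewrite !sqrrN mulrNN.
- rewrite mul1r !peval_form24 /= !phi1 !phiN1 !mul1r !addr0 cubeN.
  move: (x (idx 0) ^+ 3) (x (idx 1) ^+ 3) (x (idx 2) ^+ 3) (x (idx 3) ^+ 3) => A B C D.
  by rewrite /form24_cubes /form24_inv /inv6 /inv9 /inv12; ring.
- rewrite !peval_form24 /= !phi1 phiw phiw2 -/w -/w' !mul1r !addr0.
  have th : phi K qtheta = w - w' by rewrite phiD phiM phiN1 phiw phiw2 mulN1r.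
  have th2 : (w - w') ^+ 2 = - 3%:R.
    have -> : (w - w') ^+ 2 = (w + w') ^+ 2 - 4%:R * (w * w') by ring.
    by rewrite ws wp; ring.
  rewrite th; move: (x (idx 0)) (x (idx 1)) (x (idx 2)) (x (idx 3)) => a b c d.
  (* The second and third cubes are conjugate resolvents Y and Z; the invariants are evaluated
     through Y + Z, Y Z and Y - Z alone. *)
  rewrite !addrA (fourier_cube a b c wp ww ww').
  have -> : (a + w' * b + w * c) ^+ 3 = (a + w * c + w' * b) ^+ 3 by rewrite addrAC.
  rewrite (fourier_cube a c b wp ww ww').
  have -> : (a + b + c) ^+ 3 = (a + 1 * b + 1 * c) ^+ 3 by rewrite !mul1r.
  rewrite (@fourier_cube 1 1) ?mul1r //.
  set a1 := a ^+ 2 * b + b ^+ 2 * c + c ^+ 2 * a; set a2 := a ^+ 2 * c + b ^+ 2 * a + c ^+ 2 * b.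
  have -> : a ^+ 2 * c + c ^+ 2 * b + b ^+ 2 * a = a2 by rewrite /a2; ring.
  have -> : a ^+ 2 * b + c ^+ 2 * a + b ^+ 2 * c = a1 by rewrite /a1; ring.
  set t := a ^+ 3 + b ^+ 3 + c ^+ 3 + 6%:R * (a * b * c).
  have -> : a ^+ 3 + c ^+ 3 + b ^+ 3 + 6%:R * (a * c * b) = t by rewrite /t; ring.
  have [hs hp hd] := resolvent_sum_prod t (3%:R * a2) (3%:R * a1) ws wp.
  have -> : t + w' * (3%:R * a1) + w * (3%:R * a2) = t + w * (3%:R * a2) + w' * (3%:R * a1) by rewrite addrAC.
  move: (t + w' * (3%:R * a2) + w * (3%:R * a1)) (t + w * (3%:R * a2) + w' * (3%:R * a1)) hs hp hd => Y Z hs hp hd.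
  rewrite -form24_inv_scale /form24_cubes.
  have e9 : inv9 (t + 3%:R * a2 + 3%:R * a1) Y Z = 81%:R * (w - w') * inv9 (a ^+ 3) (b ^+ 3) (c ^+ 3).
    transitivity (- ((t + 3%:R * a2 + 3%:R * a1) ^+ 2 - (t + 3%:R * a2 + 3%:R * a1) * (Y + Z) + Y * Z) * (Y - Z)).
      by rewrite /inv9; ring.
    by rewrite hs hp hd /inv9 /t /a1 /a2; ring.
  have fcong t2 tc c2 p r t2' tc' c2' p' r' : t2 = t2' -> tc = tc' -> c2 = c2' -> p = p' -> r = r' ->
    form24_inv t2 tc c2 p r = form24_inv t2' tc' c2' p' r' by move=> -> -> -> -> ->.
  apply: fcong.
  + have -> : (((w - w') * d) ^+ 3) ^+ 2 = ((w - w') ^+ 2) ^+ 3 * (d ^+ 3) ^+ 2 by ring.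
    by rewrite th2; ring.
  + have -> : ((w - w') * d) ^+ 3 * inv9 (t + 3%:R * a2 + 3%:R * a1) Y Z =
      ((w - w') * d) ^+ 3 * (81%:R * (w - w') * inv9 (a ^+ 3) (b ^+ 3) (c ^+ 3)) by rewrite e9.
    have -> : ((w - w') * d) ^+ 3 * (81%:R * (w - w') * inv9 (a ^+ 3) (b ^+ 3) (c ^+ 3)) =
      81%:R * ((w - w') ^+ 2) ^+ 2 * (d ^+ 3 * inv9 (a ^+ 3) (b ^+ 3) (c ^+ 3)) by ring.
    by rewrite th2; ring.
  + rewrite e9; have -> : (81%:R * (w - w') * inv9 (a ^+ 3) (b ^+ 3) (c ^+ 3)) ^+ 2 =
      81%:R ^+ 2 * (w - w') ^+ 2 * inv9 (a ^+ 3) (b ^+ 3) (c ^+ 3) ^+ 2 by ring.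
    by rewrite th2; ring.
  + transitivity (((t + 3%:R * a2 + 3%:R * a1) + (Y + Z)) ^+ 2 - 12%:R * ((t + 3%:R * a2 + 3%:R * a1) * (Y + Z) + Y * Z)).
      by rewrite /inv6; ring.
    by rewrite hs hp /inv6 /t /a1 /a2; ring.
  transitivity (((t + 3%:R * a2 + 3%:R * a1) + (Y + Z)) * (((t + 3%:R * a2 + 3%:R * a1) + (Y + Z)) ^+ 3
     + 216%:R * ((t + 3%:R * a2 + 3%:R * a1) * (Y * Z)))); first by rewrite /inv12; ring.
  by rewrite hs hp /inv12 /t /a1 /a2; ring.
- by rewrite mul1r !peval_form24 /= !phi1 !phiw !mul1r !addr0 w3.
- by rewrite mul1r !peval_form24 /= !phi1 !phiw !mul1r !addr0 w3.
- by rewrite mul1r !peval_form24 /= !phi1 !phiw !mul1r !addr0 w3.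
Qed.

Lemma form24_gen_wf j : [/\ wf_forms (form24_gen j), wf_forms (form24_gen_inv j),
  comp_scalar (form24_gen j) (form24_gen_inv j) (form24_scalar j) & form24_scalar j <> q0].
Proof.
have [lt|ge] := ltnP j 7; last first.
  rewrite /form24_gen /form24_gen_inv /form24_scalar !nth_default //.
  by case: eqP ge => [->|_] // _; split.
by case: j lt => [|[|[|[|[|[|[|j]]]]]]] // _; split.
Qed.

Lemma form24_factor_neq0 j : form24_factor j != 0.
Proof. by rewrite /form24_factor; case: ifP => _; rewrite ?oner_neq0 // expf_neq0 // pnatr_eq0. Qed.

Lemma form24_symmetry j v : D4pt (pden form24) v -> D4pt (pden form24) (v *m forms_mx K (form24_gen j)).
Proof.
have [w1 w2 c s0] := form24_gen_wf j.
exact: (forms_symmetry w1 w2 c s0 (form24_factor_neq0 j) (form24_invariant j)).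
Qed.

(** The property of points of the plane x_4 = 0 that is carried along the symmetries preserving this
    plane, until the point lies on a coordinate line. *)
Definition crit24 (x y z : K) : Prop := \row_j tuple4 x y z 0 j != 0 ->
  (forall t, dp (\row_j tuple4 x y z 0 j) t (pden form24) = 0) -> D4pt (pden form24) (\row_j tuple4 x y z 0 j).

Lemma crit24_move j x y z x' y' z' :
  (forall i : 'I_4, lform (nth [::] (form24_gen j) i) (tuple4 x y z 0) = tuple4 x' y' z' 0 i) ->
  crit24 x' y' z' -> crit24 x y z.
Proof.
move=> hj hc n0 hd; have [w1 w2 c s0] := form24_gen_wf j.
have E : (\row_i tuple4 x y z 0 i) *m forms_mx K (form24_gen j) = \row_i tuple4 x' y' z' 0 i.
  apply/rowP => i; rewrite mul_forms_mx [RHS]mxE -hj; congr (lform _ _).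
  by apply: boolp.funext => k; rewrite mxE.
apply: (forms_symmetry_inv w1 w2 c s0 (form24_factor_neq0 j) (form24_invariant j)).
rewrite E; apply: hc => [|t]; rewrite -E; last first.
  exact: (forms_critical w1 w2 c s0 (form24_invariant j) hd).
apply: contraNneq n0 => vM; have uM := forms_unit K w1 w2 c s0.
by rewrite -[Y in Y == _](mulmxK uM) vM mul0mx.
Qed.

Lemma dp_form24 x y z t : dp (\row_j tuple4 x y z 0 j) t (pden form24) =
  t ord0 (idx 0) * grad_x x y z + t ord0 (idx 1) * grad_x y z x + t ord0 (idx 2) * grad_x z x y.
Proof.
rewrite dp_pden pdiff_form24; last by rewrite mxE.
by rewrite !mxE /grad_x /tuple4 /=; ring.
Qed.

Lemma crit24_edge x y : crit24 x y 0.
Proof.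
move=> n0 hd; have unit_t (i : nat) (k : 'I_4) : (delta_mx 0 (idx i) : 'rV[K]_4) ord0 k = (k == idx i)%:R by rewrite mxE.
have h0 := hd (delta_mx 0 (idx 0)); have h1 := hd (delta_mx 0 (idx 1)).
rewrite dp_form24 !unit_t /= mul1r !mul0r !addr0 in h0.
rewrite dp_form24 !unit_t /= mul1r !mul0r add0r addr0 in h1.
have h : (x ^+ 3) ^+ 2 + (y ^+ 3) ^+ 2 = 0.
  have z3 : (0 : K) ^+ 3 = 0 by rewrite expr0n.
  apply: grad24_edge.
    have [->|x0] := eqVneq x 0; first by rewrite z3 mul0r.
    have -> : grad24 (x ^+ 3) (y ^+ 3) 0 = 0; last by rewrite mulr0.
    by rewrite /grad_x z3 in h0; apply: mulr_eq0l h0; rewrite mulf_neq0 ?expf_neq0 ?nat_neq0.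
  have [->|y0] := eqVneq y 0; first by rewrite z3 mul0r.
  have -> : grad24 (y ^+ 3) 0 (x ^+ 3) = 0; last by rewrite mulr0.
  by rewrite /grad_x z3 in h1; apply: mulr_eq0l h1; rewrite mulf_neq0 ?expf_neq0 ?nat_neq0.
apply: form24_node; rewrite ?mxE /tuple4 //=.
apply: contraNneq n0 => x0; have y0 : y = 0.
  by apply: (@expr_eq0 y 2); apply: (@expr_eq0 _ 1); rewrite -[RHS]h x0; ring.
by rewrite x0 y0; apply/eqP/rowP; apply: ord4; rewrite !mxE.
Qed.

Lemma crit24_cyclic x y z : crit24 y z x -> crit24 x y z.
Proof.
by apply: (@crit24_move 0); apply: ord4; rewrite /tuple4 /= phi1 mul1r addr0.
Qed.

Lemma crit24_edges x y z : x * y * z = 0 -> crit24 x y z.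
Proof.
move/eqP; rewrite !mulf_eq0 => /orP[/orP[]|] /eqP ->; last exact: crit24_edge.
- exact/crit24_cyclic/crit24_edge.
- exact/crit24_cyclic/crit24_cyclic/crit24_edge.
Qed.

(** x^3 + y^3 + z^3 - 3 x y z is the product of the three Fourier forms, so the Fourier symmetry
    moves the point to the coordinate triangle. *)
Lemma crit24_fourier x y z : x ^+ 3 + y ^+ 3 + z ^+ 3 = 3%:R * (x * y * z) -> crit24 x y z.
Proof.
move=> h; have [ws wp] := omega_conj K; set w := omega K in ws wp; set w' := w ^+ 2 in ws wp.
apply: (@crit24_move 3 x y z (x + y + z) (x + w * y + w' * z) (x + w' * y + w * z)).
  by apply: ord4; rewrite /tuple4 /= ?phi1 ?phiw ?phiw2 ?mulr0 ?addr0 // !mul1r addrA.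
apply: crit24_edges; rewrite -mulrA.
have -> : (x + w * y + w' * z) * (x + w' * y + w * z) = x ^+ 2 + (w + w') * (x * (y + z))
  + (w * w') * (y ^+ 2 + z ^+ 2) + ((w + w') ^+ 2 - 2%:R * (w * w')) * (y * z) by ring.
rewrite ws wp; transitivity (x ^+ 3 + y ^+ 3 + z ^+ 3 - 3%:R * (x * y * z)); first by ring.
by rewrite h subrr.
Qed.

Lemma crit24_phase x y z : crit24 x y (omega K * z) -> crit24 x y z.
Proof.
apply: (@crit24_move 5 x y z x y (omega K * z)).
by apply: ord4; rewrite /tuple4 /= ?phi1 ?phiw ?mul1r ?addr0 ?mulr0.
Qed.

(* (x^3 + y^3 + z^3)^3 = 27 x^3 y^3 z^3 defines nine lines, which the symmetries carry to the coordinate axes. *)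
Lemma crit24_lines x y z :
  (x ^+ 3 + y ^+ 3 + z ^+ 3) ^+ 3 = 27%:R * (x ^+ 3 * y ^+ 3 * z ^+ 3) -> crit24 x y z.
Proof.
have [ws wp] := omega_conj K; set w := omega K in ws wp.
have w3 : w ^+ 3 = 1 by rewrite exprS.
set s := x ^+ 3 + y ^+ 3 + z ^+ 3; set q := 3%:R * (x * y * z) => h.
have : (s - q) * ((s - w * q) * (s - w ^+ 2 * q)) = 0.
  have -> : (s - w * q) * (s - w ^+ 2 * q) = s ^+ 2 - (w + w ^+ 2) * (s * q) + (w * w ^+ 2) * q ^+ 2 by ring.
  rewrite ws wp; transitivity (s ^+ 3 - 27%:R * (x ^+ 3 * y ^+ 3 * z ^+ 3)); first by rewrite /q; ring.
  by rewrite h subrr.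
move/eqP; rewrite !mulf_eq0 !subr_eq0 => /or3P[] /eqP e.
- exact: crit24_fourier.
- apply: crit24_phase; apply: crit24_fourier.
  by rewrite -/w exprMn w3 mul1r -/s e /q; ring.
- apply: crit24_phase; apply: crit24_phase; apply: crit24_fourier.
  have -> : (omega K * (omega K * z)) ^+ 3 = (w ^+ 3) ^+ 2 * z ^+ 3 by rewrite /w; ring.
  by rewrite w3 expr1n mul1r -/s e /q /w; ring.
Qed.

(* Rows (1,1,-1) - n, (-1,1,1), (1,-1,1), n with n = (n1, n2, n3, 1). *)
Definition triangle_tilt (n1 n2 n3 : Z) : forms :=
  [:: [:: (qint (1 - n1)%BZ, 0); (qN1, 1); (q1, 2); (qint n1, 3)];
      [:: (qint (1 - n2)%BZ, 0); (q1, 1); (qN1, 2); (qint n2, 3)];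
      [:: (qint (- 1 - n3)%BZ, 0); (q1, 1); (q1, 2); (qint n3, 3)];
      [:: (qN1, 0); (q1, 3)]]%N.

Definition triangle_tilt_inv (n1 n2 n3 : Z) : forms :=
  [:: [:: (q1, 0); (q1, 1); (qint (- n1 - n2)%BZ, 3)];
      [:: (q1, 1); (q1, 2); (qint (- n2 - n3)%BZ, 3)];
      [:: (q1, 2); (q1, 0); (qint (- n3 - n1)%BZ, 3)];
      [:: (q1, 0); (q1, 1); (qint (2 - n1 - n2)%BZ, 3)]]%N.

Local Arguments Z.sub : simpl never.
Local Arguments Z.opp : simpl never.
Lemma form24_toric n1 n2 n3 : toric_critical_D4 (forms_mx K (triangle_tilt n1 n2 n3)) (pden form24).
Proof.
have tiltE a b c : (fun j : 'I_4 => lform (nth [::] (triangle_tilt n1 n2 n3) j) (tuple4 a b c a)) =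
    tuple4 (a - b + c) (a + b - c) (b + c - a) 0.
  apply: boolp.funext; apply: ord4; rewrite /tuple4 /= ?(phi_int, phi1, phiN1, zKB, zKN, zK1); ring.
apply: toric_critical_plane => y0 y1 y2 n0 x; rewrite /x !tiltE => {x}.
set x := y0 - y1 + y2; set y := y0 + y1 - y2; set z := y1 + y2 - y0.
have pd a b c : pdiff (tuple4 x y z 0) (tuple4 a b c 0) form24 =
    a * grad_x x y z + b * grad_x y z x + c * grad_x z x y.
  by rewrite pdiff_form24 // /grad_x /tuple4 /=; ring.
rewrite !pd => h0 h1 h2.
have y00 : y0 != 0.
  apply: contraTneq n0 => e; rewrite e eqxx /= negb_or !negbK.
  have ex : x = y2 - y1 by rewrite /x e; ring.
  have ey : y = y1 - y2 by rewrite /y e; ring.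
  have ez : z = y1 + y2 by rewrite /z e; ring.
  have [||-> ->] := @boundary24 y1 y2; last by rewrite eqxx.
  - by rewrite -ex -ey -ez -[RHS]h1; ring.
  - by rewrite -ex -ey -ez -[RHS]h2; ring.
have y10 : y1 != 0.
  apply: contraNneq y00 => e.
  have ex : x = y2 + y0 by rewrite /x e; ring.
  have ey : y = y0 - y2 by rewrite /y e; ring.
  have ez : z = y2 - y0 by rewrite /z e; ring.
  have [||_ ->] := @boundary24 y2 y0; last by rewrite eqxx.
  - by rewrite -ex -ey -ez -[RHS]h2; ring.
  - by rewrite -ex -ey -ez -[RHS]h0; ring.
have y20 : y2 != 0.
  apply: contraNneq y00 => e.
  have ex : x = y0 - y1 by rewrite /x e; ring.
  have ey : y = y0 + y1 by rewrite /y e; ring.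
  have ez : z = y1 - y0 by rewrite /z e; ring.
  have [||-> _] := @boundary24 y0 y1; last by rewrite eqxx.
  - by rewrite -ex -ey -ez -[RHS]h0; ring.
  - by rewrite -ex -ey -ez -[RHS]h1; ring.
split => //.
have {}h0 := mulr_eq0l y00 h0; have {}h1 := mulr_eq0l y10 h1; have {}h2 := mulr_eq0l y20 h2.
have {}h0 : grad_x x y z + grad_x y z x - grad_x z x y = 0 by rewrite -[RHS]h0; ring.
have {}h1 : - grad_x x y z + grad_x y z x + grad_x z x y = 0 by rewrite -[RHS]h1; ring.
have {}h2 : grad_x x y z - grad_x y z x + grad_x z x y = 0 by rewrite -[RHS]h2; ring.
have half (a b c : K) : 2%:R * a = b + c -> b = 0 -> c = 0 -> a = 0.
  by move=> e b0 c0; apply: (mulr_eq0l (nat_neq0 1)); rewrite e b0 c0 addr0.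
have gx : grad_x x y z = 0 by apply: half h0 h2; ring.
have gy : grad_x y z x = 0 by apply: half h0 h1; ring.
have gz : grad_x z x y = 0 by apply: half h1 h2; ring.
(* The derivative along x_4 vanishes as well, since x_4 occurs only through its cube: the whole
   differential is 0. *)
have hd t : dp (\row_j tuple4 x y z 0 j) t (pden form24) = 0 by rewrite dp_form24 gx gy gz !mulr0 !addr0.
have r0 : \row_j tuple4 x y z 0 j != 0 :> 'rV[K]_4.
  apply: contraNneq y00 => /rowP r0.
  have := r0 (idx 0); have := r0 (idx 1); rewrite !mxE /tuple4 /= => hy hx.
  by apply/eqP/(mulr_eq0l (nat_neq0 1)); rewrite -[RHS](addr0 0) -{1}hx -hy /x /y; ring.
suff : crit24 x y z by apply.
have [/crit24_edges //|xyz] := eqVneq (x * y * z) 0.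
have [/crit24_lines //|J0] := eqVneq ((x ^+ 3 + y ^+ 3 + z ^+ 3) ^+ 3) (27%:R * (x ^+ 3 * y ^+ 3 * z ^+ 3)).
exfalso; move: xyz; rewrite !mulf_eq0 !negb_or => /andP[/andP[x0 y0'] z0].
have g0 (a b c : K) : a != 0 -> grad_x a b c = 0 -> grad24 (a ^+ 3) (b ^+ 3) (c ^+ 3) = 0.
  by move=> a0; apply: mulr_eq0l; rewrite mulf_neq0 ?expf_neq0 ?nat_neq0.
have [/expr_eq0 e _ _] := grad24_eq0 (g0 _ _ _ x0 gx) (g0 _ _ _ y0' gy) (g0 _ _ _ z0 gz) J0.
by rewrite e eqxx in x0.
Qed.

(** The starting point (1, i, 0, 0) satisfies the equation of [form24_node]. The tree is certified
    by the number of its points and the distinctness of their codes. *)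
Definition form24_points := orbit_points form24_gen [:: q1; qi; q0; q0]
  ([:: (0, [:: 0]); (1, [:: 1]); (2, [:: 3]); (3, [:: 4; 3]); (3, [:: 0]); (4, [:: 1]); (5, [:: 2]); (6, [:: 5;
    3]); (6, [:: 0]); (7, [:: 3]); (8, [:: 4; 3]); (8, [:: 1]); (9, [:: 2]); (9, [:: 2]); (9, [:: 2]); (9, [::
    2]); (9, [:: 0]); (10, [:: 3]); (10, [:: 2]); (10, [:: 2]); (10, [:: 2]); (10, [:: 2]); (10, [:: 2]); (10, [::
    0]); (11, [:: 3]); (12, [:: 4; 3]); (12, [:: 0]); (13, [:: 3]); (14, [:: 4; 3]); (13, [:: 3]); (13, [:: 1]);
    (13, [:: 2]); (13, [:: 0]); (14, [:: 3]); (15, [:: 4; 3]); (14, [:: 0]); (15, [:: 3]); (16, [:: 4; 3]); (16,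
    [:: 0]); (17, [:: 3]); (18, [:: 4; 3]); (18, [:: 0]); (19, [:: 3]); (20, [:: 4; 3]); (20, [:: 0]); (21, [::
    1]); (22, [:: 5; 3]); (22, [:: 1]); (23, [:: 2]); (23, [:: 2]); (23, [:: 0]); (24, [:: 1]); (25, [:: 5; 3]);
    (25, [:: 2]); (26, [:: 5; 3]); (26, [:: 2]); (26, [:: 2]); (25, [:: 0]); (26, [:: 4; 3]); (27, [:: 5; 3]);
    (27, [:: 0]); (28, [:: 1]); (29, [:: 5; 3]); (29, [:: 1]); (27, [:: 2]); (27, [:: 2]); (26, [:: 2]); (26, [::
    2]); (24, [:: 2]); (21, [:: 2]); (21, [:: 0]); (22, [:: 3]); (23, [:: 4; 3]); (24, [:: 5; 3]); (24, [:: 5;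
    3]); (19, [:: 5; 3]); (19, [:: 3]); (19, [:: 0]); (15, [:: 2])])%N
  3 (free_coords 3).

(** Modulo 3001 the residue 934 is a primitive cube root of unity and 1353 a square root of -1. The
    vertex is n = (-2, 0, -1, 1). *)
Lemma form24_points_distinct : distinct_codes 3001 934 1353 (triangle_tilt_inv (-2)%BZ 0%BZ (-1)%BZ) 1440 form24_points.
Proof. by vm_compute. Qed.

Lemma form24_points_D4 x : x \in form24_points -> D4pt (pden form24) (vec K x).
Proof.
apply: orbit_points_D4.
  have i2 : ('i ^+ 3) ^+ 2 = -1 :> K by rewrite exprAC sqrCi -signr_odd.
  by apply: form24_node; rewrite !mxE /= ?phi0 ?phi1 ?phii ?oner_neq0 // !expr1n i2 subrr.
move=> j; have [w1 _ _ _] := form24_gen_wf j.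
apply: preserves_forms_symmetry w1 _ => v; exact: form24_symmetry.
Qed.
End Degree24.

Theorem mu_D4_form24 (R : realType) k : (1 <= k)%N -> (((1440 * k ^ 3)%N%:R)%:E <= mu_D4 R (24 * k)%N)%E.
Proof.
have nz : qint 2 <> q0 by [].
have [v [hv v0 vinj]] := @distinct_codesP (Cplx R) 3001 934 1353 291 610 (triangle_tilt_inv (-2)%BZ 0%BZ (-1)%BZ)
  (triangle_tilt (-2)%BZ 0%BZ (-1)%BZ) (qint 2) 1440 _ erefl erefl erefl erefl erefl nz form24_points_distinct.
apply: (@mu_D4_power_cover _ (pden (form24 (Cplx R))) _ 24 1440 v isT _ _ _ _ v0 vinj).
- exact: pden_homog.
- exact: (@forms_unit _ _ (triangle_tilt_inv (-2)%BZ 0%BZ (-1)%BZ) (qint 2)).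
- exact: form24_toric.
- by move=> j; have [x hx ->] := hv j; exact: form24_points_D4.
Qed.

Theorem mainTheorem3 (R : realType) :
  [/\ ((48%:R)%:E <= mu_D4 R 8)%E,
      ((160%:R)%:E <= mu_D4 R 12)%E
    & ((1440%:R)%:E <= mu_D4 R 24)%E] /\
  (forall k : nat, (1 <= k)%N ->
    [/\ (((48 * k ^ 3)%N%:R)%:E <= mu_D4 R (8 * k)%N)%E,
        (((160 * k ^ 3)%N%:R)%:E <= mu_D4 R (12 * k)%N)%E
      & (((1440 * k ^ 3)%N%:R)%:E <= mu_D4 R (24 * k)%N)%E]).
Proof.
have H k : (1 <= k)%N ->
    [/\ (((48 * k ^ 3)%N%:R)%:E <= mu_D4 R (8 * k)%N)%E,
        (((160 * k ^ 3)%N%:R)%:E <= mu_D4 R (12 * k)%N)%E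
      & (((1440 * k ^ 3)%N%:R)%:E <= mu_D4 R (24 * k)%N)%E].
  by move=> k0; split; [exact: mu_D4_octic|exact: mu_D4_duodecic|exact: mu_D4_form24].
by split=> //; have := H 1%N isT; rewrite exp1n !muln1.
Qed.
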